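(* Let $\Psi\in\mathfrak F^*$ with $B^2_\Psi=1$, $\tau>0$, $\eta(k)=\tfrac12N^{1-\alpha}\sqrt{1+k/N}$ and $\Gamma=(\log N)^2$. For all $1/3<\alpha<1$, the rescaled correlation kernel of the modified GUE satisfies $$N^{-\alpha}K^N_{\Psi,\alpha}(xN^{-\alpha},yN^{-\alpha})\cong L^N_{\Psi,\eta}(x,y),$$ i.e. these two families of kernels are asymptotically equivalent.
   Context: Shapes: $\mathfrak F$ is the set of (differentiable) functions $\Psi:\mathbb R\to[0,1]$ such that $\Psi'\le 0$ is Riemann integrable, $\Psi\in L^1(0,\infty)$ and $1-\Psi\in L^1(-\infty,0)$; $\mathfrak F^*$ is the set of $\Psi\in\mathfrak F$ such that $\Phi:=-\Psi'$ satisfies $\Phi(x)\le e^{-c|x|}$ for some $c>0$. $B^2_\Psi=\int_{\mathbb R}\Psi(1-\Psi)\,dx$. Modified GUE kernel: let $h_k$ be the orthonormal Hermite polynomial of degree $k$ with respect to $e^{-x^2}$ on $\mathbb R$, $c_N=\pi\sqrt N/\sqrt2$, $\varphi_k(x)=\sqrt{c_N}\,h_k(c_Nx)e^{-(c_Nx)^2/2}$. For $N>0$, $K^N_{\Psi,\alpha}(x,y)=\sum_{k=0}^\infty\Psi\bigl(\frac{k-N}{\tau N^\alpha}\bigr)\varphi_k(x)\varphi_k(y)$. Kernel $L$: for $k\in\mathbb Z$ let $\xi_k\in(0,1)$ be such that $\frac1{\tau N^\alpha}\Phi\bigl(\frac{k+\xi_k}{\tau N^\alpha}\bigr)=\Psi\bigl(\frac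 k{\tau N^\alpha}\bigr)-\Psi\bigl(\frac{k+1}{\tau N^\alpha}\bigr)$ (mean value theorem), and $$L^N_{\Psi,\eta}(x,y)=\frac1{\tau N^\alpha}\sum_{k\in\mathbb Z,\ |k|\le\Gamma N^\alpha}\Phi\Bigl(\frac{k+\xi_k}{\tau N^\alpha}\Bigr)\frac{\sin[2\pi\eta(k)(x-y)]}{\pi(x-y)}.$$ Asymptotic equivalence: two families of kernels $(K^N)_{N>0}$, $(L^N)_{N>0}$ on $\mathbb R$ are asymptotically equivalent, $K^N\cong L^N$, if for every $\ell\in\mathbb N$ and all $f_1,\dots,f_\ell\in C_0^\infty(\mathbb R)$ (smooth, compactly supported), $$\lim_{N\to\infty}\operatorname{Tr}[f_1K^N\cdots f_\ell K^N]=\lim_{N\to\infty}\operatorname{Tr}[f_1L^N\cdots f_\ell L^N],$$ where $\operatorname{Tr}[f_1K\cdots f_\ell K]=\int_{\mathbb R^\ell}f_1(x_1)K(x_1,x_2)f_2(x_2)\cdots f_\ell(x_\ell)K(x_\ell,x_1)\,dx_1\cdots dx_\ell$. *)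

(* Defs.v *)
From HB Require Import structures.
From mathcomp Require Import all_boot all_order all_algebra.
From mathcomp Require Import all_classical all_reals all_analysis.
Set Implicit Arguments.
Unset Strict Implicit.
Unset Printing Implicit Defensive.
Import Order.TTheory GRing.Theory Num.Theory.
Import numFieldTopology.Exports numFieldNormedType.Exports.
Local Open Scope classical_set_scope.
Local Open Scope ring_scope.

Section riemann.
Context {R : realType}.
Implicit Types (f : R -> R) (a b : R).

(* Limit of Riemann sums over the tagged partitions
   a = x 0 < ... < x n = b with tags t i in [x i, x i.+1], as the mesh tends
   to 0. *)
Definition is_riemann_integral f a b (I : R) : Prop :=
  forall e : R, 0 < e -> exists2 d : R, 0 < d &
    forall (n : nat) (x t : nat -> R),
      x 0%N = a -> x n = b ->
      (forall i, (i < n)%N ->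
        [/\ x i < x i.+1, x i.+1 - x i < d & x i <= t i <= x i.+1]) ->
      `|\sum_(i < n) f (t i) * (x i.+1 - x i) - I| < e.

(* Integrability on the whole line: integrable on every segment, with a
   convergent improper integral. *)
Definition riemann_integrable_line f : Prop :=
  (forall a b, a < b -> exists I, is_riemann_integral f a b I) /\
  exists J : R, forall e : R, 0 < e -> exists M : R,
    forall a b I, a < - M -> M < b -> a < b ->
      is_riemann_integral f a b I -> `|I - J| < e.

End riemann.

Section shapes.
Context {R : realType}.
Let mu := @lebesgue_measure R.
Implicit Type Psi : R -> R.

Definition Phi Psi : R -> R := fun x => - (Psi^`()%classic x).

Record is_shape Psi : Prop := Shape {
  shape_itv : forall x, 0 <= Psi x <= 1 ;
  shape_derivable : forall x, derivable Psi x 1 ;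
  shape_derive_le0 : forall x, Psi^`()%classic x <= 0 ;
  shape_derive_riemann : riemann_integrable_line Psi^`()%classic ;
  shape_L1_right : mu.-integrable `]0, +oo[ (fun x => (Psi x)%:E) ;
  shape_L1_left : mu.-integrable `]-oo, 0[ (fun x => (1 - Psi x)%:E) }.

Definition is_shape_star Psi : Prop :=
  is_shape Psi /\
  exists2 c : R, 0 < c & forall x, Phi Psi x <= expR (- (c * `|x|)).

Definition B2 Psi : \bar R := (\int[mu]_x (Psi x * (1 - Psi x))%:E)%E.

End shapes.

Section kernels.
Context {R : realType}.
Let mu := @lebesgue_measure R.

(* The sign of h k is fixed by the usual convention of a positive leading
   coefficient, so that these conditions determine h. *)
Definition orthonormal_hermite (h : nat -> {poly R}) : Prop :=
  (forall k, size (h k) = k.+1 /\ 0 < lead_coef (h k)) /\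
  forall j k, (\int[mu]_x ((h j).[x] * (h k).[x] * expR (- x ^+ 2))%:E
               = ((j == k)%:R : R)%:E)%E.

Definition cN (N : R) : R := pi * Num.sqrt N / Num.sqrt 2.

Definition phi (h : nat -> {poly R}) (N : R) (k : nat) (x : R) : R :=
  Num.sqrt (cN N) * (h k).[cN N * x] * expR (- ((cN N * x) ^+ 2 / 2)).

Definition gue_kernel (h : nat -> {poly R}) (Psi : R -> R)
    (tau alpha N x y : R) : R :=
  limn (series (fun k : nat =>
    Psi ((k%:R - N) / (tau * N `^ alpha)) * phi h N k x * phi h N k y)).

Definition rescaled_gue_kernel (h : nat -> {poly R}) (Psi : R -> R)
    (tau alpha N x y : R) : R :=
  N `^ (- alpha) *
  gue_kernel h Psi tau alpha N (x * N `^ (- alpha)) (y * N `^ (- alpha)).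

(* sin [2 pi s (x - y)] / (pi (x - y)), extended by continuity to the diagonal
   (which matters for traces with a single factor). *)
Definition sine_kernel (s x y : R) : R :=
  if x == y then 2 * s else sin (2 * pi * s * (x - y)) / (pi * (x - y)).

Definition mean_value_points (Psi : R -> R) (tau alpha N : R)
    (xi : int -> R) : Prop :=
  forall k : int, 0 < xi k < 1 /\
    (tau * N `^ alpha)^-1 * Phi Psi ((k%:~R + xi k) / (tau * N `^ alpha))
    = Psi (k%:~R / (tau * N `^ alpha)) - Psi ((k + 1)%:~R / (tau * N `^ alpha)).

Definition L_kernel (Psi : R -> R) (tau alpha Gamma : R) (eta xi : int -> R)
    (N x y : R) : R :=
  (tau * N `^ alpha)^-1 *
  \sum_(k \in [set k : int | `|k|%:~R <= Gamma * N `^ alpha])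
    Phi Psi ((k%:~R + xi k) / (tau * N `^ alpha)) * sine_kernel (eta k) x y.

End kernels.

Section asymptotic_equivalence.
Context {R : realType}.
Let mu := @lebesgue_measure R.

Definition smooth_compact_support (f : R -> R) : Prop :=
  (forall n x, derivable (derive1n n f) x 1) /\
  compact (closure [set x | f x != 0]).

(* Integral over R^n as an iterated Lebesgue integral dx_n ... dx_1; it is used
   for continuous compactly supported integrands, where Fubini applies. *)
Fixpoint integral_Rn (n : nat) : (n.-tuple R -> R) -> R :=
  match n with
  | 0%N => fun F => F [tuple]
  | n'.+1 => fun F =>
      (\int[mu]_x integral_Rn (fun t : n'.-tuple R => F [tuple of x :: t]))%R
  end.

Definition kernel_trace (l : nat) (f : 'I_l -> R -> R) (K : R -> R -> R) : R :=
  integral_Rn (fun t : l.-tuple R =>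
    \prod_(i < l) (f i (tnth t i) * K (tnth t i) (tnth t (ordS i)))).

(* In general the traces diverge as N grows (already for a single factor they
   are of the order of the density of the particles), so equality of their
   limits is expressed by their difference tending to 0; see
   asymptotically_equivalent_lim for the consequence on limits proper. *)
Definition asymptotically_equivalent (K L : R -> R -> R -> R) : Prop :=
  forall (l : nat) (f : 'I_l -> R -> R),
    (forall i, smooth_compact_support (f i)) ->
    kernel_trace f (K N) - kernel_trace f (L N) @[N --> +oo] --> (0 : R).

Lemma asymptotically_equivalent_sym K L :
  asymptotically_equivalent K L -> asymptotically_equivalent L K.
Proof.
move=> KL l f fs; rewrite -oppr0.
rewrite (_ : (fun N => _) = (fun N => - (kernel_trace f (K N) - kernel_trace f (L N)))).
  by apply: cvgN; exact: KL.
by apply/funext => N; rewrite opprB.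
Qed.

Lemma asymptotically_equivalent_lim K L :
  asymptotically_equivalent K L ->
  forall (l : nat) (f : 'I_l -> R -> R),
    (forall i, smooth_compact_support (f i)) ->
  forall c : \bar R,
    (kernel_trace f (K N))%:E @[N --> +oo] --> c <->
    (kernel_trace f (L N))%:E @[N --> +oo] --> c.
Proof.
have H K' L' : asymptotically_equivalent K' L' ->
  forall (l : nat) (f : 'I_l -> R -> R),
    (forall i, smooth_compact_support (f i)) ->
  forall c : \bar R, (kernel_trace f (L' N))%:E @[N --> +oo] --> c ->
    (kernel_trace f (K' N))%:E @[N --> +oo] --> c.
  move=> KL l f fs c Lc; rewrite -[c]adde0.
  rewrite (_ : (fun N => _) = (fun N => (kernel_trace f (L' N))%:E +
      (kernel_trace f (K' N) - kernel_trace f (L' N))%:E)%E); last first.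
    by apply/funext => N; rewrite -EFinD addrC subrK.
  apply: cvgeD => //; first by rewrite fin_num_adde_defl.
  by apply: cvg_EFin; [exact: nearW | exact: KL].
move=> KL l f fs c; split; apply: H => //.
exact: asymptotically_equivalent_sym.
Qed.

End asymptotic_equivalence.

(* Main.v *)
(* Let [psi_k = h_k(u) exp(-u^2/2)] and let [S_n = sum_(j<n) psi_j(u) psi_j(v)]
   be the Christoffel-Darboux kernel. Abel summation writes the kernel [K] as an
   average of the [S_n] with the weights [Psi(k) - Psi(k+1)], which are the
   weights of the kernel [L]; so it suffices to compare [S_n], rescaled, with a
   sine kernel, uniformly on compact sets.

   This is done for the symmetrized kernel [S_n + psi_n psi_n / 2], whose
   derivative along the diagonal direction is [- (u + v)/2 psi_n(u) psi_n(v)],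
   hence small. On the antidiagonal [v = -u] parity reduces it to
   [psi_n psi_n' / u], and [psi_n psi_n'] is controlled by viewing [psi_n] as a
   perturbation of the harmonic oscillator of frequency [sqrt(2n+1)]. The
   amplitude is determined at the origin by Wallis' estimates. The cutoff
   [Gamma = (log N)^2] makes the exponentially small tails of [Psi] beat every
   power of [N]. This gives [|K - L| = O(N^-d)] with [d = (3 alpha - 1)/2 > 0],
   uniformly on compact sets.

   Both kernels are bounded by a multiple of [1/(1/N^2 + |x - y|)], the inverse
   of a quantity satisfying the triangle inequality. Iterating such kernels on a
   compact set costs only powers of [log N], so the traces differ by
   [O(N^-d (log N)^l)]. *)
Require Import Defs.
From HB Require Import structures.
From mathcomp Require Import all_boot all_order all_algebra ring lra zify.
From mathcomp Require Import all_classical all_reals all_analysis.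
From mathcomp Require Import measurable_realfun.
Set Implicit Arguments.
Unset Strict Implicit.
Unset Printing Implicit Defensive.
Import Order.TTheory GRing.Theory Num.Theory.
Import numFieldTopology.Exports numFieldNormedType.Exports.
Local Open Scope classical_set_scope.
Local Open Scope ring_scope.

(** * Orthogonal polynomials and Hermite functions *)

(** The threshold 1/3 comes from the curvature of the density near the origin. Points of a fixed
    compact set become Hermite variables of size X of order b = N^(1/2 - alpha), and moving to the
    antidiagonal costs X^2 / sqrt N. The kernel carries one more factor of order b, so the error is
    b^3 / sqrt N = N^(1 - 3 alpha).

    No asymptotics of individual Hermite functions is needed: on the diagonal, twice the symmetrized
    kernel is the energy of the oscillator solved by psi_n, and it is maximal at the origin, where
    it is explicit. This a priori bound controls every error term.

    Two mismatches survive Abel summation. As N is real, the weights of K are sampled at points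
    shifted by the fractional part of N from those of L; the two sequences of values of Psi
    interlace, which suffices against slowly varying frequencies. Moreover the frequency of S_n
    agrees with that of L only up to a bounded shift under the square root. *)

Section lambda_alg.
Context {R : realType}.
(** Stands for the integral of [p] against exp(-x^2). The ladder relations follow algebraically from
    linearity, integration by parts and orthonormality. *)
Variable Lam : {poly R} -> R.
Hypothesis LamD : forall p q, Lam (p + q) = Lam p + Lam q.
Hypothesis LamZ : forall a p, Lam (a *: p) = a * Lam p.
Hypothesis Lam_deriv : forall p, Lam p^`() = Lam (2 *: 'X * p).
Variable h : nat -> {poly R}.
Hypothesis size_h : forall k, size (h k) = k.+1.
Hypothesis lead_h : forall k, 0 < lead_coef (h k).
Hypothesis ortho_h : forall j k, Lam (h j * h k) = (j == k)%:R.

Lemma expand_in_graded_family n (q : {poly R}) : (size q <= n)%N ->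
  exists a : 'I_n -> R, q = \sum_(j < n) a j *: h j.
Proof.
elim: n q => [|n IH] q.
  by rewrite leqn0 size_poly_eq0 => /eqP ->; exists (fun=> 0); rewrite big_ord0.
move=> sq; have lh0 : (h n)`_n != 0.
  by have := lead_h n; rewrite lead_coefE size_h /= => /gt_eqF ->.
pose c := q`_n / (h n)`_n.
have [|a qa] := IH (q - c *: h n).
  apply/leq_sizeP => j; rewrite leq_eqVlt => /predU1P[<-|nj].
    by rewrite coefB coefZ /c divfK ?subrr.
  rewrite coefB coefZ !nth_default ?mulr0 ?subr0 ?size_h//.
  exact: leq_trans sq nj.
exists (fun i => if unlift ord_max i is Some j then a j else c).
rewrite big_ord_recr/= unlift_none -[LHS](subrK (c *: h n)) qa; congr (_ + _).
by apply: eq_bigr => i _; rewrite -[widen_ord _ _]/(widen_ord (leqnSn n) i)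
  (_ : widen_ord _ i = lift ord_max i) ?liftK//; apply/val_inj; rewrite /= /bump leqNgt ltn_ord.
Qed.

Lemma Lam_sum n (F : 'I_n -> {poly R}) : Lam (\sum_(i < n) F i) = \sum_(i < n) Lam (F i).
Proof.
have Lam0 : Lam 0 = 0 by rewrite -[X in Lam X](scale0r (1 : {poly R})) LamZ mul0r.
elim: n F => [|n IH] F; first by rewrite !big_ord0.
by rewrite !big_ord_recr/= LamD IH.
Qed.

Lemma orthonormal_expand n (q : {poly R}) : (size q <= n)%N ->
  q = \sum_(j < n) Lam (q * h j) *: h j.
Proof.
move=> /expand_in_graded_family[a ->]; apply: eq_bigr => j _.
congr (_ *: _); rewrite mulr_suml Lam_sum (bigD1 j)//= -scalerAl LamZ ortho_h eqxx mulr1.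
rewrite big1 ?addr0// => i ij; rewrite -scalerAl LamZ ortho_h.
by rewrite (_ : (_ == _) = false) ?mulr0//; apply/negbTE.
Qed.

Lemma ortho_low n (q : {poly R}) : (size q <= n)%N -> Lam (h n * q) = 0.
Proof.
move=> /expand_in_graded_family[a ->]; rewrite mulr_sumr Lam_sum big1// => i _.
by rewrite -scalerAr LamZ ortho_h gtn_eqF ?mulr0.
Qed.

(** Integration by parts makes p -> 2 X p - p' adjoint to differentiation ([adj] below). By degree,
    each left-hand side is then orthogonal to all but one of the [h i] in its expansion, and
    adjointness gives both the same coefficient. *)
Lemma hermite_step n : exists c : R,
  2 *: 'X * h n - (h n)^`() = c *: h n.+1 /\ (h n.+1)^`() = c *: h n.
Proof.
pose c := Lam (h n * (h n.+1)^`()); exists c.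
have adj m p : Lam ((2 *: 'X * h m - (h m)^`()) * p) = Lam (h m * p^`()).
  have := Lam_deriv (h m * p); rewrite derivM LamD => /eqP.
  rewrite mulrBl LamD -[- ((h m)^`() * p)]scaleN1r LamZ mulN1r addrC eq_sym => /eqP.
  by rewrite -mulrA => ->; rewrite addrK.
have sd m : (size (h m)^`() <= m)%N.
  by rewrite -ltnS -(size_h m) lt_size_deriv// -size_poly_gt0 size_h.
have sX m : (size (2 *: 'X * h m - (h m)^`())%R <= m.+2)%N.
  apply: (leq_trans (size_polyD _ _)); rewrite geq_max size_polyN; apply/andP; split.
    rewrite -scalerAl; apply: (leq_trans (size_scale_leq _ _)).
    by rewrite mulrC size_mulX -?size_poly_gt0 size_h.
  by apply: (leq_trans (sd m)); rewrite -addn2 leq_addr.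
split.
  rewrite (orthonormal_expand (sX n)) big_ord_recr/= big1 ?add0r ?adj//.
  by move=> i _; rewrite adj ortho_low ?scale0r// (leq_trans (sd i))// -ltnS.
rewrite (orthonormal_expand (sd n.+1)) big_ord_recr/= big1 ?add0r => [|i _].
  by rewrite mulrC.
rewrite mulrC -adj mulrC ortho_low ?scale0r//.
by apply: (leq_trans (sX i)); rewrite ltnS.
Qed.

(** Comparing leading coefficients in both relations gives c^2 = 2 (n + 1); positivity of the
    leading coefficients selects the root. *)
Lemma hermite_ladder n :
  2 *: 'X * h n - (h n)^`() = Num.sqrt (2 * n.+1%:R) *: h n.+1 /\
  (h n.+1)^`() = Num.sqrt (2 * n.+1%:R) *: h n.
Proof.
have [c [c1 c2]] := hermite_step n.
have lh m : lead_coef (h m) = (h m)`_m by rewrite lead_coefE size_h.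
have l1 := lead_h n.+1; have l0 := lead_h n; rewrite !lh in l1 l0.
have e1 : 2 * (h n)`_n = c * (h n.+1)`_n.+1.
  have := congr1 (fun p : {poly R} => p`_n.+1) c1.
  rewrite /= coefZ coefB coef_deriv -scalerAl coefZ coefXM/= [(h n)`_n.+2]nth_default ?mul0rn ?subr0//.
  by rewrite size_h leqW.
have e2 : n.+1%:R * (h n.+1)`_n.+1 = c * (h n)`_n.
  by have := congr1 (fun p : {poly R} => p`_n) c2; rewrite /= coefZ coef_deriv mulr_natl.
have c0 : 0 < c.
  by have : 0 < c * (h n.+1)`_n.+1; [rewrite -e1 mulr_gt0|rewrite pmulr_lgt0].
suff -> : Num.sqrt (2 * n.+1%:R) = c by [].
rewrite -[RHS]ger0_norm ?ltW// -sqrtr_sqr; congr Num.sqrt.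
apply: (mulIf (x := (h n)`_n * (h n.+1)`_n.+1)).
  by rewrite mulf_neq0// gt_eqF.
by transitivity ((2 * (h n)`_n) * (n.+1%:R * (h n.+1)`_n.+1)); [ring|rewrite e1 e2; ring].
Qed.

End lambda_alg.

(** * Integration by parts against the Gaussian weight *)

Section calculus.
Context {R : realType}.
Notation mu := (@lebesgue_measure R).

Lemma ftc_segment (F f : R -> R) (a b : R) : a < b ->
  (forall x, a <= x <= b -> is_derive x 1 F (f x)) ->
  (forall x, a <= x <= b -> {for x, continuous f}) ->
  (\int[mu]_(x in `[a, b]) (f x)%:E = (F b - F a)%:E)%E.
Proof.
move=> ab dF cf.
have inab x : x \in `[a, b]%classic -> a <= x <= b by rewrite inE/= in_itv.
have Fc x : a <= x <= b -> {for x, continuous F}.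
  by move=> /dF Fx; apply/differentiable_continuous/derivable1_diffP.
rewrite (@continuous_FTC2 _ f F)//.
- by apply: continuous_in_subspaceT => x /inab /cf.
- split => [x|  |].
  + by rewrite in_itv/= => /andP[ax xb]; have [] := dF x; rewrite ?ltW.
  + by apply: cvg_at_right_filter; apply: Fc; rewrite lexx ltW.
  + by apply: cvg_at_left_filter; apply: Fc; rewrite lexx ltW.
- move=> x; rewrite in_itv/= => /andP[ax xb].
  have xab : a <= x <= b by rewrite !ltW.
  by rewrite derive1E; have := dF x xab => ?; rewrite derive_val.
Qed.

Lemma monomial_le_expR (k : nat) : exists2 C : R, 0 <= C & forall x : R, `|x| ^+ k <= C * expR (x ^+ 2 / 2).
Proof.
(* The 1 takes care of |x| <= 1; 2^k k! comes from keeping only the k-th Taylor term of exp(x^2 /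
   2). *)
exists (1 + 2 ^+ k * k`!%:R); first by rewrite addr_ge0// mulr_ge0// exprn_ge0.
move=> x; have e1 : 1 <= expR (x ^+ 2 / 2).
  by rewrite -expR0 ler_expR divr_ge0// sqr_ge0.
have h : `|x| ^+ k <= 1 + (x ^+ 2) ^+ k.
  have [x1|x1] := leP `|x| 1.
    by rewrite (@le_trans _ _ 1) ?exprn_ile1// lerDl exprn_ge0// sqr_ge0.
  apply: (@le_trans _ _ ((x ^+ 2) ^+ k)); last by rewrite lerDr.
  by rewrite -(real_normK (num_real x)) lerXn2r ?nnegrE ?exprn_ge0// ler_eXnr// ltW.
apply: (le_trans h); rewrite mulrDl mul1r lerD//.
case: k {h} => [|k]; first by rewrite !expr0 fact0 !mul1r.
have := @expR_ge1Dxn _ (x ^+ 2 / 2) k; rewrite divr_ge0 ?sqr_ge0// => /(_ isT) h.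
have {}h : (x ^+ 2 / 2) ^+ k.+1 / (k.+1)`!%:R <= expR (x ^+ 2 / 2).
  by apply: le_trans h; rewrite lerDr.
rewrite ler_pdivrMr ?ltr0n ?fact_gt0// expr_div_n ler_pdivrMr ?exprn_gt0// in h.
by apply: (le_trans h); rewrite le_eqVlt; apply/orP; left; apply/eqP; ring.
Qed.

Lemma poly_le_expR (p : {poly R}) : exists2 C : R, 0 <= C & forall x : R, `|p.[x]| <= C * expR (x ^+ 2 / 2).
Proof.
pose C k := projT1 (cid2 (monomial_le_expR k)).
have C0 k : 0 <= C k by rewrite /C; case: cid2.
have CE k x : `|x| ^+ k <= C k * expR (x ^+ 2 / 2) by rewrite /C; case: cid2.
exists (\sum_(i < size p) `|p`_i| * C i).
  by apply: sumr_ge0 => i _; rewrite mulr_ge0.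
move=> x; rewrite horner_coef mulr_suml; apply: (le_trans (ler_norm_sum _ _ _)).
by apply: ler_sum => i _; rewrite normrM normrX -mulrA ler_wpM2l.
Qed.

Lemma integrable_half_gauss : mu.-integrable setT (fun x : R => (expR (- (x ^+ 2 / 2)))%:E).
Proof.
have := @integrable_normal_pdf R 0 1; rewrite /normal_pdf oner_eq0 /= => h.
have := integrableZl measurableT (normal_peak 1 : R)^-1 h.
apply: eq_integrable => // x _; rewrite /= -EFinM mulrA mulVf ?mul1r.
  by rewrite /normal_fun subr0 expr1n mulr2n mulNr.
by rewrite gt_eqF// normal_peak_gt0.
Qed.

Lemma integrable_poly_gauss (p : {poly R}) :
  mu.-integrable setT (fun x : R => (p.[x] * expR (- x ^+ 2))%:E).
Proof.
have [C C0 pC] := poly_le_expR p.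
apply: (le_integrable measurableT _ _ (integrableZl measurableT C integrable_half_gauss)).
  apply/measurable_EFinP; apply: continuous_measurable_fun => x.
  apply: cvgM; first exact: continuous_horner.
  exact: continuous_gauss_fun.
move=> x _; rewrite -EFinM !abse_EFin lee_fin !normrM !(ger0_norm (expR_ge0 _)) (ger0_norm C0).
apply: (le_trans (ler_wpM2r (expR_ge0 _) (pC x))).
by rewrite -mulrA -expRD (_ : _ + _ = - (x ^+ 2 / 2))//; field.
Qed.

Lemma poly_gauss_cvg0 (p : {poly R}) : (fun n : nat => p.[n%:R] * expR (- n%:R ^+ 2)) @ \oo --> (0 : R).
Proof.
have [C C0 pC] := poly_le_expR p.
apply/norm_cvg0P; apply: (@squeeze_cvgr _ _ _ _ (fun=> 0) (fun n : nat => C * (1 + n%:R / 2)^-1)).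
- apply: nearW => n; rewrite normr_ge0/= normrM (ger0_norm (expR_ge0 _)).
  apply: (le_trans (ler_wpM2r (expR_ge0 _) (pC _))).
  rewrite -mulrA ler_wpM2l// -expRD (_ : _ + _ = - (n%:R ^+ 2 / 2)); last by field.
  rewrite expRN lef_pV2 ?posrE ?expR_gt0 ?ltr_wpDr ?divr_ge0//.
  apply: (le_trans _ (expR_ge1Dx _)); rewrite lerD2l ler_pM2r ?invr_gt0//.
  by rewrite -natrX ler_nat; case: n => // n; rewrite -mulnn leq_pmulr.
- exact: cvg_cst.
- rewrite -(mulr0 C); apply: cvgMl_tmp; apply/cvgrPdist_lt => e e0; near=> n.
  rewrite sub0r normrN ger0_norm ?invr_ge0 ?addr_ge0 ?divr_ge0//.
  have n0 : 0 < 1 + n%:R / 2 :> R by rewrite ltr_wpDr ?divr_ge0.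
  rewrite (invf_plt n0 e0) (@lt_trans _ _ (1 + e^-1)) ?ltrDr//.
  rewrite ltrD2l ltr_pdivlMr//; near: n; exact: nbhs_infty_gtr.
Unshelve. all: by end_near. Qed.

(** The difference of the two integrands is the derivative of p exp(-x^2). Its integral over [-n, n]
    tends to the full integral by dominated convergence, and to 0 because the boundary terms
    vanish. *)
Lemma gauss_integration_by_parts (p : {poly R}) :
  (\int[mu]_x (p^`().[x] * expR (- x ^+ 2)) = \int[mu]_x ((2 *: 'X * p).[x] * expR (- x ^+ 2)))%R.
Proof.
pose q := p^`() - 2 *: 'X * p.
have iq := integrable_poly_gauss q.
apply/eqP; rewrite -subr_eq0 -RintegralB//; try exact: integrable_poly_gauss.
under eq_Rintegral do rewrite -mulrBl -hornerN -hornerD -/q.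
have dF (x : R) : is_derive x 1 (fun x => p.[x] * expR (- x ^+ 2)) (q.[x] * expR (- x ^+ 2)).
  have h1 := is_derive_poly p x.
  apply: trigger_derive.
  rewrite /q !hornerE /= /GRing.scale /=; ring.
have cq : continuous (fun x : R => q.[x] * expR (- x ^+ 2)).
  by move=> x; apply: cvgM; [exact: continuous_horner|exact: continuous_gauss_fun].
pose f_ (n : nat) (x : R) : \bar R := ((q.[x] * expR (- x ^+ 2)) * \1_(`[- n%:R, n%:R]%classic) x)%:E.
have mf : measurable_fun setT (fun x : R => (q.[x] * expR (- x ^+ 2))%:E).
  by apply/measurable_EFinP; exact: continuous_measurable_fun.
have fE n x : f_ n x = ((fun x => (q.[x] * expR (- x ^+ 2))%:E) \_ `[- n%:R, n%:R]) x.
  by rewrite /f_ patchE indicE; case: (x \in _); rewrite ?mulr1 ?mulr0.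
have cvgf : (fun n => \int[mu]_x f_ n x)%E @ \oo --> (\int[mu]_x (q.[x] * expR (- x ^+ 2))%:E)%E.
  apply: (@dominated_cvg _ _ R mu setT measurableT f_ (fun x => (q.[x] * expR (- x ^+ 2))%:E)
    (fun x => `|(q.[x] * expR (- x ^+ 2))%:E|)%E).
  - move=> n; apply/measurable_EFinP; apply: measurable_funM; first exact: continuous_measurable_fun.
    exact: measurable_indic.
  - move=> x _; apply/cvg_EFin; first exact: nearW.
    apply: cvg_near_cst; near=> n; rewrite /f_/= indicE mem_set ?mulr1//=.
    rewrite in_itv/= -ler_norml; near: n; exact: nbhs_infty_ger.
  - by move=> x _.
  - exact: integrable_abse.
  - move=> n x _; rewrite /f_ !abse_EFin lee_fin normrM indicE ler_piMr//.
    by case: (_ \in _); rewrite ?normr1 ?normr0.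
(* The index n + 1 keeps the interval nondegenerate, as [ftc_segment] demands; the composite with -X
   evaluates [p] at the left endpoint. *)
have cvgn : (fun n => \int[mu]_x f_ n.+1 x)%E @ \oo --> 0%E.
  have := (@poly_gauss_cvg0 p); have := @poly_gauss_cvg0 (p \Po - 'X).
  rewrite -(cvg_shiftS _) => h1; rewrite -(cvg_shiftS _) => h2.
  have := cvgB h2 h1; rewrite subrr => h.
  rewrite (_ : (fun n => _) = EFin \o (fun n : nat => p.[n.+1%:R] * expR (- n.+1%:R ^+ 2) - (p \Po - 'X).[n.+1%:R] * expR (- n.+1%:R ^+ 2))).
    by apply/cvg_EFin; [exact: nearW|exact: h].
  apply/funext => n; under eq_integral do rewrite fE.
  have n0 : - n.+1%:R < n.+1%:R :> R by rewrite (@lt_trans _ _ 0)// oppr_lt0.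
  rewrite -integral_mkcond (ftc_segment n0 (fun x _ => dF x) (fun x _ => cq x)).
  by rewrite /= horner_comp !hornerE sqrrN.
have e : (\int[mu]_x (q.[x] * expR (- x ^+ 2))%:E)%E = 0%E.
  move: cvgf; rewrite -(cvg_shiftS _) => cvgf.
  exact: (cvg_unique (@ereal_hausdorff R) cvgf cvgn).
by rewrite /Rintegral e.
Unshelve. all: by end_near. Qed.
End calculus.

(** * Hermite functions: ladder relations, oscillator equation, Christoffel-Darboux formulas *)

Section hermite_functions.
Context {R : realType}.
Notation mu := (@lebesgue_measure R).
Variable h : nat -> {poly R}.
Hypothesis hermite_h : orthonormal_hermite h.

Lemma orthonormal_hermite_ladder n :
  2 *: 'X * h n - (h n)^`() = Num.sqrt (2 * n.+1%:R) *: h n.+1 /\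
  (h n.+1)^`() = Num.sqrt (2 * n.+1%:R) *: h n.
Proof.
have [hsz hor] := hermite_h.
apply: (hermite_ladder (Lam := fun p => (\int[mu]_x (p.[x] * expR (- x ^+ 2)))%R)).
- move=> p q; rewrite -RintegralD//; try exact: integrable_poly_gauss.
  by apply: eq_Rintegral => x _; rewrite hornerD mulrDl.
- move=> a p; rewrite -RintegralZl//; try exact: integrable_poly_gauss.
  by apply: eq_Rintegral => x _; rewrite hornerZ mulrA.
- exact: gauss_integration_by_parts.
- by move=> k; have [] := hsz k.
- by move=> k; have [] := hsz k.
- move=> j k; have := hor j k; rewrite /Rintegral.
  by move=> e; under eq_integral do rewrite hornerM; rewrite e.
Qed.

Lemma hermite0_const : h 0%N = ((h 0%N)`_0)%:P.
Proof. by apply: size1_polyC; have [/(_ 0%N)[-> _] _] := hermite_h. Qed.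

Lemma hermite0_sqr : (h 0%N)`_0 ^+ 2 = (Num.sqrt pi)^-1.
Proof.
have [hsz hor] := hermite_h.
have := hor 0%N 0%N.
have h0 x : (h 0%N).[x] = (h 0%N)`_0 by rewrite hermite0_const hornerC coefC.
under eq_integral do rewrite !h0 -expr2 EFinM.
rewrite integralZl//; last exact: integrableT_gauss.
rewrite integralT_gauss -EFinM eqxx => -[] /eqP e; apply/eqP.
have p0 : Num.sqrt pi != 0 :> R by rewrite gt_eqF// sqrtr_gt0 pi_gt0.
by rewrite -[X in _ == X]mul1r eq_sym -(inj_eq (mulIf p0)) mulfVK// eq_sym.
Qed.

Definition psi n (x : R) := (h n).[x] * expR (- (x ^+ 2 / 2)).
Definition dpsi n (x : R) := ((h n)^`().[x] - x * (h n).[x]) * expR (- (x ^+ 2 / 2)).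

Lemma is_derive_psi n (x : R) : is_derive x 1 (psi n) (dpsi n x).
Proof.
have h1 := is_derive_poly (h n) x.
apply: trigger_derive; rewrite /dpsi /GRing.scale /=; field => //.
Qed.

(** Differentiating the raising relation and lowering again gives Hermite's equation, which the
    Gaussian factor turns into the oscillator equation. *)
Lemma is_derive_dpsi n (x : R) : is_derive x 1 (dpsi n) (- ((2 * n%:R + 1) - x ^+ 2) * psi n x).
Proof.
have h1 := is_derive_poly (h n) x; have h2 := is_derive_poly (h n)^`() x.
apply: trigger_derive; rewrite /psi /GRing.scale /=.
suff e : (h n)^`()^`().[x] = 2 * x * (h n)^`().[x] - 2 * n%:R * (h n).[x].
  by rewrite e; field.
have [e1 e2] := orthonormal_hermite_ladder n.
have := congr1 (fun p : {poly R} => (deriv p).[x]) e1.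
rewrite /= derivB derivZ e2 scalerA -expr2 sqr_sqrtr ?mulr_ge0// derivM derivZ derivX !hornerE.
move=> e; lra.
Qed.

Lemma psi_ladder n x : Num.sqrt (2 * n.+1%:R) * psi n.+1 x = x * psi n x - dpsi n x.
Proof.
have [e1 e2] := orthonormal_hermite_ladder n.
have e := congr1 (fun p : {poly R} => p.[x]) e1; rewrite /= !hornerE in e.
by rewrite /psi /dpsi mulrA -e; ring.
Qed.

Lemma dpsi_ladder n x : dpsi n.+1 x = Num.sqrt (2 * n.+1%:R) * psi n x - x * psi n.+1 x.
Proof.
have [e1 e2] := orthonormal_hermite_ladder n.
by rewrite /psi /dpsi e2 hornerZ; ring.
Qed.

Lemma dpsi0 x : dpsi 0 x = - x * psi 0 x.
Proof.
by rewrite /psi /dpsi hermite0_const derivC !hornerC; ring.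
Qed.

(** The average of the Christoffel-Darboux kernels with n and n + 1 terms; the half weight makes the
    Christoffel-Darboux numerator an expression in [psi n] and [dpsi n] alone. *)
Definition half_kernel n (u v : R) :=
  \sum_(j < n) psi j u * psi j v + psi n u * psi n v / 2.

Lemma christoffel_darboux n u v : 2 * (u - v) * half_kernel n u v = psi n u * dpsi n v - dpsi n u * psi n v.
Proof.
elim: n => [|n IH]; first by rewrite /half_kernel big_ord0 !dpsi0; field.
have -> : half_kernel n.+1 u v = half_kernel n u v + (psi n u * psi n v + psi n.+1 u * psi n.+1 v) / 2.
  by rewrite /half_kernel big_ord_recr/=; field.
rewrite mulrDr IH !dpsi_ladder.
set s := Num.sqrt (2 * n.+1%:R).
have -> : dpsi n u = u * psi n u - s * psi n.+1 u by rewrite psi_ladder; ring.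
have -> : dpsi n v = v * psi n v - s * psi n.+1 v by rewrite psi_ladder; ring.
by field.
Qed.

(** The right-hand side is the energy of the oscillator solved by [psi n]: where u^2 < 2n + 1, a
    bound on the diagonal controls both [psi n] and [dpsi n]. *)
Lemma christoffel_darboux_diag n u :
  2 * half_kernel n u u = dpsi n u ^+ 2 + ((2 * n%:R + 1) - u ^+ 2) * psi n u ^+ 2.
Proof.
elim: n => [|n IH]; first by rewrite /half_kernel big_ord0 !dpsi0; field.
have -> : half_kernel n.+1 u u = half_kernel n u u + (psi n u ^+ 2 + psi n.+1 u ^+ 2) / 2.
  by rewrite /half_kernel big_ord_recr/=; field.
rewrite mulrDr IH !dpsi_ladder.
set s := Num.sqrt (2 * n.+1%:R).
have -> : dpsi n u = u * psi n u - s * psi n.+1 u by rewrite psi_ladder; ring.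
have : s ^+ 2 = 2 * n%:R + 2 by rewrite sqr_sqrtr ?mulr_ge0// -[n.+1%:R]natr1; ring.
rewrite -[n.+1%:R]natr1; move: (psi n u) (psi n.+1 u) (n%:R : R) => a b m e.
rewrite !sqrrB !exprMn e; field => //.
Qed.

Lemma psi_parity n x : psi n (- x) = (-1) ^+ n * psi n x /\ dpsi n (- x) = - (-1) ^+ n * dpsi n x.
Proof.
elim: n => [|n [IH1 IH2]].
  rewrite !dpsi0 expr0 mul1r; suff -> : psi 0 (- x) = psi 0 x by split=> //; ring.
  by rewrite /psi hermite0_const !hornerC sqrrN.
have s0 : Num.sqrt (2 * n.+1%:R) != 0 :> R by rewrite gt_eqF// sqrtr_gt0 mulr_gt0.
have e : psi n.+1 (- x) = (-1) ^+ n.+1 * psi n.+1 x.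
  apply: (mulfI s0); transitivity (- x * psi n (- x) - dpsi n (- x)); first exact: psi_ladder.
  rewrite IH1 IH2 exprS; transitivity (- (-1) ^+ n * (x * psi n x - dpsi n x)); first by ring.
  by rewrite -psi_ladder; ring.
by split=> //; rewrite !dpsi_ladder e IH1 exprS; ring.
Qed.

End hermite_functions.

(** * Amplitude of the half-integer kernel at the origin *)

Section wallis.
Context {R : realType}.
Notation mu := (@lebesgue_measure R).

Lemma integrable_segment (f : R -> R) (a b : R) : continuous f ->
  mu.-integrable `[a, b] (EFin \o f).
Proof.
move=> cf; apply: continuous_compact_integrable; first exact: segment_compact.
by apply: continuous_subspaceT.
Qed.

Lemma is_derive_pow (f : R -> R) n (x d : R) : is_derive x 1 f d ->
  is_derive x 1 (fun y => f y ^+ n) (n%:R * f x ^+ n.-1 * d).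
Proof.
have -> : (fun y => f y ^+ n) = f ^+ n.
  by apply/funext => y; elim: n => [|n IH]; rewrite ?expr0// !exprS IH.
exact: is_deriveX.
Qed.

Lemma natr_double_succ (m k : nat) : (2 * m + k)%:R = 2 * m%:R + k%:R :> R.
Proof. by rewrite natrD natrM. Qed.

Definition wallis_integral n : R := (\int[mu]_(x in `[0, pi / 2]) (sin x ^+ n))%R.

Lemma continuous_sinX n : continuous (fun x : R => sin x ^+ n).
Proof.
move=> x; apply: (@continuous_comp _ _ _ sin (fun y => y ^+ n)); first exact: continuous_sin.
exact: exprn_continuous.
Qed.

(** The difference of the two sides is the integral of the derivative of - cos x sin^(n+1) x, which
    vanishes at both endpoints. *)
Lemma wallis_integral_rec n : n.+2%:R * wallis_integral n.+2 = n.+1%:R * wallis_integral n.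
Proof.
have p0 : 0 < pi / 2 :> R by rewrite divr_gt0 ?pi_gt0.
have I m := @integrable_segment (fun x => sin x ^+ m) 0 (pi / 2) (@continuous_sinX m).
have c_sin (k m : nat) (x : R) : {for x, continuous (fun y : R => k%:R * sin y ^+ m)}.
  by apply: cvgM; [exact: cvg_cst|exact: continuous_sinX].
apply/eqP; rewrite -subr_eq0 -!RintegralZl// -RintegralB//; last 2 first.
- by apply: integrable_segment => x; exact: c_sin.
- by apply: integrable_segment => x; exact: c_sin.
have dF (x : R) : 0 <= x <= pi / 2 -> is_derive x 1 (fun x => - cos x * sin x ^+ n.+1)
    (n.+2%:R * sin x ^+ n.+2 - n.+1%:R * sin x ^+ n).
  move=> _; have dS : is_derive x 1 (fun x : R => sin x ^+ n.+1) (n.+1%:R * sin x ^+ n * cos x).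
    exact: is_derive_pow.
  apply: trigger_derive; rewrite /GRing.scale/=.
  have := cos2Dsin2 x => e.
  rewrite -[n.+2%:R]natr1 -[n.+1%:R]natr1 !exprS.
  have {}e : cos x ^+ 2 = 1 - sin x ^+ 2 by rewrite -e addrK.
  rewrite !exprS expr0 !mulr1 in e.
  transitivity (sin x * (sin x * sin x ^+ n) - (n%:R + 1) * (cos x * cos x) * sin x ^+ n).
    by rewrite -mulr_natr; ring.
  by rewrite e; ring.
rewrite /Rintegral (ftc_segment p0 dF) => [|x _]; last by apply: cvgB; exact: c_sin.
by rewrite /= cos_pihalf sin0 oppr0 mul0r expr0n/= mulr0 subrr.
Qed.

Lemma wallis_integral0 : wallis_integral 0 = pi / 2.
Proof.
rewrite /wallis_integral; under eq_Rintegral do rewrite expr0.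
rewrite Rintegral_cst//= lebesgue_measure_itv/= lte_fin divr_gt0 ?pi_gt0//.
by rewrite -EFinD/= mul1r subr0.
Qed.

Lemma wallis_integral1 : wallis_integral 1 = 1.
Proof.
have p0 : 0 < pi / 2 :> R by rewrite divr_gt0 ?pi_gt0.
have dF (x : R) : 0 <= x <= pi / 2 -> is_derive x 1 (fun x => - cos x) (sin x ^+ 1).
  by move=> _; apply: trigger_derive; rewrite expr1; ring.
rewrite /wallis_integral /Rintegral (ftc_segment p0 dF) => [|x _]; last exact: continuous_sinX.
by rewrite /= cos_pihalf cos0; ring.
Qed.

Lemma wallis_integral_nincr n : wallis_integral n.+1 <= wallis_integral n.
Proof.
apply: le_Rintegral => //; [exact: integrable_segment (@continuous_sinX _)|exact: integrable_segment (@continuous_sinX _)|].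
move=> x; rewrite /= in_itv/= => /andP[x0 x1].
have s0 : 0 <= sin x.
  by apply: sin_ge0_pi; rewrite x0/= (le_trans x1)// ler_pdivrMr// ler_peMr ?pi_ge0// ler1n.
by rewrite exprS ler_piMl ?exprn_ge0// sin_le1.
Qed.

(** The central binomial coefficient of 2m over m, divided by 4^m. *)
Definition wallis m : R := \prod_(i < m) ((2 * i%:R + 1) / (2 * i%:R + 2)).

Lemma wallis_gt0 m : 0 < wallis m.
Proof. by apply: prodr_gt0 => i _; rewrite divr_gt0// ltr_wpDl// mulr_ge0. Qed.

Lemma wallis_integral_even m : wallis_integral (2 * m) = pi / 2 * wallis m.
Proof.
elim: m => [|m IH]; first by rewrite muln0 wallis_integral0 /wallis big_ord0 mulr1.
have := wallis_integral_rec (2 * m); rewrite IH => e.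
have n0 : ((2 * m).+2)%:R != 0 :> R by rewrite pnatr_eq0.
rewrite mulnS add2n; apply: (mulfI n0); rewrite e /wallis big_ord_recr/= -/(wallis m).
have -> : ((2 * m).+2)%:R = 2 * m%:R + 2 :> R by rewrite -natr_double_succ addn2.
have -> : ((2 * m).+1)%:R = 2 * m%:R + 1 :> R by rewrite -(natr_double_succ m 1) addn1.
have : 2 * m%:R + 2 != 0 :> R by rewrite gt_eqF// ltr_wpDl// mulr_ge0.
by move=> d; field; rewrite d.
Qed.

Lemma wallis_integral_odd m : (2 * m%:R + 1) * wallis m * wallis_integral (2 * m).+1 = 1.
Proof.
elim: m => [|m IH]; first by rewrite muln0 wallis_integral1 /wallis big_ord0; ring.
have := wallis_integral_rec (2 * m).+1 => e.
rewrite mulnS add2n /wallis big_ord_recr/= -/(wallis m).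
rewrite -[RHS]IH -[m.+1%:R]natr1.
have e' : (2 * m%:R + 3) * wallis_integral (2 * m).+3 = (2 * m%:R + 2) * wallis_integral (2 * m).+1.
  by move: e; rewrite -!natr_double_succ addn2 addn3.
have d : 2 * m%:R + 2 != 0 :> R by rewrite gt_eqF// ltr_wpDl// mulr_ge0.
transitivity (wallis m * ((2 * m%:R + 1) / (2 * m%:R + 2)) * ((2 * m%:R + 3) * wallis_integral (2 * m).+3)).
  by ring.
by rewrite e'; field.
Qed.

(** The integrals W(n) decrease in n: W(2m+1) <= W(2m) gives the first bound, and W(2m) <= W(2m-1)
    the second. *)
Lemma wallis_bounds m :
  2 <= pi * wallis m ^+ 2 * (2 * m%:R + 1) /\ pi * wallis m ^+ 2 * m%:R <= 1.
Proof.
have w0 := wallis_gt0 m.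
have c0 : 0 < (2 * m%:R + 1) * wallis m by rewrite mulr_gt0// ltr_wpDl// mulr_ge0.
have o := wallis_integral_odd m; have ev := wallis_integral_even m.
split.
  have := wallis_integral_nincr (2 * m); rewrite -(ler_pM2l c0) o ev => h; nra.
case: m w0 c0 o ev => [|m] w0 c0 o ev; first by rewrite mulr0.
have := wallis_integral_nincr (2 * m).+1.
have := wallis_integral_rec (2 * m).+1.
rewrite mulnS add2n in o ev; rewrite ev => r h.
have e' : (2 * m%:R + 3) * wallis_integral (2 * m).+3 = (2 * m%:R + 2) * wallis_integral (2 * m).+1.
  by move: r; rewrite -!natr_double_succ addn2 addn3.
rewrite -[m.+1%:R]natr1 in o c0 *.
have m2 : 0 < 2 * m%:R + 2 :> R by rewrite ltr_wpDl// mulr_ge0.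
have h2 : (2 * m%:R + 2) * (pi / 2 * wallis m.+1) * wallis m.+1 <= 1.
  apply: (@le_trans _ _ ((2 * m%:R + 2) * wallis m.+1 * wallis_integral (2 * m).+1)).
    by rewrite mulrAC ler_pM2l// mulr_gt0.
  rewrite mulrAC -e' -[leRHS]o le_eqVlt; apply/orP; left; apply/eqP; ring.
by apply: le_trans h2; rewrite le_eqVlt; apply/orP; left; apply/eqP; field.
Qed.

End wallis.

(** * Hermite functions and the symmetrized kernel at the origin *)

Section hermite_at_origin.
Context {R : realType}.
Variable h : nat -> {poly R}.
Hypothesis hermite_h : orthonormal_hermite h.
Local Notation psi := (psi h).
Local Notation dpsi := (dpsi h).
Local Notation half_kernel := (half_kernel h).

(** Two ladder steps at the origin multiply the square by (2m + 1) / (2m + 2), the Wallis ratio; the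
    initial value is the normalization of [h 0]. *)
Lemma psi0_even m : psi (2 * m) 0 ^+ 2 = wallis m / Num.sqrt pi.
Proof.
elim: m => [|m IH].
  rewrite muln0 /psi (hermite0_const hermite_h) hornerC expr0n/= mul0r oppr0 expR0 mulr1.
  by rewrite (hermite0_sqr hermite_h) /wallis big_ord0 mul1r.
have e1 := psi_ladder hermite_h (2 * m).+1 0; have e2 := dpsi_ladder hermite_h (2 * m) 0.
rewrite mul0r sub0r in e1; rewrite mul0r subr0 in e2; rewrite e2 in e1.
rewrite mulnS add2n; move: (psi (2 * m).+2 0) (psi (2 * m) 0) IH e1 {e2} => b a IH e1.
have := congr1 (fun z => z ^+ 2) e1; rewrite sqrrN !exprMn !sqr_sqrtr ?mulr_ge0//.
rewrite IH /wallis big_ord_recr/= -/(wallis m).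
have -> : ((2 * m).+2)%:R = 2 * m%:R + 2 :> R by rewrite -natr_double_succ addn2.
have -> : ((2 * m).+1)%:R = 2 * m%:R + 1 :> R by rewrite -(natr_double_succ m 1) addn1.
have d : 2 * m%:R + 2 != 0 :> R by rewrite gt_eqF// ltr_wpDl// mulr_ge0.
have d2 : Num.sqrt pi != 0 :> R by rewrite gt_eqF// sqrtr_gt0 pi_gt0.
move=> e; have d' : 2 * (2 * m%:R + 2) != 0 :> R by rewrite mulf_neq0.
by apply: (mulfI d'); rewrite e; field; rewrite d d2.
Qed.

Lemma psi0_odd m : psi (2 * m).+1 0 = 0.
Proof.
have [e _] := psi_parity hermite_h (2 * m).+1 0.
rewrite oppr0 exprS mulnC exprM sqrr_sign mulr1 mulN1r in e.
by rewrite mulnC; lra.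
Qed.

Lemma half_kernel0_even m :
  half_kernel (2 * m) 0 0 = (4 * m%:R + 1) * wallis m / (2 * Num.sqrt pi).
Proof.
have d : Num.sqrt pi != 0 :> R by rewrite gt_eqF// sqrtr_gt0 pi_gt0.
have := christoffel_darboux_diag hermite_h (2 * m) 0.
have -> : dpsi (2 * m) 0 = 0.
  have [_ e] := psi_parity hermite_h (2 * m) 0; rewrite oppr0 exprM sqrrN expr1n expr1n in e; lra.
rewrite psi0_even natrM expr0n/= subr0 add0r => e.
by have : 2 != 0 :> R by []; move=> /mulfI; apply; rewrite e; field.
Qed.

Lemma half_kernel0_odd m :
  half_kernel (2 * m).+1 0 0 = (2 * m%:R + 1) * wallis m / Num.sqrt pi.
Proof.
have d : Num.sqrt pi != 0 :> R by rewrite gt_eqF// sqrtr_gt0 pi_gt0.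
have := christoffel_darboux_diag hermite_h (2 * m).+1 0.
rewrite psi0_odd (dpsi_ladder hermite_h) mul0r subr0 expr0n/= mulr0 addr0 exprMn psi0_even.
rewrite sqr_sqrtr ?mulr_ge0// -(addn1 (2 * m)%N) natr_double_succ => e.
by have : 2 != 0 :> R by []; move=> /mulfI; apply; rewrite e; field.
Qed.

Lemma half_kernel0_approx n :
  `|half_kernel n 0 0 - Num.sqrt (2 * n%:R + 1) / pi| <= (Num.sqrt (2 * n%:R + 1))^-1.
Proof.
set om : R := Num.sqrt (2 * n%:R + 1).
have pn0 : pi != 0 :> R by rewrite gt_eqF// pi_gt0.
have pi2 : 2 <= pi :> R by exact: pi_ge2.
have pi4 : pi <= 4 :> R by have := @pihalf_lt2 R; rewrite ltr_pdivrMr// => /ltW; rewrite -natrM.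
have om2 : om ^+ 2 = 2 * n%:R + 1 by rewrite sqr_sqrtr// addr_ge0// mulr_ge0.
have om0 : 0 < om by rewrite sqrtr_gt0 ltr_wpDl// mulr_ge0.
(* Squares avoid the root in [om]: a difference of at most 2 between K^2 pi^2 and om^2, divided by
   pi^2 (K + om / pi) >= pi om, leaves at most 2 / (pi om), and pi >= 2. *)
suff [k0 k2] : 0 <= half_kernel n 0 0 /\
    `|half_kernel n 0 0 ^+ 2 * pi ^+ 2 - om ^+ 2| <= 2.
  have e (k p o : R) : p != 0 -> (k - o / p) * (k + o / p) * p ^+ 2 = k ^+ 2 * p ^+ 2 - o ^+ 2.
    by move=> p0; field.
  have s0 : 0 < half_kernel n 0 0 + om / pi by rewrite ltr_wpDl// divr_gt0// pi_gt0.
  rewrite -(ler_pM2r (mulr_gt0 s0 (exprn_gt0 2 (pi_gt0 R)))) -[X in `|_| * X]gtr0_norm ?mulr_gt0 ?exprn_gt0 ?pi_gt0//.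
  rewrite -normrM mulrA (e _ _ _ pn0); apply: (le_trans k2).
  apply: (@le_trans _ _ (om^-1 * (om / pi * pi ^+ 2))).
    have e2 (o p : R) : o != 0 -> p != 0 -> o^-1 * (o / p * p ^+ 2) = p.
      by move=> o0 p0; field; rewrite o0 p0.
    by rewrite e2// gt_eqF.
  by rewrite ler_pM2l ?invr_gt0// ler_pM2r ?exprn_gt0 ?pi_gt0// lerDr.
have sp : Num.sqrt pi ^+ 2 = pi :> R by rewrite sqr_sqrtr// pi_ge0.
have sp0 : Num.sqrt pi != 0 :> R by rewrite gt_eqF// sqrtr_gt0 pi_gt0.
have [m [en|en]] : exists m, n = (2 * m)%N \/ n = (2 * m).+1.
  exists n./2; rewrite mul2n; case: (boolP (odd n)) => o; [right|left].
    by rewrite -[LHS]odd_double_half o.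
  by rewrite -[LHS]odd_double_half (negbTE o).
- have [lo up] := @wallis_bounds R m; have w0 := @wallis_gt0 R m.
  have m0 : 0 <= m%:R :> R by [].
  rewrite om2 en half_kernel0_even natrM; split.
    by rewrite divr_ge0 ?mulr_ge0 ?addr_ge0 ?mulr_ge0// ltW.
  have -> : ((4 * m%:R + 1) * wallis m / (2 * Num.sqrt pi)) ^+ 2 * pi ^+ 2 =
      (4 * m%:R + 1) ^+ 2 * (pi * wallis m ^+ 2) / 4 :> R.
    have alg (a w p q : R) : q ^+ 2 = p -> q != 0 ->
      (a * w / (2 * q)) ^+ 2 * p ^+ 2 = a ^+ 2 * (p * w ^+ 2) / 4 by move=> <- q0; field.
    exact: alg.
  set z := pi * wallis m ^+ 2 in lo up *.
  (* The upper Wallis bound is void at m = 0, where [z] is pi. *)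
  have z4 : z <= 4.
    have : m = 0%N \/ 1 <= m%:R :> R by case: (m) => [|k]; [left|right; rewrite ler1n].
    case=> [m00|]; last by nra.
    by rewrite /z m00 /wallis big_ord0 expr1n mulr1.
  rewrite ler_norml; apply/andP; split; nra.
- have [lo up] := @wallis_bounds R m; have w0 := @wallis_gt0 R m.
  have m0 : 0 <= m%:R :> R by [].
  rewrite om2 en half_kernel0_odd -(addn1 (2 * m)%N) natr_double_succ; split.
    by rewrite divr_ge0 ?sqrtr_ge0 ?mulr_ge0 ?addr_ge0 ?mulr_ge0// ltW.
  have -> : ((2 * m%:R + 1) * wallis m / Num.sqrt pi) ^+ 2 * pi ^+ 2 =
      (2 * m%:R + 1) ^+ 2 * (pi * wallis m ^+ 2) :> R.
    have alg (a w p q : R) : q ^+ 2 = p -> q != 0 ->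
      (a * w / q) ^+ 2 * p ^+ 2 = a ^+ 2 * (p * w ^+ 2) by move=> <- q0; field.
    exact: alg.
  set z := pi * wallis m ^+ 2 in lo up *.
  have lo2 : 2 * (2 * m%:R + 1) <= (2 * m%:R + 1) ^+ 2 * z by nra.
  have [m00|m1] : m = 0%N \/ 1 <= m%:R :> R by case: (m) => [|k]; [left|right; rewrite ler1n].
    have -> : z = pi by rewrite /z m00 /wallis big_ord0 expr1n mulr1.
    by rewrite m00 ler_norml; apply/andP; split; nra.
  have z1 : z <= 1 by nra.
  have up2 : (2 * m%:R + 1) ^+ 2 * z <= 4 * m%:R + 5 by nra.
  by rewrite ler_norml; apply/andP; split; lra.
Qed.

End hermite_at_origin.

(** * Comparison with the sine kernel *)

Section sine_kernel_approximation.
Context {R : realType}.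

Lemma mvt_bound (F dF : R -> R) (s B : R) :
  (forall t : R, is_derive t 1 F (dF t)) ->
  (forall t, `|t| <= `|s| -> `|dF t| <= B) -> `|F s - F 0| <= B * `|s|.
Proof.
move=> FdF hB.
have cF a b : {within `[a, b], continuous F}.
  apply: continuous_subspaceT => x; apply/differentiable_continuous/derivable1_diffP.
  by have [] := FdF x.
have [s0|s0] := leP 0 s.
  have [c] := @MVT_segment _ F dF 0 s s0 (fun x _ => FdF x) (cF _ _).
  rewrite in_itv/= subr0 => /andP[c0 cs] ->.
  by rewrite normrM ler_wpM2r// hB// !ger0_norm.
have [c] := @MVT_segment _ F dF s 0 (ltW s0) (fun x _ => FdF x) (cF _ _).
rewrite in_itv/= sub0r distrC => /andP[cs c0] ->.
by rewrite normrM normrN ler_wpM2r// hB// !ler0_norm ?lerN2// ltW.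
Qed.

Lemma ler_norm_sin (x : R) : `|sin x| <= `|x|.
Proof.
have := @mvt_bound sin cos x 1 (fun t => is_derive_sin t).
rewrite sin0 subr0 mul1r; apply => t _.
by rewrite ler_norml cos_geN1 cos_le1.
Qed.

(* Duhamel's formula for the equation [g'' + 4 om^2 g = r] satisfied by the
   derivative [g = 2 p p'] of [p^2]. *)
Lemma perturbed_oscillator_sqr (p dp : R -> R) (om y B : R) : 0 < om -> 0 <= y ->
  (forall t : R, is_derive t 1 p (dp t)) ->
  (forall t : R, is_derive t 1 dp (- (om ^+ 2 - t ^+ 2) * p t)) ->
  (forall t, `|t| <= y -> `|8 * t ^+ 2 * (p t * dp t) + 4 * t * p t ^+ 2| <= B) ->
  `|2 * p y * dp y - ((dp 0 ^+ 2 - om ^+ 2 * p 0 ^+ 2) * sin (2 * om * y) / om +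
      2 * p 0 * dp 0 * cos (2 * om * y))| <= B / (2 * om) * y.
Proof.
move=> o0 y0 d1 d2 hB.
pose g t := 2 * p t * dp t.
pose dg t := 2 * dp t ^+ 2 - 2 * (om ^+ 2 - t ^+ 2) * p t ^+ 2.
pose r t := 8 * t ^+ 2 * (p t * dp t) + 4 * t * p t ^+ 2.
have a3 (t : R) : is_derive t 1 g (dg t).
  have := d1 t; have := d2 t => b1 b2.
  by apply: trigger_derive; rewrite /GRing.scale/= /dg; ring.
have a4 (t : R) : is_derive t 1 dg (r t - 4 * om ^+ 2 * g t).
  have := d1 t; have := d2 t => b1 b2.
  by apply: trigger_derive; rewrite /GRing.scale/= /r /g; ring.
pose S t := sin (2 * om * (y - t)); pose C t := cos (2 * om * (y - t)).
have a5 (t : R) : is_derive t 1 (fun t => 2 * om * (y - t)) (- 2 * om).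
  by apply: trigger_derive; rewrite /GRing.scale/=; ring.
have a6 (t : R) : is_derive t 1 S (C t * (- 2 * om)).
  exact: (@is_derive1_comp _ sin (fun t => 2 * om * (y - t)) t _ _ (is_derive_sin _) (a5 t)).
have a7 (t : R) : is_derive t 1 C (- S t * (- 2 * om)).
  exact: (@is_derive1_comp _ cos (fun t => 2 * om * (y - t)) t _ _ (is_derive_cos _) (a5 t)).
have on0 : om != 0 by rewrite gt_eqF.
(* Variation of constants: [q y] is [g y], [q 0] is the value at [y] of the unperturbed solution
   with the same initial data, and only the source [r] survives in the derivative of [q]. *)
pose q t := dg t * S t / (2 * om) + g t * C t.
have dq (t : R) : is_derive t 1 q (r t * S t / (2 * om)).
  have := a3 t; have := a4 t; have := a6 t; have := a7 t.
  rewrite /q; move: (r t) => rt.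
  clear -on0; clearbody g dg S C => b1 b2 b3 b4.
  by apply: trigger_derive; rewrite /GRing.scale/=; field.
have := @mvt_bound q _ y (B / (2 * om)) dq.
rewrite (ger0_norm y0) => /(_ _) h1.
have -> : 2 * p y * dp y - ((dp 0 ^+ 2 - om ^+ 2 * p 0 ^+ 2) * sin (2 * om * y) / om +
      2 * p 0 * dp 0 * cos (2 * om * y)) = q y - q 0.
  rewrite /q /S /C /g /dg subrr mulr0 sin0 cos0 subr0 expr0n/=.
  move: (sin _) (cos _) (p _) (dp _) (p _) (dp _) => a b c d e f.
  by field.
apply: h1 => t ty; rewrite !normrM [`|(2 * om)^-1|]ger0_norm; last by rewrite invr_ge0 mulr_ge0// ltW.
rewrite ler_wpM2r ?invr_ge0 ?mulr_ge0 ?(ltW o0)//.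
apply: (@le_trans _ _ `|r t|); last exact: hB.
by rewrite ler_piMr// ler_norml sin_geN1 sin_le1.
Qed.

Variable h : nat -> {poly R}.
Hypothesis hermite_h : orthonormal_hermite h.
Local Notation psi := (psi h).
Local Notation dpsi := (dpsi h).
Local Notation half_kernel := (half_kernel h).
Local Notation omega n := (Num.sqrt (2 * n%:R + 1 : R)).

Lemma omega_sqr n : omega n ^+ 2 = 2 * n%:R + 1.
Proof. by rewrite sqr_sqrtr// addr_ge0// mulr_ge0. Qed.

Lemma omega_ge1 n : 1 <= omega n.
Proof. by rewrite -[leLHS]sqrtr1 ler_wsqrtr// lerDr mulr_ge0. Qed.

Lemma half_kernelS n u v : half_kernel n.+1 u v =
  half_kernel n u v + (psi n u * psi n v + psi n.+1 u * psi n.+1 v) / 2.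
Proof. by rewrite /half_kernel big_ord_recr/=; field. Qed.

Lemma is_derive_psi_comp n (f : R -> R) (x d : R) : is_derive x 1 f d ->
  is_derive x 1 (fun t => psi n (f t)) (dpsi n (f x) * d).
Proof.
move=> fd; have ps := is_derive_psi h n (f x).
have := @is_derive1_comp _ (psi n) f x _ _ ps fd.
by rewrite mulrC.
Qed.

(* Along a diagonal direction the half-integer Christoffel-Darboux kernel moves
   only by [-t psi psi]: no oscillating term of order one survives. *)
Lemma is_derive_half_kernel n (y t : R) :
  is_derive t 1 (fun t => half_kernel n (t + y) (t - y)) (- t * (psi n (t + y) * psi n (t - y))).
Proof.
have dp m : is_derive t 1 (fun t => psi m (t + y) * psi m (t - y))
    (dpsi m (t + y) * psi m (t - y) + psi m (t + y) * dpsi m (t - y)).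
  have d1 : is_derive t 1 (fun t => psi m (t + y)) (dpsi m (t + y)).
    have -> : dpsi m (t + y) = dpsi m (t + y) * 1 by rewrite mulr1.
    by apply: is_derive_psi_comp; apply: trigger_derive; ring.
  have d2 : is_derive t 1 (fun t => psi m (t - y)) (dpsi m (t - y)).
    have -> : dpsi m (t - y) = dpsi m (t - y) * 1 by rewrite mulr1.
    by apply: is_derive_psi_comp; apply: trigger_derive; ring.
  by apply: trigger_derive; rewrite /GRing.scale/=; ring.
elim: n => [|n IH].
  rewrite (_ : (fun t => _) = (fun t => psi 0 (t + y) * psi 0 (t - y) / 2)); last first.
    by apply/funext => z; rewrite /half_kernel big_ord0 add0r.
  have d0 := dp 0%N; rewrite !(dpsi0 hermite_h) in d0.
  by apply: trigger_derive; rewrite /GRing.scale/=; field.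
rewrite (_ : (fun t => _) = (fun t => half_kernel n (t + y) (t - y) +
   (psi n (t + y) * psi n (t - y) + psi n.+1 (t + y) * psi n.+1 (t - y)) / 2)); last first.
  by apply/funext => z; rewrite half_kernelS.
have d0 := dp n; have d1 := dp n.+1.
rewrite !(dpsi_ladder hermite_h) in d1.
set s := Num.sqrt (2 * n.+1%:R) in d1.
have e x : dpsi n x = x * psi n x - s * psi n.+1 x by rewrite (psi_ladder hermite_h); ring.
rewrite !e in d0.
by apply: trigger_derive; rewrite /GRing.scale/=; field.
Qed.

(** At y = 0 the diagonal derivative is - t psi^2, so the diagonal increases up to the origin and
    decreases after it. *)
Lemma half_kernel_diag_le n u : half_kernel n u u <= half_kernel n 0 0.
Proof.
have dE (t : R) : is_derive t 1 (fun t => half_kernel n t t) (- t * psi n t ^+ 2).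
  have := is_derive_half_kernel n 0 t; rewrite addr0 subr0 -expr2.
  by under eq_fun do rewrite addr0 subr0.
have cF a b : {within `[a, b], continuous (fun t => half_kernel n t t)}.
  apply: continuous_subspaceT => x; apply/differentiable_continuous/derivable1_diffP.
  by have [] := dE x.
have [s0|s0] := leP 0 u.
  have [c] := @MVT_segment _ _ _ 0 u s0 (fun x _ => dE x) (cF _ _).
  rewrite in_itv/= subr0 => /andP[c0 cs] e.
  by rewrite -subr_le0 e mulr_le0_ge0// mulNr oppr_le0 mulr_ge0// sqr_ge0.
have [c] := @MVT_segment _ _ _ u 0 (ltW s0) (fun x _ => dE x) (cF _ _).
rewrite in_itv/= sub0r => /andP[c0 cs] e.
by rewrite -subr_ge0 e mulr_ge0// ?oppr_ge0 ?(ltW s0)// mulr_ge0 ?sqr_ge0// oppr_ge0.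
Qed.

Lemma half_kernel0_le n : half_kernel n 0 0 <= 2 * omega n.
Proof.
have := half_kernel0_approx hermite_h n; have o1 := omega_ge1 n.
set om : R := omega n in o1 *; rewrite ler_norml => /andP[_].
rewrite lerBlDr => h1; apply: (le_trans h1).
have i1 : om^-1 <= om by rewrite (@le_trans _ _ 1)// invf_le1// (lt_le_trans _ o1).
have : om / pi <= om.
  have := pi_ge2 R; rewrite ler_pdivrMr ?pi_gt0//; move: (pi : R) => p p2; nra.
by move=> *; lra.
Qed.

(** The energy is twice the diagonal, which is largest at the origin, where the Wallis estimate
    applies; the bound therefore holds at every [u]. *)
Lemma energy_le n (u : R) :
  dpsi n u ^+ 2 + (omega n ^+ 2 - u ^+ 2) * psi n u ^+ 2 <= 4 * omega n.
Proof.
have := half_kernel_diag_le n u; have := half_kernel0_le n.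
have := christoffel_darboux_diag hermite_h n u; rewrite omega_sqr.
move: (half_kernel n u u) (half_kernel n 0 0) => *; lra.
Qed.

Lemma psi_sqr_le n (u : R) : 2 * u ^+ 2 <= omega n ^+ 2 -> psi n u ^+ 2 <= 8 / omega n.
Proof.
move=> hu; have := energy_le n u; have o1 := omega_ge1 n.
have := sqr_ge0 (psi n u); have := sqr_ge0 (dpsi n u).
move: (psi n u ^+ 2) (dpsi n u ^+ 2) (u ^+ 2) (omega n) hu o1 => p d w o *.
by rewrite ler_pdivlMr; nra.
Qed.

(** Here omega^2 - u^2 >= omega^2 / 2, so the energy dominates omega |psi dpsi| by the
    arithmetic-geometric mean inequality. *)
Lemma psi_dpsi_le n (u : R) : 2 * u ^+ 2 <= omega n ^+ 2 -> `|psi n u * dpsi n u| <= 4.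
Proof.
move=> hu; have := energy_le n u; have o1 := omega_ge1 n.
move: (psi n u) (dpsi n u) (omega n) hu o1 => p d o hu o1 h1.
have h2 : d ^+ 2 + o ^+ 2 / 2 * p ^+ 2 <= 4 * o.
  apply: le_trans h1; rewrite lerD2l ler_wpM2r ?sqr_ge0//; lra.
have h3 : `|p * d| * o <= 4 * o.
  rewrite -(gtr0_norm (lt_le_trans ltr01 o1)) -normrM.
  rewrite ler_norml ger0_norm; last lra.
  by apply/andP; split; nra.
by rewrite -(ler_pM2r (lt_le_trans ltr01 o1)).
Qed.

Lemma psi_psi_le n (u v : R) : 2 * u ^+ 2 <= omega n ^+ 2 -> 2 * v ^+ 2 <= omega n ^+ 2 ->
  `|psi n u * psi n v| <= 8 / omega n.
Proof.
move=> /psi_sqr_le + /psi_sqr_le; move: (8 / _) (psi n u) (psi n v) => b x y hx hy.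
by rewrite ler_norml; apply/andP; split; nra.
Qed.

Lemma half_kernel_shift n (s y X : R) : `|s| + `|y| <= X -> 2 * X ^+ 2 <= omega n ^+ 2 ->
  `|half_kernel n (s + y) (s - y) - half_kernel n y (- y)| <= 8 * X ^+ 2 / omega n.
Proof.
move=> sy hX.
have o0 : 0 < omega n := lt_le_trans ltr01 (omega_ge1 n).
have X0 : 0 <= X by apply: le_trans sy; rewrite addr_ge0.
have sX : `|s| <= X by apply: le_trans sy; rewrite lerDl.
have hx (x : R) : `|x| <= X -> 2 * x ^+ 2 <= omega n ^+ 2.
  move=> xX; apply: le_trans hX; rewrite ler_pM2l// -(real_normK (num_real x)).
  by rewrite lerXn2r ?nnegrE.
have := @mvt_bound (fun t => half_kernel n (t + y) (t - y)) _ s (X * (8 / omega n))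
  (fun t => is_derive_half_kernel n y t).
rewrite add0r sub0r => /(_ _) h1; apply: (le_trans (h1 _)) => [t ts|].
  rewrite mulNr normrN normrM ler_pM//; first exact: le_trans sX.
  have tX : `|t| + `|y| <= X by apply: le_trans sy; rewrite lerD2r.
  apply: psi_psi_le; apply: hx; apply: le_trans tX; first exact: ler_normD.
  by apply: (le_trans (ler_normB _ _)).
have -> : 8 * X ^+ 2 / omega n = X * (8 / omega n) * X by ring.
by rewrite ler_wpM2l// mulr_ge0// divr_ge0// ltW.
Qed.

(** Parity makes one of psi(0), dpsi(0) vanish. This removes the cosine from the oscillator
    estimate, and identifies the coefficient of the sine, up to the sign (-1)^n, with the energy at
    the origin, hence with the kernel there. *)
Lemma half_kernel_antidiagonal n (y : R) : 0 < y -> 2 * y ^+ 2 <= omega n ^+ 2 ->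
  `|half_kernel n y (- y) - half_kernel n 0 0 * sin (2 * omega n * y) / (2 * omega n * y)|
    <= 4 * (y ^+ 2 + y / omega n) / omega n.
Proof.
move=> y0 hy; have o0 : 0 < omega n := lt_le_trans ltr01 (omega_ge1 n).
have hx (t : R) : `|t| <= y -> 2 * t ^+ 2 <= omega n ^+ 2.
  move=> ty; apply: le_trans hy; rewrite ler_pM2l// -(real_normK (num_real t)).
  by rewrite lerXn2r ?nnegrE// ltW.
have d2 (t : R) : is_derive t 1 (dpsi n) (- (omega n ^+ 2 - t ^+ 2) * psi n t).
  by rewrite omega_sqr; exact: is_derive_dpsi.
have := @perturbed_oscillator_sqr (psi n) (dpsi n) (omega n) y (32 * y ^+ 2 + 32 * y / omega n)
  o0 (ltW y0) (fun t => is_derive_psi h n t) d2.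
move=> h1.
have [p0 q0] := psi_parity hermite_h n 0; rewrite oppr0 in p0 q0.
have [py qy] := psi_parity hermite_h n y.
have cd := christoffel_darboux hermite_h n y (- y); rewrite py qy in cd.
have ck := christoffel_darboux_diag hermite_h n 0; rewrite -omega_sqr expr0n/= subr0 in ck.
have e2 : (-1) ^+ n * (-1) ^+ n = 1 :> R by rewrite -expr2 sqrr_sign.
have en : `|(-1) ^+ n| = 1 :> R by rewrite normrX normrN1 expr1n.
move: h1 cd ck p0 q0 e2 en {py qy d2}.
(* The bound is 8 t^2 times the bound 4 on |psi dpsi|, plus 4 |t| times the bound 8 / omega on
   psi^2. *)
have hb (t : R) : `|t| <= y -> `|8 * t ^+ 2 * (psi n t * dpsi n t) + 4 * t * psi n t ^+ 2| <=
    32 * y ^+ 2 + 32 * y / omega n.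
  move=> ty; have t2 : t ^+ 2 <= y ^+ 2.
    by rewrite -(real_normK (num_real t)) lerXn2r ?nnegrE// ltW.
  apply: (le_trans (ler_normD _ _)); apply: lerD.
    rewrite normrM (ger0_norm (mulr_ge0 (ler0n R 8) (sqr_ge0 t))).
    have := psi_dpsi_le (hx t ty); have := sqr_ge0 t; move: `|psi n t * _| (normr_ge0 (psi n t * dpsi n t)) => *.
    nra.
  rewrite normrM (ger0_norm (sqr_ge0 (psi n t))) normrM (ger0_norm (ler0n R 4)).
  rewrite [leRHS](_ : _ = 4 * y * (8 / omega n)); last by ring.
  by apply: ler_pM; [exact: mulr_ge0|exact: sqr_ge0|rewrite ler_wpM2l|apply: psi_sqr_le; exact: hx].
move: (half_kernel n y (- y)) (half_kernel n 0 0) (psi n y) (dpsi n y) (psi n 0) (dpsi n 0)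
  ((-1) ^+ n) (omega n) o0 hb => H K p q p0 q0 ee o o0 hb /(_ hb).
move=> h1 cd ck ep eq e2 en.
have z : p0 * q0 = 0.
  have : p0 * q0 = - (ee * ee) * (p0 * q0) by rewrite [in LHS]ep [in LHS]eq; ring.
  by rewrite e2; lra.
have k2 : q0 ^+ 2 - o ^+ 2 * p0 ^+ 2 = - ee * (2 * K).
  rewrite ck; have a1 : p0 ^+ 2 = ee * p0 ^+ 2 by rewrite expr2 {1}ep; ring.
  have a2 : q0 ^+ 2 = - ee * q0 ^+ 2 by rewrite expr2 {1}eq; ring.
  by rewrite {1}a1 {1}a2; ring.
have pq : 2 * p * q = - ee * (4 * y * H).
  have -> : 4 * y * H = 2 * (y - - y) * H by ring.
  by rewrite cd; transitivity (ee * ee * (2 * p * q)); [rewrite e2 mul1r|ring].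
have z2 : 2 * p0 * q0 = 0 by rewrite -mulrA z mulr0.
rewrite z2 mul0r addr0 k2 pq in h1.
rewrite (_ : _ - _ = - ee * (4 * y * (H - K * sin (2 * o * y) / (2 * o * y)))) in h1; last first.
  by field; rewrite !gt_eqF.
rewrite !normrM normrN en mul1r (gtr0_norm y0) ger0_norm// in h1.
rewrite -(ler_pM2l (mulr_gt0 (ltr0n R 4) y0)).
apply: (le_trans h1); rewrite le_eqVlt; apply/orP; left; apply/eqP; field.
by rewrite gt_eqF.
Qed.

Lemma sine_kernelC (s x y : R) : sine_kernel s x y = sine_kernel s y x.
Proof.
rewrite /sine_kernel eq_sym; case: eqP => // _.
have -> : y - x = - (x - y) by rewrite opprB.
by rewrite !mulrN sinN invrN mulrN mulNr opprK.
Qed.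

(** For u = s + y and v = s - y one has |s| + |y| = max(|u|, |v|), so the path to the antidiagonal
    stays within X. The constant collects 8 X^2 from this shift, 4 from the half term, and 4 X^2 + 4
    X + 1 from the antidiagonal and the amplitude at the origin. *)
Lemma christoffel_sum_approx n (u v X : R) : `|u| <= X -> `|v| <= X ->
  2 * X ^+ 2 <= omega n ^+ 2 ->
  `|\sum_(j < n) psi j u * psi j v - sine_kernel (omega n / (2 * pi)) u v|
    <= (12 * X ^+ 2 + 4 * X + 5) / omega n.
Proof.
wlog uv : u v / v <= u.
  move=> H uX vX hX; have [vu|/ltW uv] := leP v u; first exact: H.
  rewrite sine_kernelC (eq_bigr (fun j : 'I_n => psi j v * psi j u)) => [|j _]; last by rewrite mulrC.
  exact: H.
move=> uX vX hX; have o1 := omega_ge1 n.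
have o0 : 0 < omega n := lt_le_trans ltr01 o1.
have X0 : 0 <= X by apply: le_trans uX.
have hx (t : R) : `|t| <= X -> 2 * t ^+ 2 <= omega n ^+ 2.
  move=> ty; apply: le_trans hX; rewrite ler_pM2l// -(real_normK (num_real t)).
  by rewrite lerXn2r ?nnegrE.
pose s := (u + v) / 2; pose y := (u - v) / 2.
have esu : s + y = u by rewrite /s /y; field.
have esv : s - y = v by rewrite /s /y; field.
have y0 : 0 <= y by rewrite divr_ge0// subr_ge0.
have syX : `|s| + `|y| <= X.
  rewrite (ger0_norm y0); have [s0|s0] := leP 0 s.
    by rewrite (ger0_norm s0) esu (le_trans (ler_norm _)).
  rewrite (ltr0_norm s0) (_ : - s + y = - v); last by rewrite -esv opprB addrC.
  by apply: le_trans vX; rewrite -normrN ler_norm.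
have h1 := half_kernel_shift syX hX; rewrite esu esv in h1.
have h2 := psi_psi_le (hx _ uX) (hx _ vX).
have h3 := half_kernel0_approx hermite_h n.
have -> : \sum_(j < n) psi j u * psi j v = half_kernel n u v - psi n u * psi n v / 2.
  by rewrite /half_kernel addrK.
suff h4 : `|half_kernel n y (- y) - sine_kernel (omega n / (2 * pi)) u v| <=
    (4 * X ^+ 2 + 4 * X + 1) / omega n.
  move: h1 h2 h4; rewrite ![_ / omega n]mulrC; move: (half_kernel _ _ _) (half_kernel _ _ _) (psi n u * psi n v) (sine_kernel _ _ _).
  move: (omega n)^-1 => i a b c d; rewrite !ler_norml => /andP[? ?] /andP[? ?] /andP[? ?].
  by apply/andP; split; lra.
move: y0; rewrite le_eqVlt => /predU1P[ye|y0].
  have uve : u = v by apply/eqP; rewrite -subr_eq0 -[u - v](@mulfVK _ 2)// -/y -ye mul0r.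
  rewrite -ye oppr0 /sine_kernel uve eqxx.
  have -> : 2 * (omega n / (2 * pi)) = omega n / pi :> R.
    by have : pi != 0 :> R by [rewrite gt_eqF// pi_gt0]; move: (pi : R) (omega n : R) => p o p0; field.
  apply: (le_trans h3); rewrite -[leLHS]mul1r ler_wpM2r ?invr_ge0 ?(ltW o0)// lerDr.
  by rewrite addr_ge0// mulr_ge0// sqr_ge0.
have yX : y <= X by apply: le_trans syX; rewrite (gtr0_norm y0) lerDr.
have h5 := half_kernel_antidiagonal y0 (hx y _).
rewrite (gtr0_norm y0) in h5; have {}h5 := h5 yX.
have -> : sine_kernel (omega n / (2 * pi)) u v = omega n / pi * sin (2 * omega n * y) / (2 * omega n * y).
  rewrite /sine_kernel; case: eqP => [uve|_].
    by move: y0; rewrite /y uve subrr mul0r ltxx.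
  have pn : pi != 0 :> R by rewrite gt_eqF// pi_gt0.
  have -> : u - v = 2 * y by rewrite /y; field.
  have -> : 2 * pi * (omega n / (2 * pi)) * (2 * y) = 2 * omega n * y.
    by move: (pi : R) pn (omega n) => p pn o; field.
  move: (pi : R) pn (omega n) o0 (sin _) => p pn o o0 S; field.
  by rewrite pn !gt_eqF.
have h6 : `|sin (2 * omega n * y) / (2 * omega n * y)| <= 1.
  have p0 : 0 < 2 * omega n * y by rewrite mulr_gt0// mulr_gt0.
  rewrite normrM normfV ler_pdivrMr ?normr_gt0 ?gt_eqF// mul1r.
  exact: ler_norm_sin.
have h7 : `|(half_kernel n 0 0 - omega n / pi) * (sin (2 * omega n * y) / (2 * omega n * y))| <= (omega n)^-1.
  by rewrite normrM; apply: (le_trans _ h3); rewrite ler_piMr.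
have h8 : 4 * (y ^+ 2 + y / omega n) / omega n <= (4 * X ^+ 2 + 4 * X) / omega n.
  rewrite ler_wpM2r ?invr_ge0 ?(ltW o0)// mulrDr lerD// ler_wpM2l//.
    by rewrite lerXn2r ?nnegrE// ltW.
  by rewrite ler_pdivrMr//; nra.
rewrite (_ : _ - _ = (half_kernel n y (- y) - half_kernel n 0 0 * sin (2 * omega n * y) / (2 * omega n * y)) +
  (half_kernel n 0 0 - omega n / pi) * (sin (2 * omega n * y) / (2 * omega n * y))); last by ring.
apply: (le_trans (ler_normD _ _)); rewrite [leRHS]mulrDl mul1r; apply: lerD => //.
exact: le_trans h8.
Qed.

(** A cruder bound, valid for all [u] and [v], for use far from the bulk of the weights; with
    absolute values inside the sum it also controls single terms. *)
Lemma christoffel_sum_le n (u v : R) :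
  \sum_(j < n) `|psi j u * psi j v| <= 2 * omega n.
Proof.
have hd (x : R) : \sum_(j < n) psi j x ^+ 2 <= 2 * omega n.
  apply: (le_trans _ (half_kernel0_le n)); apply: (le_trans _ (half_kernel_diag_le n x)).
  rewrite /half_kernel (eq_bigr (fun j : 'I_n => psi j x ^+ 2)) => [|j _]; last by rewrite expr2.
  by rewrite lerDl -expr2 divr_ge0// sqr_ge0.
apply: (@le_trans _ _ (\sum_(j < n) (psi j u ^+ 2 + psi j v ^+ 2) / 2)).
  apply: ler_sum => j _; move: (psi j u) (psi j v) => a b.
  have := sqr_ge0 (a - b); have := sqr_ge0 (a + b).
  by rewrite ler_norml sqrrB sqrrD => *; apply/andP; split; lra.
rewrite -mulr_suml big_split/=; have := hd u; have := hd v.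
move: (\sum_(j < n) psi j u ^+ 2) (\sum_(j < n) psi j v ^+ 2) => *; lra.
Qed.

End sine_kernel_approximation.

(** * Traces of products of near-diagonal kernels *)

Section iterated_kernels.
Context {R : realType}.
Notation mu := (@lebesgue_measure R).
Implicit Types (K L : R -> R -> R) (fs : nat -> R -> R).

Lemma bounded_support_integrable (g : R -> R) (M B : R) : measurable_fun setT g ->
  (forall z, `|g z| <= B) -> (forall z, M < `|z| -> g z = 0) ->
  mu.-integrable setT (EFin \o g).
Proof.
move=> mg gB gM.
have -> : EFin \o g = (EFin \o g) \_ `[- M, M].
  apply/funext => z; rewrite patchE; case: ifPn => // /negP zM; rewrite /= gM//.
  by rewrite ltNge; apply: contra_notN zM; rewrite inE/= in_itv/= ler_norml.
apply: (integrable_mkcond _ _).1 => //.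
apply: measurable_bounded_integrable => //.
- by rewrite /= lebesgue_measure_itv/=; case: ifP => // _; rewrite -EFinD ltry.
- exact: measurable_funTS.
- by exists B; split; [exact: num_real|move=> x Bx y _ /=; rewrite (le_trans (gB _))// ltW].
Qed.

Lemma bounded_support_integral_le (g H : R -> R) (M B : R) : measurable_fun setT g ->
  (forall z, `|g z| <= B) -> (forall z, M < `|z| -> g z = 0) ->
  continuous H -> (forall z, `|z| <= M -> `|g z| <= H z) ->
  (`|\int[mu]_z g z| <= \int[mu]_(z in `[- M, M]) H z)%R.
Proof.
move=> mg gB gM cH gH.
have ig := bounded_support_integrable mg gB gM.
apply: (le_trans (le_normr_Rintegral _ _)) => //.
have -> : (\int[mu]_t `|g t| = \int[mu]_(t in `[- M, M]) `|g t|)%R.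
  rewrite [RHS]Rintegral_mkcond; apply: eq_Rintegral => z _.
  rewrite patchE; case: ifPn => // /negP zM; rewrite /= gM ?normr0//.
  by rewrite ltNge; apply: contra_notN zM; rewrite inE/= in_itv/= ler_norml.
apply: le_Rintegral => //.
- by apply: (integrableS measurableT) => //; exact: integrable_norm.
- exact: integrable_segment.
- by move=> z; rewrite /= in_itv/= -ler_norml => /gH.
Qed.

(** Tonelli applies to the positive and negative parts, and the integral is by definition their
    difference, even when they are infinite. *)
Lemma measurable_Rintegral (d : measure_display) (T : measurableType d) (g : T -> R -> R) :
  measurable_fun setT (fun p : T * R => g p.1 p.2) ->
  measurable_fun setT (fun p => (\int[mu]_z g p z)%R).
Proof.
move=> mg; apply: (measurableT_comp (fine_measurable measurableT)).
pose f (p : T * R) := (g p.1 p.2)%:E.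
have mf : measurable_fun setT f by exact/measurable_EFinP.
have -> : (fun p => \int[mu]_z (g p z)%:E)%E =
    (fun p => fubini_F mu (f^\+)%E p - fubini_F mu (f^\-)%E p)%E.
  apply/funext => p; rewrite integralE /fubini_F /=; congr (_ - _)%E; apply: eq_integral => z _.
    by rewrite !funeposE.
  by rewrite !funenegE.
apply: emeasurable_funB.
- by apply: measurable_fun_fubini_tonelli_F => //; exact: measurable_funepos.
- by apply: measurable_fun_fubini_tonelli_F => //; exact: measurable_funeneg.
Qed.

Definition near_kernel (A x y : R) : R := (A^-1 + `|x - y|)^-1.

Lemma near_kernel_gt0 A x y : 0 < A -> 0 < near_kernel A x y.
Proof. by move=> A0; rewrite invr_gt0 ltr_wpDr// invr_gt0. Qed.

Lemma near_kernel_le A x y : 0 < A -> near_kernel A x y <= A.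
Proof.
by move=> A0; rewrite invf_ple ?posrE ?ltr_wpDr ?invr_gt0// lerDl.
Qed.

(* The reciprocal of [near_kernel] obeys the triangle inequality. *)
Lemma near_kernel_mul A x y z : 0 < A ->
  near_kernel A x z * near_kernel A z y <=
  near_kernel A x y * (near_kernel A x z + near_kernel A z y).
Proof.
move=> A0; rewrite /near_kernel.
have a0 : 0 < A^-1 by rewrite invr_gt0.
have := ler_distD z x y; move: `|x - y| `|x - z| `|z - y| (normr_ge0 (x - y)) (normr_ge0 (x - z)) (normr_ge0 (z - y)).
move: A^-1 a0 => a a0 u v w u0 v0 w0 uvw.
have p0 : 0 < a + u by lra. have p1 : 0 < a + v by lra. have p2 : 0 < a + w by lra.
have -> : (a + v)^-1 + (a + w)^-1 = (a + v)^-1 * (a + w)^-1 * (a + v + (a + w)).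
  by field; rewrite !gt_eqF.
rewrite mulrCA -[leLHS]mulr1 ler_pM2l ?mulr_gt0 ?invr_gt0//.
by rewrite mulrC ler_pdivlMr// mul1r; lra.
Qed.

Lemma near_kernelC A x y : near_kernel A x y = near_kernel A y x.
Proof. by rewrite /near_kernel distrC. Qed.

Lemma continuous_near_kernel A x : 0 < A -> continuous (near_kernel A x).
Proof.
move=> A0 z; apply: cvgV; first by rewrite gt_eqF// ltr_wpDr// invr_gt0.
apply: cvgD; first exact: cvg_cst.
by apply: cvg_norm; apply: cvgB; [exact: cvg_cst|exact: cvg_id].
Qed.

(** The segment [-M, M] lies in [x - 2M, x + 2M]; on each half an explicit logarithm is a primitive
    and contributes ln(1 + 2 M A). *)
Lemma near_kernel_integral A M x : 0 < A -> 0 < M -> `|x| <= M ->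
  (\int[mu]_(z in `[- M, M]) near_kernel A x z <= 2 * ln (1 + 2 * M * A))%R.
Proof.
move=> A0 M0 xM.
have a0 : 0 < A^-1 by rewrite invr_gt0.
have c := @continuous_near_kernel A x A0.
have mc : measurable_fun setT (near_kernel A x) by exact: continuous_measurable_fun.
have g0 z : (0 <= (near_kernel A x z)%:E)%E by rewrite lee_fin ltW// near_kernel_gt0.
have M2 : 0 < 2 * M by rewrite mulr_gt0.
have r1 : (\int[mu]_(z in `[x, (x + 2 * M)%R]) (near_kernel A x z)%:E = (ln (1 + 2 * M * A))%:E)%E.
  have h1 : x < x + 2 * M by rewrite ltrDl.
  have h2 z : x <= z <= x + 2 * M -> is_derive z 1 (fun z => ln (A^-1 + (z - x))) (near_kernel A x z).
    move=> /andP[xz _].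
    have z0 : 0 < A^-1 + (z - x) by rewrite ltr_wpDr// subr_ge0.
    have d1 := @is_derive1_ln _ _ z0.
    have d2 : is_derive z 1 (fun z => A^-1 + (z - x)) 1 by apply: trigger_derive; ring.
    have := @is_derive1_comp _ (@ln R) (fun z => A^-1 + (z - x)) z _ _ d1 d2.
    by rewrite mulr1 /near_kernel distrC ger0_norm// subr_ge0.
  rewrite (ftc_segment h1 h2 (fun z _ => c z)).
  rewrite subrr addr0 [x + _]addrC addrK -ln_div ?posrE ?addr_gt0//.
  by congr (ln _)%:E; rewrite invrK mulrDl mulVf ?gt_eqF.
have r2 : (\int[mu]_(z in `[(x - 2 * M)%R, x]) (near_kernel A x z)%:E = (ln (1 + 2 * M * A))%:E)%E.
  have h1 : x - 2 * M < x by rewrite ltrBlDr ltrDl.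
  have h2 z : x - 2 * M <= z <= x -> is_derive z 1 (fun z => - ln (A^-1 + (x - z))) (near_kernel A x z).
    move=> /andP[_ xz].
    have z0 : 0 < A^-1 + (x - z) by rewrite ltr_wpDr// subr_ge0.
    have d1 := @is_derive1_ln _ _ z0.
    have d2 : is_derive z 1 (fun z => A^-1 + (x - z)) (-1) by apply: trigger_derive; ring.
    have := @is_derive1_comp _ (@ln R) (fun z => A^-1 + (x - z)) z _ _ d1 d2.
    rewrite mulrN1 => d3; have -> : near_kernel A x z = - - (A^-1 + (x - z))^-1.
      by rewrite opprK /near_kernel ger0_norm// subr_ge0.
    exact: is_deriveN.
  rewrite (ftc_segment h1 h2 (fun z _ => c z)).
  rewrite subrr addr0 opprK opprB [x + _]addrC addrNK addrC -ln_div ?posrE ?addr_gt0//.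
  by congr (ln _)%:E; rewrite invrK mulrDl mulVf ?gt_eqF.
rewrite -lee_fin /Rintegral fineK; last first.
  by apply: integrable_fin_num => //; exact: integrable_segment.
have /andP[x1 x2] : - M <= x <= M by rewrite -ler_norml.
apply: (@le_trans _ _ (\int[mu]_(z in `[(x - 2 * M)%R, x[ `|` `[x, (x + 2 * M)%R]) (near_kernel A x z)%:E)%E).
  apply: ge0_subset_integral => //.
  - exact: measurableU.
  - by apply/measurable_EFinP; exact: measurable_funTS.
  - move=> z /=; rewrite !in_itv/= => /andP[z1 z2].
    by have [zx|zx] := ltP z x; [left|right]; apply/andP; split => //; lra.
rewrite ge0_integral_setU//; last 2 first.
- by apply/measurable_EFinP; exact: measurable_funTS.
- apply/disj_setPS => z /= []; rewrite !in_itv/= => /andP[_ h1] /andP[h2 _].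
  by move: h1; rewrite ltNge h2.
have -> : 2 * ln (1 + 2 * M * A) = ln (1 + 2 * M * A) + ln (1 + 2 * M * A) by ring.
rewrite r1 EFinD leeD// -r2.
apply: ge0_subset_integral => //; first by apply/measurable_EFinP; exact: measurable_funTS.
by move=> z /=; rewrite !in_itv/= => /andP[-> /ltW->].
Qed.

Lemma near_kernel_integral2 A M x y a b : 0 < A -> 0 < M -> `|x| <= M -> `|y| <= M ->
  0 <= a -> 0 <= b ->
  (\int[mu]_(z in `[- M, M]) (a * near_kernel A x z + b * near_kernel A y z)
    <= (a + b) * (2 * ln (1 + 2 * M * A)))%R.
Proof.
move=> A0 M0 xM yM a0 b0.
have i x' c : mu.-integrable `[- M, M] (EFin \o (fun z => c * near_kernel A x' z)).
  apply: integrable_segment => z; apply: cvgM; first exact: cvg_cst.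
  exact: continuous_near_kernel.
have i1 x' : mu.-integrable `[- M, M] (EFin \o near_kernel A x').
  by apply: integrable_segment; exact: continuous_near_kernel.
rewrite RintegralD// ?i// !RintegralZl// mulrDl lerD// ler_wpM2l//; exact: near_kernel_integral.
Qed.

(** The composition K f_i K f_(i+1) ... K with [n] inner integrations. It integrates in the order of
    [integral_Rn], so traces are expressed by it without Fubini. *)
Fixpoint iter_kernel K fs (n i : nat) (x y : R) : R :=
  if n is n'.+1 then (\int[mu]_z (K x z * fs i z * iter_kernel K fs n' i.+1 z y))%R else K x y.

Fixpoint chain K fs (i : nat) (x : R) (t : seq R) (y : R) : R :=
  if t is z :: t' then K x z * fs i z * chain K fs i.+1 z t' y else K x y.

Section bounded_kernel.
Variables (K : R -> R -> R) (fs : nat -> R -> R) (M B : R).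
Hypothesis K_meas : measurable_fun setT (fun p : R * R => K p.1 p.2).
Hypothesis fs_meas : forall i, measurable_fun setT (fs i).
Hypothesis K_bound : forall x y, `|K x y| <= B.
Hypothesis fs_bound : forall i x, `|fs i x| <= B.
Hypothesis fs_supp : forall i x, M < `|x| -> fs i x = 0.

Lemma iter_kernel_step_measurable (A : R -> R -> R) i :
  measurable_fun setT (fun p : R * R => A p.1 p.2) ->
  measurable_fun setT (fun q : (R * R) * R => K q.1.1 q.2 * fs i q.2 * A q.2 q.1.2).
Proof.
move=> mA.
have m12 : measurable_fun setT (fun q : (R * R) * R => (q.1.1, q.2)).
  by apply: measurable_fun_pair => //; exact: measurableT_comp.
have m22 : measurable_fun setT (fun q : (R * R) * R => (q.2, q.1.2)).
  by apply: measurable_fun_pair => //; exact: measurableT_comp.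
apply: measurable_funM; last exact: (measurableT_comp mA m22).
apply: measurable_funM; first exact: (measurableT_comp K_meas m12).
exact: measurableT_comp.
Qed.

(** Proved together because bounding one level uses measurability of the level below. The value of
    the bound is immaterial: it only ensures integrability. *)
Lemma iter_kernel_meas_bound n i :
  measurable_fun setT (fun p : R * R => iter_kernel K fs n i p.1 p.2) /\
  exists b, forall x y, `|iter_kernel K fs n i x y| <= b.
Proof.
elim: n i => [|n IH] i; first by split=> //; exists B.
have [mA [b Ab]] := IH i.+1.
have m := iter_kernel_step_measurable i mA.
split; first exact: (measurable_Rintegral (g := fun p z => K p.1 z * fs i z * iter_kernel K fs n i.+1 z p.2)).
exists (\int[mu]_(z in `[- M, M]) (B * B * b))%R => x y /=.
apply: bounded_support_integral_le (B * B * b) _ _ _ _ _.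
- exact: (measurable_fun_pair2 (x, y) m).
- by move=> z; rewrite !normrM !ler_pM// mulr_ge0.
- by move=> z /(fs_supp i) ->; rewrite mulr0 mul0r.
- by move=> z; exact: cvg_cst.
- by move=> z _; rewrite !normrM !ler_pM// mulr_ge0.
Qed.

Lemma iter_kernel_integrable n i x y :
  mu.-integrable setT (EFin \o (fun z => K x z * fs i z * iter_kernel K fs n i.+1 z y)).
Proof.
have [mA [b Ab]] := iter_kernel_meas_bound n i.+1.
apply: (@bounded_support_integrable _ M (B * B * b)).
- exact: (measurable_fun_pair2 (x, y) (iter_kernel_step_measurable i mA)).
- by move=> z; rewrite !normrM !ler_pM// mulr_ge0.
- by move=> z /(fs_supp i) ->; rewrite mulr0 mul0r.
Qed.

Lemma integral_chain n i c x y :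
  integral_Rn (fun t : n.-tuple R => c * chain K fs i x t y) = c * iter_kernel K fs n i x y.
Proof.
elim: n i c x => [|n IH] i c x //=.
rewrite -RintegralZl//; last exact: iter_kernel_integrable.
apply: eq_Rintegral => z _.
rewrite (_ : (fun t => _) = (fun t : n.-tuple R => c * (K x z * fs i z) * chain K fs i.+1 z t y)).
  by rewrite IH !mulrA.
by apply/funext => t; rewrite !mulrA.
Qed.

End bounded_kernel.

Section two_kernels.
Variables (K L : R -> R -> R) (fs : nat -> R -> R) (M B F C A e : R).
Hypotheses (A0 : 0 < A) (M0 : 0 < M) (F0 : 0 <= F) (C0 : 0 <= C) (e0 : 0 <= e).
Hypothesis K_meas : measurable_fun setT (fun p : R * R => K p.1 p.2).
Hypothesis L_meas : measurable_fun setT (fun p : R * R => L p.1 p.2).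
Hypothesis fs_meas : forall i, measurable_fun setT (fs i).
Hypothesis K_bound : forall x y, `|K x y| <= B.
Hypothesis L_bound : forall x y, `|L x y| <= B.
Hypothesis fs_bound : forall i x, `|fs i x| <= B.
Hypothesis fs_supp : forall i x, M < `|x| -> fs i x = 0.
Hypothesis fs_le : forall i x, `|fs i x| <= F.
Hypothesis K_le : forall x y, `|x| <= M -> `|y| <= M -> `|K x y| <= C * near_kernel A x y.
Hypothesis L_le : forall x y, `|x| <= M -> `|y| <= M -> `|L x y| <= C * near_kernel A x y.
Hypothesis KL_le : forall x y, `|x| <= M -> `|y| <= M -> `|K x y - L x y| <= e.

(** The cost of one composition: [C] for the kernel, [F] for the test function, and two terms from
    [near_kernel_mul], each with integral at most 2 ln(1 + 2 M A). *)
Let q := 2 * C * F * (2 * ln (1 + 2 * M * A)).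

Lemma log_factor_ge0 : 0 <= 2 * ln (1 + 2 * M * A).
Proof. by rewrite mulr_ge0// ln_ge0// lerDl !mulr_ge0// ltW. Qed.

Lemma iter_kernel_le n i x y : `|x| <= M -> `|y| <= M ->
  `|iter_kernel K fs n i x y| <= C * q ^+ n * near_kernel A x y.
Proof.
have q0 : 0 <= q by rewrite /q; apply: mulr_ge0; [rewrite !mulr_ge0|exact: log_factor_ge0].
elim: n i x => [|n IH] i x xM yM; first by rewrite expr0 mulr1 K_le.
have [mA [b Ab]] := iter_kernel_meas_bound K_meas fs_meas K_bound fs_bound fs_supp n i.+1.
have G0 := ltW (near_kernel_gt0 x y A0).
set c := C * F * (C * q ^+ n) * near_kernel A x y.
have c0 : 0 <= c by rewrite /c !mulr_ge0// exprn_ge0.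
rewrite /=; apply: (le_trans (@bounded_support_integral_le _
  (fun z => c * near_kernel A x z + c * near_kernel A y z) M (B * B * b) _ _ _ _ _)).
- exact: (measurable_fun_pair2 (x, y) (iter_kernel_step_measurable K_meas fs_meas i mA)).
- by move=> z; rewrite !normrM !ler_pM// mulr_ge0.
- by move=> z /(fs_supp i) ->; rewrite mulr0 mul0r.
- move=> z; apply: cvgD; apply: cvgM; try exact: cvg_cst; exact: continuous_near_kernel.
- move=> z zM; have h1 := IH i.+1 z zM yM; have h2 := K_le xM zM; have h3 := fs_le i z.
  have Gxz := ltW (near_kernel_gt0 x z A0); have Gzy := ltW (near_kernel_gt0 z y A0).
  apply: (@le_trans _ _ (C * near_kernel A x z * F * (C * q ^+ n * near_kernel A z y))).
    by rewrite !normrM !ler_pM// mulr_ge0.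
  have -> : C * near_kernel A x z * F * (C * q ^+ n * near_kernel A z y) =
    C * F * (C * q ^+ n) * (near_kernel A x z * near_kernel A z y) by ring.
  rewrite -mulrDr [near_kernel A y z]near_kernelC /c -(mulrA _ (near_kernel A x y)).
  by rewrite ler_wpM2l ?near_kernel_mul// !mulr_ge0// exprn_ge0.
- apply: (le_trans (near_kernel_integral2 A0 M0 xM yM c0 c0)).
  have -> : (c + c) * (2 * ln (1 + 2 * M * A)) = q * (C * q ^+ n) * near_kernel A x y.
    by rewrite /c; set r := q ^+ n; rewrite /q; ring.
  by rewrite le_eqVlt exprS; apply/orP; left; apply/eqP; ring.
Qed.

Lemma iter_kernel_close n i x y : `|x| <= M -> `|y| <= M ->
  `|iter_kernel K fs n i x y - iter_kernel L fs n i x y| <= e * n.+1%:R * q ^+ n.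
Proof.
have q0 : 0 <= q by rewrite /q; apply: mulr_ge0; [rewrite !mulr_ge0|exact: log_factor_ge0].
elim: n i x => [|n IH] i x xM yM; first by rewrite expr0 !mulr1 KL_le.
have [mA [b Ab]] := iter_kernel_meas_bound K_meas fs_meas K_bound fs_bound fs_supp n i.+1.
have [mA' [b' Ab']] := iter_kernel_meas_bound L_meas fs_meas L_bound fs_bound fs_supp n i.+1.
set c1 := e * F * (C * q ^+ n); set c2 := C * F * (e * n.+1%:R * q ^+ n).
have c10 : 0 <= c1 by rewrite /c1 !mulr_ge0// exprn_ge0.
have c20 : 0 <= c2 by rewrite /c2 !mulr_ge0// exprn_ge0.
rewrite /= -RintegralB//; last 2 first.
- exact: (iter_kernel_integrable K_meas fs_meas K_bound fs_bound fs_supp).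
- exact: (iter_kernel_integrable L_meas fs_meas L_bound fs_bound fs_supp).
apply: (le_trans (@bounded_support_integral_le _
  (fun z => c2 * near_kernel A x z + c1 * near_kernel A y z) M (B * B * b + B * B * b') _ _ _ _ _)).
- apply: measurable_funB.
  + exact: (measurable_fun_pair2 (x, y) (iter_kernel_step_measurable K_meas fs_meas i mA)).
  + exact: (measurable_fun_pair2 (x, y) (iter_kernel_step_measurable L_meas fs_meas i mA')).
- move=> z; apply: (le_trans (ler_normB _ _)).
  by apply: lerD; rewrite !normrM !ler_pM// mulr_ge0.
- by move=> z /(fs_supp i) ->; rewrite !(mulr0, mul0r) subr0.
- move=> z; apply: cvgD; apply: cvgM; try exact: cvg_cst; exact: continuous_near_kernel.
- move=> z zM; have h1 := iter_kernel_le n i.+1 zM yM; have h2 := L_le xM zM; have h3 := fs_le i z.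
  have h4 := KL_le xM zM; have h5 := IH i.+1 z zM yM.
  have Gxz := ltW (near_kernel_gt0 x z A0); have Gzy := ltW (near_kernel_gt0 z y A0).
  (* Telescoping: in each summand one kernel carries the uniform error and the other is a
     near-diagonal kernel, whose integral is only logarithmic. *)
  rewrite (_ : _ - _ = L x z * fs i z * (iter_kernel K fs n i.+1 z y - iter_kernel L fs n i.+1 z y) +
    (K x z - L x z) * fs i z * iter_kernel K fs n i.+1 z y); last by ring.
  apply: (le_trans (ler_normD _ _)); apply: lerD.
    rewrite (_ : c2 * _ = C * near_kernel A x z * F * (e * n.+1%:R * q ^+ n)); last by rewrite /c2; ring.
    by rewrite !normrM !ler_pM// mulr_ge0.
  rewrite (_ : c1 * _ = e * F * (C * q ^+ n * near_kernel A z y)); last by rewrite /c1 near_kernelC; ring.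
  by rewrite !normrM !ler_pM// mulr_ge0.
- apply: (le_trans (near_kernel_integral2 A0 M0 xM yM c20 c10)).
  (* Each summand involves a single [near_kernel], whence q / 2 instead of [q]; the gain of 1/2 is
     then dropped. *)
  have -> : (c2 + c1) * (2 * ln (1 + 2 * M * A)) = q * (e * (n.+1%:R + 1) * q ^+ n) / 2.
    by rewrite /c1 /c2; set r := q ^+ n; rewrite /q; field.
  rewrite -[n.+2%:R]natr1 exprS.
  have -> : e * (n.+1%:R + 1) * (q * q ^+ n) = q * (e * (n.+1%:R + 1) * q ^+ n) by ring.
  by rewrite ler_pdivrMr// ler_peMr ?ler1n// mulr_ge0// mulr_ge0 ?exprn_ge0// mulr_ge0.
Qed.

End two_kernels.

End iterated_kernels.

(** * Traces as integrals of iterated kernels *)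

Section kernel_traces.
Context {R : realType}.
Notation mu := (@lebesgue_measure R).

Lemma chain_prod (K : R -> R -> R) (fs : nat -> R -> R) i x (t : seq R) y :
  chain K fs i x t y = (\prod_(j < size t) (K (nth 0 (x :: t) j) (nth 0 (x :: t) j.+1) *
    fs (i + j)%N (nth 0 (x :: t) j.+1))) * K (last x t) y.
Proof.
elim: t i x => [|z t IH] i x; first by rewrite big_ord0 mul1r.
rewrite big_ord_recl/= IH addn0 mulrA; congr (_ * _ * _).
by apply: eq_bigr => j _; rewrite /bump /= add1n addSnnS.
Qed.

(** The cyclic successor wraps around only at the last index, so cutting there turns the product
    into a chain from [x] back to [x]. The passage through [inord] lets the chain shift its index
    freely. *)
Lemma kernel_trace_chain n (f : 'I_n.+1 -> R -> R) (K : R -> R -> R) :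
  let fs i := f (inord i) in
  kernel_trace f K =
  (\int[mu]_x integral_Rn (fun t : n.-tuple R => fs 0%N x * chain K fs 1 x t x))%R.
Proof.
move=> fs; rewrite /kernel_trace /=; apply: eq_Rintegral => x _; congr integral_Rn.
apply/funext => t; have e := chain_prod K fs 1 x t x; rewrite size_tuple in e; rewrite {}e.
have tn (i : 'I_n.+1) : tnth [tuple of x :: t] i = nth 0 (x :: t) i by rewrite (tnth_nth 0).
under eq_bigr do rewrite !tn.
rewrite big_split/= big_ord_recl/= [X in _ * X]big_ord_recr/= !big_split/=.
have -> : nth 0 (x :: t) (n.+1 %% n.+1) = x by rewrite modnn.
have -> : nth 0 (x :: t) n = last x t by have := nth_last 0 (x :: t); rewrite /= size_tuple.
have -> : fs 0%N = f ord0 by congr f; apply/val_inj; rewrite /= inordK.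
have -> : \prod_(i < n) f (lift ord0 i) (nth 0 (tval t) (0 + i)) =
    \prod_(i < n) fs (1 + i)%N (nth 0 (tval t) i).
  by apply: eq_bigr => j _; congr (f _ _); apply/val_inj; rewrite /= inordK// ltnS.
have -> : \prod_(i < n) K (nth 0 (x :: t) i) (nth 0 (x :: t) (i.+1 %% n.+1)) =
    \prod_(i < n) K (nth 0 (x :: t) i) (nth 0 (tval t) i).
  by apply: eq_bigr => j _; rewrite modn_small// ltnS.
by rewrite -!mulrA; congr (_ * _); rewrite mulrCA mulrA.
Qed.

Section close.
Variables (n : nat) (f : 'I_n.+1 -> R -> R) (K L : R -> R -> R) (M B F C A e : R).
Hypotheses (A0 : 0 < A) (M0 : 0 < M) (F0 : 0 <= F) (C0 : 0 <= C) (e0 : 0 <= e).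
Hypothesis f_meas : forall i, measurable_fun setT (f i).
Hypothesis f_supp : forall i x, M < `|x| -> f i x = 0.
Hypothesis f_le : forall i x, `|f i x| <= F.
Hypothesis K_meas : measurable_fun setT (fun p : R * R => K p.1 p.2).
Hypothesis L_meas : measurable_fun setT (fun p : R * R => L p.1 p.2).
Hypothesis K_le : forall x y, `|x| <= M -> `|y| <= M -> `|K x y| <= C * near_kernel A x y.
Hypothesis L_le : forall x y, `|x| <= M -> `|y| <= M -> `|L x y| <= C * near_kernel A x y.
Hypothesis KL_le : forall x y, `|x| <= M -> `|y| <= M -> `|K x y - L x y| <= e.

(** The kernels are controlled only on the square that carries the test functions. Cutting them off
    outside it leaves the traces unchanged and supplies the global bounds assumed by the iteration
    lemmas. *)
Definition truncate_kernel (H : R -> R -> R) x y :=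
  if (`|x| <= M) && (`|y| <= M) then H x y else 0.

Lemma kernel_trace_truncate H : kernel_trace f (truncate_kernel H) = kernel_trace f H.
Proof.
rewrite /kernel_trace; congr integral_Rn; apply/funext => t.
have [/forallP h|/forallPn[i]] := boolP [forall i, `|tnth t i| <= M].
  by apply: eq_bigr => i _; rewrite /truncate_kernel !h.
rewrite -ltNge => /(f_supp i) fi.
by rewrite [LHS](bigD1 i)//= [RHS](bigD1 i)//= fi !mul0r.
Qed.

Lemma measurable_truncate_kernel H : measurable_fun setT (fun p : R * R => H p.1 p.2) ->
  measurable_fun setT (fun p : R * R => truncate_kernel H p.1 p.2).
Proof.
move=> mH; apply: measurable_fun_ifT => //; apply: measurable_and; apply: measurable_fun_ler => //.
- by apply: measurableT_comp => //; exact: measurable_fst.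
- by apply: measurableT_comp => //; exact: measurable_snd.
Qed.

Lemma kernel_trace_iter (H : R -> R -> R) (D : R) : measurable_fun setT (fun p : R * R => H p.1 p.2) ->
  (forall x y, `|H x y| <= D) ->
  kernel_trace f H =
  (\int[mu]_x (f (inord 0) x * iter_kernel H (fun i => f (inord i)) n 1 x x))%R.
Proof.
move=> mH HD; rewrite kernel_trace_chain; apply: eq_Rintegral => x _.
apply: (@integral_chain _ H (fun i => f (inord i)) M (Num.max D F)) => //.
- by move=> *; rewrite le_max HD.
- by move=> *; rewrite le_max f_le orbT.
- by move=> *; exact: f_supp.
Qed.

Lemma kernel_trace_close : `|kernel_trace f K - kernel_trace f L| <=
  2 * M * (F * (e * n.+1%:R * (2 * C * F * (2 * ln (1 + 2 * M * A))) ^+ n)).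
Proof.
rewrite -(kernel_trace_truncate K) -(kernel_trace_truncate L).
set K1 := truncate_kernel K; set L1 := truncate_kernel L.
have CA0 : 0 <= C * A by rewrite mulr_ge0// ltW.
have bnd H : (forall x y, `|x| <= M -> `|y| <= M -> `|H x y| <= C * near_kernel A x y) ->
    forall x y, `|truncate_kernel H x y| <= C * A.
  move=> HC x y; rewrite /truncate_kernel; case: ifP => [/andP[xM yM]|_]; last by rewrite normr0.
  by rewrite (le_trans (HC _ _ xM yM))// ler_wpM2l// near_kernel_le.
have trE H x y : `|x| <= M -> `|y| <= M -> truncate_kernel H x y = H x y.
  by move=> xM yM; rewrite /truncate_kernel xM yM.
have mK := measurable_truncate_kernel K_meas; have mL := measurable_truncate_kernel L_meas.
rewrite -/K1 in mK; rewrite -/L1 in mL.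
pose D := Num.max (C * A) F; pose fs i := f (inord i).
have KD x y : `|K1 x y| <= D by rewrite le_max bnd.
have LD x y : `|L1 x y| <= D by rewrite le_max bnd.
have fD i x : `|fs i x| <= D by rewrite le_max f_le orbT.
have fS i x : M < `|x| -> fs i x = 0 by exact: f_supp.
have fm i : measurable_fun setT (fs i) by exact: f_meas.
rewrite (kernel_trace_iter mK KD) (kernel_trace_iter mL LD).
have [mKi [bK hK]] := iter_kernel_meas_bound mK fm KD fD fS n 1.
have [mLi [bL hL]] := iter_kernel_meas_bound mL fm LD fD fS n 1.
have diag (H : R -> R -> R) : measurable_fun setT (fun p : R * R => H p.1 p.2) ->
    measurable_fun setT (fun x => f (inord 0) x * H x x).
  move=> mH; apply: measurable_funM => //.
  by apply: (@measurableT_comp _ _ _ _ _ _ (fun p : R * R => H p.1 p.2) _ (fun x : R => (x, x))) => //; exact: measurable_fun_pair.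
have FD : F <= D by rewrite le_max lexx orbT.
have intg (H : R -> R -> R) b : measurable_fun setT (fun p : R * R => H p.1 p.2) ->
    (forall x y, `|H x y| <= b) -> mu.-integrable setT (EFin \o (fun x => f (inord 0) x * H x x)).
  move=> mH Hb; apply: (@bounded_support_integrable _ _ M (F * b)); first exact: diag.
  - by move=> z; rewrite normrM ler_pM.
  - by move=> z /(f_supp (inord 0)) ->; rewrite mul0r.
rewrite -RintegralB//; [|exact: intg mKi hK|exact: intg mLi hL].
set c := F * _.
have c0 : 0 <= c.
  by rewrite /c !mulr_ge0// exprn_ge0// !mulr_ge0// ln_ge0// lerDl !mulr_ge0// ltW.
apply: (le_trans (@bounded_support_integral_le _ _ (cst c) M (F * bK + F * bL) _ _ _ _ _)).
- by apply: measurable_funB; [exact: diag mKi|exact: diag mLi].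
- by move=> z; rewrite (le_trans (ler_normB _ _))// lerD// normrM ler_pM.
- by move=> z /(f_supp (inord 0)) ->; rewrite !mul0r subr0.
- by move=> z; exact: cvg_cst.
- move=> z zM; rewrite -mulrBr normrM /c ler_pM//.
  apply: (@iter_kernel_close _ K1 L1 fs M D F C A e) => //.
  + by move=> i x; exact: f_le.
  + by move=> x y xM yM; rewrite /K1 trE// K_le.
  + by move=> x y xM yM; rewrite /L1 trE// L_le.
  + by move=> x y xM yM; rewrite /K1 /L1 !trE// KL_le.
- have MM : - M < M by rewrite gtrN.
  rewrite Rintegral_cst//= lebesgue_measure_itv/= lte_fin MM -EFinD/= mulrC opprK.
  by rewrite -mulr2n -[M *+ 2]mulr_natl.
Qed.

End close.
End kernel_traces.

(** * Tails of the shape *)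

Section shape_tails.
Context {R : realType}.
Notation mu := (@lebesgue_measure R).

(** Otherwise [f] would be at least [e] on a set of infinite measure. Combined with monotonicity,
    this stands in for the limit of the shape at infinity. *)
Lemma integrable_small_value (D : set R) (f : R -> R) (e : R) : measurable D ->
  mu D = +oo%E -> (forall x, 0 <= f x) -> mu.-integrable D (EFin \o f) -> 0 < e ->
  exists2 x, D x & f x < e.
Proof.
move=> mD Doo f0 intf e0; apply: contrapT => h.
have fe x : D x -> e <= f x.
  by move=> Dx; rewrite leNgt; apply/negP => fxe; apply: h; exists x.
have /integrableP[mf] := intf; apply/negP; rewrite -leNgt.
apply: (@le_trans _ _ (\int[mu]_(x in D) e%:E)%E).
  by rewrite integral_cst// [X in (_ * X)%E](_ : _ = +oo%E)// gt0_muley.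
apply: ge0_le_integral => //.
- by move=> x _; rewrite lee_fin ltW.
- exact: measurableT_comp.
- by move=> x Dx; rewrite /= lee_fin (le_trans (fe _ Dx))// ler_norm.
Qed.

(** The difference between [f] and the claimed bound is nondecreasing on the positive axis. It is at
    most [f], which is eventually below any positive [e], so it is nonpositive. *)
Lemma exp_tail_of_derivative (f df : R -> R) (c : R) : 0 < c ->
  (forall t : R, is_derive t 1 f (df t)) -> (forall t, df t <= 0) ->
  (forall t, 0 <= t -> - df t <= expR (- (c * t))) ->
  (forall e, 0 < e -> exists2 z, 0 <= z & f z < e) ->
  forall x, 0 <= x -> f x <= c^-1 * expR (- (c * x)).
Proof.
move=> c0 fd df0 dfe fs x x0.
have fni a b : a <= b -> f b <= f a.
  move=> ab; have [|z _ e] := @MVT_segment _ f df a b ab (fun x _ => fd x).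
    apply: continuous_subspaceT => t; apply/differentiable_continuous/derivable1_diffP.
    by have [] := fd t.
  by rewrite -subr_le0 e mulr_le0_ge0// subr_ge0.
pose q t := f t - c^-1 * expR (- (c * t)).
have dq (t : R) : is_derive t 1 q (df t + expR (- (c * t))).
  have := fd t => h.
  have e1 : is_derive t 1 (fun t => expR (- (c * t))) (expR (- (c * t)) * - c).
    apply: (@is_derive1_comp _ expR (fun t => - (c * t))).
    by apply: trigger_derive; rewrite /GRing.scale/=; ring.
  apply: trigger_derive; rewrite /GRing.scale/=; field.
  by rewrite gt_eqF.
have qnd a b : 0 <= a -> a <= b -> q a <= q b.
  move=> a0 ab; have [|z] := @MVT_segment _ q _ a b ab (fun x _ => dq x).
    apply: continuous_subspaceT => t; apply/differentiable_continuous/derivable1_diffP.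
    by have [] := dq t.
  rewrite in_itv/= => /andP[az _] e; rewrite -subr_ge0 e mulr_ge0 ?subr_ge0//.
  by rewrite addrC -lerBlDr sub0r dfe// (le_trans a0).
rewrite -subr_le0; apply/ler_addgt0Pr => e e0; rewrite add0r.
have [z z0 fz] := fs e e0.
apply: (le_trans (qnd x (Num.max x z) x0 _)); first by rewrite le_max lexx.
apply: (@le_trans _ _ (f (Num.max x z))).
  by rewrite /q lerBlDr lerDl mulr_ge0// ?invr_ge0 ?expR_ge0// ltW.
by apply: (le_trans (fni z _ _)); [rewrite le_max lexx orbT|exact: ltW].
Qed.

Lemma shape_nincr (Psi : R -> R) a b : is_shape Psi -> a <= b -> Psi b <= Psi a.
Proof.
move=> [_ dP dP0 _ _ _] ab.
have fd (t : R) : is_derive t 1 Psi (Psi^`()%classic t).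
  by rewrite derive1E; exact/derivableP.
have [|z _ e] := @MVT_segment _ Psi _ a b ab (fun x _ => fd x).
  apply: continuous_subspaceT => t; apply/differentiable_continuous/derivable1_diffP.
  exact: dP.
by rewrite -subr_le0 e mulr_le0_ge0// subr_ge0.
Qed.

Lemma shape_star_tails (Psi : R -> R) : is_shape_star Psi ->
  exists2 c : R, 0 < c & forall x, 0 <= x ->
    Psi x <= c^-1 * expR (- (c * x)) /\ 1 - Psi (- x) <= c^-1 * expR (- (c * x)).
Proof.
move=> [[P01 dP dP0 _ iR iL] [c c0 Pc]]; exists c => // x x0.
have fd (t : R) : is_derive t 1 Psi (Psi^`()%classic t).
  by rewrite derive1E; exact/derivableP.
split.
- apply: (@exp_tail_of_derivative Psi Psi^`()%classic) => //.
  + by move=> t t0; have := Pc t; rewrite /Phi (ger0_norm t0).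
  + move=> e e0; have [|||z] := @integrable_small_value `]0, +oo[ Psi e _ _ _ iR e0 => //.
    * by rewrite lebesgue_measure_itv/= ltry.
    * by move=> z; have /andP[] := P01 z.
    * by rewrite /= in_itv/= andbT => /ltW z0; exists z.
- apply: (@exp_tail_of_derivative (fun x => 1 - Psi (- x)) (fun x => Psi^`()%classic (- x))) => //.
  + move=> t; have h : is_derive t 1 (fun t => Psi (- t)) (Psi^`()%classic (- t) * -1).
      by apply: (@is_derive1_comp _ Psi (fun t => - t)); apply: trigger_derive.
    by apply: trigger_derive; rewrite /GRing.scale/=; ring.
  + by move=> t t0; have := Pc (- t); rewrite /Phi normrN (ger0_norm t0).
  + move=> e e0; have [|||z] := @integrable_small_value `]-oo, 0[ (fun x => 1 - Psi x) e _ _ _ iL e0 => //.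
    * by rewrite lebesgue_measure_itv/= ltNyr.
    * by move=> z; rewrite subr_ge0; have /andP[] := P01 z.
    * by rewrite /= in_itv/= => /ltW z0; exists (- z); rewrite ?oppr_ge0 ?opprK.
Qed.

End shape_tails.

(** * Averages of sine kernels *)

Section sine_kernel_bounds.
Context {R : realType}.

Lemma ler_dist_sin (x y : R) : `|sin x - sin y| <= `|x - y|.
Proof.
have d (t : R) : is_derive t 1 (fun t => sin (y + t)) (cos (y + t)).
  rewrite -[cos _]mulr1; apply: (@is_derive1_comp _ sin (fun t => y + t)).
  by apply: trigger_derive; ring.
have := @mvt_bound _ (fun t => sin (y + t)) _ (x - y) 1 d.
rewrite addr0 mul1r [y + _]addrC subrK; apply => t _.
by rewrite ler_norml cos_geN1 cos_le1.
Qed.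

Lemma sine_kernel_lipschitz (s s' x y : R) :
  `|sine_kernel s x y - sine_kernel s' x y| <= 2 * `|s - s'|.
Proof.
rewrite /sine_kernel; case: eqP => [_|/eqP xy].
  by rewrite -mulrBr normrM ger0_norm.
have r0 : 0 < `|x - y| by rewrite normr_gt0 subr_eq0.
rewrite -mulrBl normrM normfV normrM (gtr0_norm (pi_gt0 R)).
rewrite ler_pdivrMr ?mulr_gt0 ?pi_gt0//; apply: (le_trans (ler_dist_sin _ _)).
rewrite -mulrBl -mulrBr !normrM (gtr0_norm (pi_gt0 R)) ger0_norm//.
by rewrite le_eqVlt; apply/orP; left; apply/eqP; ring.
Qed.

Lemma sine_kernel0 (x y : R) : sine_kernel 0 x y = 0.
Proof. by rewrite /sine_kernel !mulr0 mul0r sin0 mul0r; case: ifP. Qed.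

(** Within distance 1/A the kernel is at most 2 s <= A; beyond it, the sine is at most 1 and 1/A is
    absorbed by |x - y|. *)
Lemma sine_kernel_le_near (s A x y : R) : 0 <= s -> 0 < A -> 2 * s <= A ->
  `|sine_kernel s x y| <= 2 * near_kernel A x y.
Proof.
move=> s0 A0 sA.
have k1 : `|sine_kernel s x y| <= A.
  have := sine_kernel_lipschitz s 0 x y; rewrite sine_kernel0 !subr0 (ger0_norm s0) => h.
  exact: le_trans sA.
rewrite /near_kernel; have a0 : 0 < A^-1 by rewrite invr_gt0.
have [h|h] := leP `|x - y| A^-1.
  apply: (le_trans k1); rewrite ler_pdivlMr ?ltr_wpDr//.
  apply: (@le_trans _ _ (A * (A^-1 + A^-1))); first by rewrite ler_pM2l// lerD2l.
  by rewrite mulrDr mulfV ?gt_eqF.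
have r0 : 0 < `|x - y| := lt_trans a0 h.
rewrite /sine_kernel; case: eqP => [xy|/eqP xy]; first by rewrite xy subrr normr0 ltxx in r0.
rewrite normrM normfV normrM (gtr0_norm (pi_gt0 R)).
rewrite ler_pdivrMr ?mulr_gt0 ?pi_gt0//.
apply: (@le_trans _ _ 1); first by rewrite ler_norml sin_geN1 sin_le1.
rewrite mulrAC ler_pdivlMr ?ltr_wpDr// mul1r.
have := pi_ge2 R; move: (pi : R) => p p2; nra.
Qed.

Lemma sine_kernel_scale (a s x y : R) : a != 0 ->
  a * sine_kernel s (a * x) (a * y) = sine_kernel (a * s) x y.
Proof.
move=> a0; rewrite /sine_kernel (inj_eq (mulfI a0)); case: eqP => [_|/eqP xy]; first by ring.
have p0 : pi != 0 :> R by rewrite gt_eqF// pi_gt0.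
have r0 : x - y != 0 by rewrite subr_eq0.
rewrite -mulrBr; move: (pi : R) p0 (x - y) r0 => p p0 r r0.
have -> : 2 * p * s * (a * r) = 2 * p * (a * s) * r by ring.
by field; rewrite a0 p0 r0.
Qed.

Lemma measurable_invr : measurable_fun setT (fun x : R => x^-1).
Proof.
(* Squaring makes the base of the real power nonnegative; the factor [x] restores the sign and the
   value 0 at 0. *)
have -> : (fun x : R => x^-1) = (fun x => x * (x ^+ 2) `^ (- 1)).
  apply/funext => x; rewrite powR_inv1 ?sqr_ge0//.
  have [->|x0] := eqVneq x 0; first by rewrite invr0 mul0r.
  by field.
apply: measurable_funM => //; apply: (measurableT_comp (measurable_powR _)) => //.
Qed.

Lemma measurable_sine_kernel (s : R) :
  measurable_fun setT (fun p : R * R => sine_kernel s p.1 p.2).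
Proof.
apply: measurable_fun_ifT.
- exact: measurable_fun_eqr.
- exact: measurable_cst.
- have m : measurable_fun setT (fun p : R * R => p.1 - p.2).
    by apply: measurable_funB; [exact: measurable_fst|exact: measurable_snd].
  apply: measurable_funM.
    apply: (measurableT_comp (continuous_measurable_fun (@continuous_sin R))).
    exact: measurable_funM.
  by apply: (measurableT_comp measurable_invr); exact: measurable_funM.
Qed.

Lemma abel_sum (p S : nat -> R) m : S 0%N = 0 ->
  \sum_(k < m) p k * (S k.+1 - S k) = p m * S m + \sum_(k < m) (p k - p k.+1) * S k.+1.
Proof.
move=> S0; elim: m => [|m IH]; first by rewrite !big_ord0 S0 mulr0 addr0.
by rewrite !big_ord_recr/= IH; ring.
Qed.

Lemma sum_ord_add (F : nat -> R) m n :
  \sum_(k < m + n) F k = \sum_(k < m) F k + \sum_(i < n) F (m + i)%N.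
Proof. by rewrite big_split_ord. Qed.

Lemma telescope_ord (p : nat -> R) n : \sum_(i < n) (p i - p i.+1) = p 0%N - p n.
Proof.
elim: n => [|n IH]; first by rewrite big_ord0 subrr.
by rewrite big_ord_recr/= IH; ring.
Qed.

(* Interlacing weights [p' i.+1 <= p i.+1 <= p' i] produce the same average of a
   slowly varying sequence. *)
Lemma abel_compare (n : nat) (p p' sg : nat -> R) (B D : R) : 0 <= D ->
  (forall i, p' i <= p i) -> (forall i, p i.+1 <= p' i) ->
  (forall i, 0 <= p' i <= 1) ->
  (forall i, (i <= n)%N -> `|sg i| <= B) ->
  (forall i, (i < n)%N -> `|sg i.+1 - sg i| <= D) ->
  `|\sum_(i < n.+1) (p i - p i.+1) * sg i - \sum_(i < n.+1) (p' i - p' i.+1) * sg i| <=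
   (p 0%N - p' 0%N) * B + (p n.+1 - p' n.+1) * B + D.
Proof.
move=> D0 pp' p'p p'01 sB sD.
pose d i := p i - p' i.
have d0 i : 0 <= d i by rewrite subr_ge0.
have -> : \sum_(i < n.+1) (p i - p i.+1) * sg i - \sum_(i < n.+1) (p' i - p' i.+1) * sg i =
   d 0%N * sg 0%N - d n.+1 * sg n + \sum_(i < n) d i.+1 * (sg i.+1 - sg i).
  rewrite -sumrB; elim: n {sB sD} => [|n IH].
    by rewrite !big_ord_recr !big_ord0/= /d; ring.
  by rewrite big_ord_recr/= IH [in RHS]big_ord_recr/= /d; ring.
apply: (le_trans (ler_normD _ _)); apply: lerD.
  apply: (le_trans (ler_normB _ _)).
  by apply: lerD; rewrite normrM ger0_norm ?d0// ler_wpM2l ?d0// sB.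
apply: (le_trans (ler_norm_sum _ _ _)).
apply: (@le_trans _ _ (\sum_(i < n) (p' i - p' i.+1) * D)).
  apply: ler_sum => i _; rewrite normrM ger0_norm ?d0// ler_pM ?sD//.
  by rewrite /d lerD2r.
rewrite -mulr_suml telescope_ord ler_piMl//.
have /andP[_ h1] := p'01 0%N; have /andP[h2 _] := p'01 n.
by rewrite lerBlDr (le_trans h1)// lerDl.
Qed.

Lemma sqrt_dist_le (x y m : R) : 0 < m -> m <= x -> m <= y ->
  `|Num.sqrt x - Num.sqrt y| <= `|x - y| / Num.sqrt m.
Proof.
move=> m0 mx my.
have x0 : 0 <= x by rewrite (le_trans (ltW m0)).
have y0 : 0 <= y by rewrite (le_trans (ltW m0)).
have sm : 0 < Num.sqrt m by rewrite sqrtr_gt0.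
have sx : Num.sqrt m <= Num.sqrt x by rewrite ler_wsqrtr.
have -> : x - y = (Num.sqrt x - Num.sqrt y) * (Num.sqrt x + Num.sqrt y).
  by rewrite -subr_sqr !sqr_sqrtr.
rewrite normrM ler_pdivlMr// ler_wpM2l// ger0_norm ?addr_ge0 ?sqrtr_ge0//.
by rewrite (le_trans sx)// lerDl sqrtr_ge0.
Qed.

End sine_kernel_bounds.

(** * Comparison of the two kernels at a fixed N *)

Section fixed_scale.
Context {R : realType}.
(** In the application s = tau N^alpha, b = N^(1/2 - alpha), and [n0], [J] are the integer parts of
    N and of Gamma N^alpha. *)
Variables (h : nat -> {poly R}) (Psi : R -> R) (N s c b M x y : R) (n0 J : nat).
Hypothesis hermite_h : orthonormal_hermite h.
Hypothesis Psi01 : forall x, 0 <= Psi x <= 1.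
Hypothesis Psi_nincr : forall x y, x <= y -> Psi y <= Psi x.
Hypotheses (s0 : 0 < s) (c0 : 0 < c) (N1 : 1 <= N) (b0 : 0 < b) (bN : b <= N).
Hypothesis n0N : n0%:R <= N < n0%:R + 1.
Hypothesis JN : 4 * (J%:R + 1) <= N.
Hypothesis tail_right : forall X : R, J%:R <= X -> Psi (X / s) <= c^-1 * ((N + X) ^+ 8)^-1.
Hypothesis tail_left : forall X : R, J%:R <= X -> 1 - Psi (- X / s) <= c^-1 * ((N + X) ^+ 8)^-1.
Hypotheses (M0 : 0 <= M) (xM : `|x| <= M) (yM : `|y| <= M).

Let a : R := pi * b / Num.sqrt 2.
Hypothesis aM : 2 * (a * M) ^+ 2 <= N.

Let p (k : nat) : R := Psi ((k%:R - N) / s).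
Let S (k : nat) : R := \sum_(j < k) psi h j (a * x) * psi h j (a * y).
Let term (k : nat) : R := p k * (psi h k (a * x) * psi h k (a * y)).
(** The indices from [m0] to [m1] (excluded) form the window around [n0]; its i-th element is
    matched with the index i - J of the kernel L, to which [sg i] and [p' i] belong. *)
Let m0 := (n0 - J)%N.
Let m1 := (m0 + (2 * J).+1)%N.
Let sg (i : nat) : R := sine_kernel (1 / 2 * b * Num.sqrt (N + (i%:R - J%:R))) x y.
Let p' (i : nat) : R := Psi ((i%:R - J%:R) / s).

Lemma a_bounds : 0 < a /\ a <= 3 * b.
Proof.
have p4 : pi <= 4 :> R by have := @pihalf_lt2 R; rewrite ltr_pdivrMr// => /ltW; rewrite -natrM.
have q0 : 0 < Num.sqrt 2 :> R by rewrite sqrtr_gt0.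
have q : 4 / 3 <= Num.sqrt 2 :> R.
  have : Num.sqrt 2 ^+ 2 = 2 :> R by rewrite sqr_sqrtr.
  by move: (Num.sqrt 2) q0 => r r0 r2; nra.
split; first by rewrite /a divr_gt0// mulr_gt0// pi_gt0.
rewrite /a ler_pdivrMr// -mulrA [b * _]mulrC mulrA ler_wpM2r//; first exact: ltW.
by move: (pi : R) p4 (Num.sqrt 2) q => *; nra.
Qed.

Lemma nat_window : (J <= n0)%N /\ N - J%:R - 1 < m0%:R <= N - J%:R.
Proof.
have /andP[h1 h2] := n0N; have J0 : 0 <= J%:R :> R by [].
have Jn : (J <= n0)%N.
  have := JN => JN'; have : J%:R <= n0%:R :> R by lra.
  by rewrite ler_nat.
by split=> //; rewrite /m0 natrB//; apply/andP; split; lra.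
Qed.

Lemma m1_ge : N + J%:R <= m1%:R.
Proof.
have [_ /andP[h1 h2]] := nat_window.
by rewrite /m1 natrD -addn1 natr_double_succ; lra.
Qed.

Lemma omega_le n : Num.sqrt (2 * n%:R + 1 : R) <= 2 * n%:R + 1.
Proof.
have o1 := @omega_ge1 R n; rewrite -[leRHS]omega_sqr expr2 ler_peMr//.
Qed.

Lemma christoffel_S_le k : `|S k| <= 2 * (2 * k%:R + 1).
Proof.
apply: (le_trans (ler_norm_sum _ _ _)); apply: (le_trans (christoffel_sum_le hermite_h _ _ _)).
by rewrite ler_pM2l// omega_le.
Qed.

Lemma psi_psi_le_all k u v : `|psi h k u * psi h k v| <= 2 * (2 * k%:R + 3).
Proof.
have := christoffel_sum_le hermite_h k.+1 u v; rewrite big_ord_recr/= => h1.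
apply: (@le_trans _ _ (2 * Num.sqrt (2 * k.+1%:R + 1))).
  by apply: le_trans h1; rewrite lerDr sumr_ge0.
have := omega_le k.+1; rewrite -[k.+1%:R]natr1 => h2; rewrite ler_pM2l//.
by apply: (le_trans h2); lra.
Qed.

Lemma sqrt_quarter (z : R) : 0 <= z -> Num.sqrt (z / 4) = Num.sqrt z / 2.
Proof.
move=> z0; rewrite sqrtrM//; congr (_ * _); rewrite sqrtrV//; congr (_^-1).
have -> : 4 = 2 ^+ 2 :> R by rewrite -natrX.
by rewrite sqrtr_sqr ger0_norm.
Qed.

Lemma N_gt0 : 0 < N. Proof. exact: lt_le_trans N1. Qed.

Lemma p_tail k : N + J%:R <= k%:R -> p k <= c^-1 * (k%:R ^+ 8)^-1.
Proof.
move=> hk; have := @tail_right (k%:R - N); rewrite [N + _]addrC subrK; apply; lra.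
Qed.

Lemma inv_pow8_le (X : R) : N <= X -> X * X * (X ^+ 8)^-1 <= N^-1 * (X ^+ 2)^-1.
Proof.
move=> NX; have X0 : 0 < X := lt_le_trans N_gt0 NX.
have X1 : 1 <= X := le_trans N1 NX.
have -> : X * X * (X ^+ 8)^-1 = (X ^+ 4)^-1 * (X ^+ 2)^-1 by field; rewrite gt_eqF.
rewrite ler_wpM2r ?invr_ge0 ?exprn_ge0 ?(ltW X0)// lef_pV2 ?posrE ?exprn_gt0 ?N_gt0//.
by apply: (le_trans NX); rewrite ler_eXnr.
Qed.

(** The scale [a] and the product of Hermite functions are both O(k) and the weight is O(k^-8). What
    remains, k^-6, is at most 1 / (N k^2), and k^-2 <= 2 / (k (k + 1)) telescopes. *)
Lemma term_tail k : (m1 <= k)%N ->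
  `|a * term k| <= 60 / c / N * (k%:R^-1 - k.+1%:R^-1).
Proof.
move=> mk; have [a0 ab] := a_bounds; have Np := N_gt0; have := bN => bN'.
have kN : N + J%:R <= k%:R by apply: (le_trans m1_ge); rewrite ler_nat.
have J0 : 0 <= J%:R :> R by [].
have Nk : N <= k%:R by lra.
have k1 : 1 <= k%:R :> R by exact: le_trans Nk.
have k0 : 0 < k%:R :> R by exact: lt_le_trans k1.
have pk := p_tail kN; have p0 : 0 <= p k by have /andP[] := Psi01 ((k%:R - N) / s).
have h1 : `|a * term k| <= 30 / c * (k%:R * k%:R * (k%:R ^+ 8)^-1).
  rewrite /term normrM (gtr0_norm a0) normrM (ger0_norm p0).
  apply: (@le_trans _ _ (3 * k%:R * (c^-1 * (k%:R ^+ 8)^-1 * (10 * k%:R)))).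
    apply: ler_pM => //; [exact: ltW|by rewrite mulr_ge0|by lra|].
    apply: ler_pM => //; apply: (le_trans (psi_psi_le_all _ _ _)); lra.
  by rewrite le_eqVlt; apply/orP; left; apply/eqP; ring.
apply: (le_trans h1); apply: (@le_trans _ _ (30 / c * (N^-1 * (k%:R ^+ 2)^-1))).
  by rewrite ler_wpM2l ?inv_pow8_le// divr_ge0// ltW.
rewrite -[k.+1%:R]natr1.
have -> : k%:R^-1 - (k%:R + 1)^-1 = (k%:R * (k%:R + 1))^-1 :> R.
  by field; rewrite !gt_eqF// ltr_wpDl.
have -> : 60 / c / N * (k%:R * (k%:R + 1))^-1 = 30 / c * (N^-1 * (2 * (k%:R * (k%:R + 1))^-1)).
  by ring.
rewrite ler_wpM2l ?divr_ge0 ?(ltW c0)// ler_wpM2l ?invr_ge0 ?(ltW Np)//.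
rewrite ler_pdivlMr ?mulr_gt0 ?ltr_wpDl// mulrC ler_pdivrMr ?exprn_gt0//.
by rewrite expr2; nra.
Qed.

Lemma term_tail_sum n : \sum_(i < n) `|a * term (m1 + i)| <= 60 / c / N.
Proof.
have Np := N_gt0.
apply: (@le_trans _ _ (\sum_(i < n) (60 / c / N * ((m1 + i)%:R^-1 - (m1 + i).+1%:R^-1)))).
  by apply: ler_sum => i _; apply: term_tail; rewrite leq_addr.
rewrite -mulr_sumr; have := telescope_ord (fun i => (m1 + i)%:R^-1 : R) n.
under eq_bigr do rewrite addnS; move=> ->.
have C0 : 0 <= 60 / c / N by rewrite !divr_ge0// ltW.
rewrite addn0 ler_piMr// lerBlDr; apply: (@le_trans _ _ 1); last by rewrite lerDl invr_ge0.
have m1N : N <= m1%:R by apply: (le_trans _ m1_ge); rewrite lerDl.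
by rewrite invf_le1 ?(lt_le_trans Np)// (le_trans N1).
Qed.

Lemma pp_shift i : p (m0 + i)%N = Psi ((i%:R - J%:R - (N - n0%:R)) / s).
Proof.
have [Jn _] := nat_window; congr (Psi (_ / s)).
by rewrite natrD /m0 natrB//; ring.
Qed.

(** Rescaling S_n gives the frequency (b/2) sqrt(n + 1/2), while [sg i] has (b/2) sqrt(N + i - J).
    For n = m0 + i + 1 the radicands differ by at most 3/2 and are at least N/4, whence the term 3 b
    / sqrt N. *)
Lemma christoffel_window i : (i <= 2 * J)%N ->
  `|a * S (m0 + i).+1 - sg i| <= (a * (12 * (a * M) ^+ 2 + 4 * (a * M) + 5) + 3 * b) / Num.sqrt N.
Proof.
move=> iJ; have [a0 ab] := a_bounds; have Np := N_gt0.
have [Jn /andP[m0l m0u]] := nat_window; have /andP[n0l n0u] := n0N.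
have J0 : 0 <= J%:R :> R by [].
have i0 : 0 <= i%:R :> R by [].
have iJR : i%:R <= 2 * J%:R :> R by rewrite -natrM ler_nat.
set n := (m0 + i).+1.
have nR : n%:R = m0%:R + i%:R + 1 :> R by rewrite /n -addn1 !natrD.
have sN0 : 0 < Num.sqrt N by rewrite sqrtr_gt0.
have := JN => JN'.
have oN : N <= 2 * n%:R + 1 by rewrite nR; lra.
have so : Num.sqrt N <= Num.sqrt (2 * n%:R + 1) by rewrite ler_wsqrtr.
have o0 : 0 < Num.sqrt (2 * n%:R + 1 : R) := lt_le_trans sN0 so.
have aM0 : 0 <= a * M by rewrite mulr_ge0// ltW.
have ax : `|a * x| <= a * M by rewrite normrM (gtr0_norm a0) ler_pM2l.
have ay : `|a * y| <= a * M by rewrite normrM (gtr0_norm a0) ler_pM2l.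
have hX : 2 * (a * M) ^+ 2 <= Num.sqrt (2 * n%:R + 1) ^+ 2 by rewrite omega_sqr (le_trans aM).
have h1 := christoffel_sum_approx hermite_h ax ay hX.
rewrite -/(S n) in h1.
have h2 : `|a * S n - sine_kernel (a * (Num.sqrt (2 * n%:R + 1) / (2 * pi))) x y| <=
    a * (12 * (a * M) ^+ 2 + 4 * (a * M) + 5) / Num.sqrt N.
  rewrite -sine_kernel_scale ?gt_eqF// -mulrBr normrM (gtr0_norm a0) -mulrA ler_pM2l//.
  apply: (le_trans h1); rewrite ler_wpM2l ?lef_pV2 ?posrE//.
  by have := sqr_ge0 (a * M); move: ((a * M) ^+ 2) (a * M) aM0 => *; lra.
have h3 : a * (Num.sqrt (2 * n%:R + 1) / (2 * pi)) = 1 / 2 * b * Num.sqrt (n%:R + 1 / 2).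
  have p0 : pi != 0 :> R by rewrite gt_eqF// pi_gt0.
  have q0 : Num.sqrt 2 != 0 :> R by rewrite gt_eqF// sqrtr_gt0.
  have -> : 2 * n%:R + 1 = 2 * (n%:R + 1 / 2) :> R by field.
  rewrite sqrtrM// /a; move: (pi : R) p0 (Num.sqrt 2) q0 => pp p0 qq q0.
  by field; rewrite p0 q0.
have h4 : `|sine_kernel (1 / 2 * b * Num.sqrt (n%:R + 1 / 2)) x y - sg i| <= 3 * b / Num.sqrt N.
  apply: (le_trans (sine_kernel_lipschitz _ _ _ _)).
  rewrite -mulrBr normrM ger0_norm; last by rewrite mulr_ge0// ltW.
  have N4 : 0 < N / 4 by rewrite divr_gt0.
  have l1 : N / 4 <= n%:R + 1 / 2 by rewrite nR; lra.
  have l2 : N / 4 <= N + (i%:R - J%:R) by lra.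
  have := sqrt_dist_le N4 l1 l2.
  have -> : Num.sqrt (N / 4) = Num.sqrt N / 2 by exact: sqrt_quarter (ltW Np).
  have l3 : `|n%:R + 1 / 2 - (N + (i%:R - J%:R))| <= 3 / 2.
    rewrite nR /m0 natrB// ler_norml; apply/andP; split; lra.
  move=> l4; have l5 : `|Num.sqrt (n%:R + 1 / 2) - Num.sqrt (N + (i%:R - J%:R))| <= 3 / Num.sqrt N.
    apply: (le_trans l4); rewrite invf_div mulrA ler_wpM2r ?invr_ge0 ?(ltW sN0)//.
    by move: l3; move: `|_ - _| => z; lra.
  have -> : 3 * b / Num.sqrt N = 2 * (1 / 2 * b * (3 / Num.sqrt N)) by field; rewrite gt_eqF.
  by rewrite ler_pM2l// ler_pM2l// mulr_gt0.
rewrite mulrDl (_ : a * S n - sg i = (a * S n - sine_kernel (a * (Num.sqrt (2 * n%:R + 1) / (2 * pi))) x y) +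
  (sine_kernel (1 / 2 * b * Num.sqrt (n%:R + 1 / 2)) x y - sg i)); last by rewrite h3; ring.
by apply: (le_trans (ler_normD _ _)); apply: lerD.
Qed.

Lemma kernel_close_fixed_scale n :
  `|a * \sum_(k < m1 + n) term k - \sum_(i < (2 * J).+1) (p' i - p' i.+1) * sg i| <=
  112 / c / N + (a * (12 * (a * M) ^+ 2 + 4 * (a * M) + 5) + 5 * b) / Num.sqrt N.
Proof.
have [a0 ab] := a_bounds; have Np := N_gt0.
have [Jn /andP[m0l m0u]] := nat_window; have /andP[n0l n0u] := n0N.
have J0 : 0 <= J%:R :> R by [].
have sN0 : 0 < Num.sqrt N by rewrite sqrtr_gt0.
have ci : 0 < c^-1 by rewrite invr_gt0.
have pni i j : (i <= j)%N -> p j <= p i.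
  by move=> ij; apply: Psi_nincr; rewrite ler_wpM2r ?invr_ge0 ?(ltW s0)// lerD2r ler_nat.
have p01 i : 0 <= p i <= 1 by exact: Psi01.
have N8 (X : R) : N <= X -> c^-1 * (X ^+ 8)^-1 <= c^-1 * (N ^+ 8)^-1.
  move=> NX; rewrite ler_wpM2l ?(ltW ci)// lef_pV2 ?posrE ?exprn_gt0 ?(lt_le_trans Np)//.
  by rewrite lerXn2r ?nnegrE ?(ltW Np) ?(le_trans (ltW Np)).
have N6 : N * N * (c^-1 * (N ^+ 8)^-1) <= c^-1 / N.
  rewrite mulrCA ler_wpM2l ?(ltW ci)//; apply: (le_trans (inv_pow8_le (lexx N))).
  by rewrite ler_piMr ?invr_ge0 ?(ltW Np)// invf_le1 ?exprn_gt0// exprn_ege1.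
have m1N := m1_ge; have := JN => JN'; have := N1 => N1'; have := bN => bN'.
have pm1 : p m1 <= c^-1 * (N ^+ 8)^-1.
  apply: (le_trans (p_tail m1N)); apply: N8; lra.
rewrite sum_ord_add mulrDr.
have -> : \sum_(k < m1) term k = p m1 * S m1 + \sum_(k < m1) (p k - p k.+1) * S k.+1.
  rewrite -abel_sum ?/S ?big_ord0//; apply: eq_bigr => k _.
  by rewrite /term big_ord_recr/= addrAC subrr add0r.
have -> : \sum_(k < m1) (p k - p k.+1) * S k.+1 = \sum_(k < m0) (p k - p k.+1) * S k.+1 +
    \sum_(i < (2 * J).+1) (p (m0 + i)%N - p (m0 + i).+1) * S (m0 + i).+1.
  by rewrite /m1 (sum_ord_add (fun k => (p k - p k.+1) * S k.+1)).
rewrite (mulrDr a (p m1 * S m1)) (mulrDr a (\sum_(k < m0) _)).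
(* [A1] is the boundary term of Abel summation, [A2] the part below the window, [A3] the window,
   [A4] the tail of the series; [T'] mixes the weights of K with the frequencies of L. The constant
   is 112 = 30 + 18 + 60 + 4. *)
set A1 := a * (p m1 * S m1).
set A2 := a * \sum_(k < m0) _.
set A3 := a * \sum_(i < (2 * J).+1) _.
set A4 := a * \sum_(i < n) _.
set T := \sum_(i < (2 * J).+1) (p' i - _) * _.
pose T' := \sum_(i < (2 * J).+1) (p (m0 + i)%N - p (m0 + i.+1)%N) * sg i.
have m1R : m1%:R <= 2 * N by rewrite /m1 natrD -addn1 natr_double_succ; lra.
have b1 : `|A1| <= 30 / c / N.
  rewrite /A1 normrM (gtr0_norm a0) normrM; have /andP[pm0 _] := p01 m1; rewrite (ger0_norm pm0).
  apply: (@le_trans _ _ (3 * N * (c^-1 * (N ^+ 8)^-1 * (10 * N)))).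
    apply: ler_pM => //; [exact: ltW|by rewrite mulr_ge0|by lra|].
    by apply: ler_pM => //; apply: (le_trans (christoffel_S_le _)); lra.
  rewrite (_ : _ * _ = 30 * (N * N * (c^-1 * (N ^+ 8)^-1))); last by ring.
  rewrite (_ : 30 / c / N = 30 * (c^-1 / N)); last by ring.
  by rewrite ler_pM2l.
have b2 : `|A2| <= 18 / c / N.
  have tl : 1 - p m0 <= c^-1 * (N ^+ 8)^-1.
    have hX : J%:R <= N - m0%:R by lra.
    have := tail_left hX; rewrite opprB => h1; apply: (le_trans h1); apply: N8; lra.
  rewrite /A2 normrM (gtr0_norm a0).
  apply: (@le_trans _ _ (3 * N * (6 * N * (c^-1 * (N ^+ 8)^-1)))).
    apply: ler_pM => //; [exact: ltW|lra|].
    apply: (le_trans (ler_norm_sum _ _ _)).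
    apply: (@le_trans _ _ (\sum_(k < m0) (p k - p k.+1) * (6 * N))).
      apply: ler_sum => k _; have pk0 : 0 <= p k - p k.+1 by rewrite subr_ge0 pni.
      rewrite normrM (ger0_norm pk0) ler_wpM2l//.
      apply: (le_trans (christoffel_S_le _)).
      have : k.+1%:R <= m0%:R :> R by rewrite ler_nat.
      by move=> h1; lra.
    rewrite -mulr_suml telescope_ord mulrC ler_wpM2l ?mulr_ge0 ?(ltW Np)//.
    by apply: le_trans tl; rewrite lerD2r; have /andP[] := p01 0%N.
  rewrite (_ : _ * _ = 18 * (N * N * (c^-1 * (N ^+ 8)^-1))); last by ring.
  rewrite (_ : 18 / c / N = 18 * (c^-1 / N)); last by ring.
  by rewrite ler_pM2l.
have b3 : `|A3 - T'| <= (a * (12 * (a * M) ^+ 2 + 4 * (a * M) + 5) + 3 * b) / Num.sqrt N.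
  set e1 := (X in _ <= X).
  have e10 : 0 <= e1 by apply: (le_trans (normr_ge0 _) (@christoffel_window 0%N _)).
  rewrite /A3 /T' mulr_sumr -sumrB.
  apply: (le_trans (ler_norm_sum _ _ _)).
  apply: (@le_trans _ _ (\sum_(i < (2 * J).+1) (p (m0 + i)%N - p (m0 + i.+1)%N) * e1)).
    apply: ler_sum => i _; rewrite addnS.
    have pk0 : 0 <= p (m0 + i)%N - p (m0 + i).+1 by rewrite subr_ge0 pni.
    rewrite mulrCA -mulrBr normrM (ger0_norm pk0) ler_wpM2l//.
    by apply: christoffel_window; rewrite -ltnS.
  rewrite -mulr_suml (telescope_ord (fun i => p (m0 + i)%N)) ler_piMl//.
  have /andP[_ h1] := p01 (m0 + 0)%N; have /andP[h2 _] := p01 (m0 + (2 * J).+1)%N.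
  by move: (p _) (p _) h1 h2 => *; lra.
have b4 : `|A4| <= 60 / c / N.
  rewrite /A4 mulr_sumr; apply: (le_trans (ler_norm_sum _ _ _)); exact: term_tail_sum.
(* The sequences [p] and [p'] differ by a shift of the fractional part of N, hence interlace. The
   crude bound 2 N^2 on [sg] is harmless, as it only multiplies end gaps of size N^-8. *)
have b5 : `|T' - T| <= 4 / c / N + 2 * b / Num.sqrt N.
  have iJR i : (i <= 2 * J)%N -> i%:R <= 2 * J%:R :> R by move=> iJ; rewrite -natrM ler_nat.
  have q1 i : p' i <= p (m0 + i)%N.
    rewrite pp_shift; apply: Psi_nincr; rewrite ler_wpM2r ?invr_ge0 ?(ltW s0)//.
    by rewrite lerBlDr lerDl subr_ge0.
  have q2 i : p (m0 + i.+1)%N <= p' i.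
    rewrite pp_shift; apply: Psi_nincr; rewrite ler_wpM2r ?invr_ge0 ?(ltW s0)//.
    by rewrite -[i.+1%:R]natr1; lra.
  have q3 i : 0 <= p' i <= 1 by exact: Psi01.
  have q4 i : (i <= 2 * J)%N -> `|sg i| <= 2 * (N * N).
    move=> /iJR iJ; have i0 : 0 <= i%:R :> R by [].
    have := sine_kernel_lipschitz (1 / 2 * b * Num.sqrt (N + (i%:R - J%:R))) 0 x y.
    rewrite sine_kernel0 !subr0 => h1; apply: (le_trans h1).
    rewrite ger0_norm; last by rewrite !mulr_ge0 ?sqrtr_ge0// ltW.
    have h2 : Num.sqrt (N + (i%:R - J%:R)) <= 2 * N.
      apply: (@le_trans _ _ (Num.sqrt (2 * N))); first by rewrite ler_wsqrtr//; lra.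
      rewrite -[leRHS]ger0_norm -?sqrtr_sqr; last by rewrite mulr_ge0// ltW.
      by rewrite ler_wsqrtr// ler_eXnr//; lra.
    have -> : 2 * (1 / 2 * b * Num.sqrt (N + (i%:R - J%:R))) = b * Num.sqrt (N + (i%:R - J%:R)) by field.
    by rewrite mulrCA ler_pM ?sqrtr_ge0// ltW.
  have q5 i : (i < 2 * J)%N -> `|sg i.+1 - sg i| <= 2 * b / Num.sqrt N.
    move=> iJ; have := iJR _ (ltnW iJ); have := iJR _ iJ => j1 j2.
    have i0 : 0 <= i%:R :> R by [].
    apply: (le_trans (sine_kernel_lipschitz _ _ _ _)).
    rewrite -mulrBr normrM ger0_norm; last by rewrite mulr_ge0// ltW.
    have N4 : 0 < N / 4 by rewrite divr_gt0.
    have l1 : N / 4 <= N + (i.+1%:R - J%:R) by rewrite -[i.+1%:R]natr1; lra.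
    have l2 : N / 4 <= N + (i%:R - J%:R) by lra.
    have := sqrt_dist_le N4 l1 l2.
    have -> : Num.sqrt (N / 4) = Num.sqrt N / 2 by exact: sqrt_quarter (ltW Np).
    have -> : N + (i.+1%:R - J%:R) - (N + (i%:R - J%:R)) = 1 by rewrite -[i.+1%:R]natr1; ring.
    rewrite normr1 invf_div mul1r => l4.
    have -> : 2 * b / Num.sqrt N = 2 * (1 / 2 * b * (2 / Num.sqrt N)) by field; rewrite gt_eqF.
    by rewrite ler_pM2l// ler_pM2l// mulr_gt0.
  have D0 : 0 <= 2 * b / Num.sqrt N by rewrite divr_ge0 ?mulr_ge0 ?(ltW b0) ?(ltW sN0).
  apply: (le_trans (@abel_compare _ (2 * J) (fun i => p (m0 + i)%N) p' sg _ _ D0 q1 q2 q3 q4 q5)).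
  rewrite lerD2r addn0.
  have g1 : p m0 - p' 0%N <= c^-1 * (N ^+ 8)^-1.
    have e0 : p' 0%N = Psi (- J%:R / s) by rewrite /p' sub0r.
    have := tail_left (lexx J%:R); rewrite -e0 => h1.
    have /andP[_ h2] := p01 m0.
    apply: (@le_trans _ _ (1 - p' 0%N)); first by rewrite lerD2r.
    by apply: (le_trans h1); apply: N8; lra.
  have g2 : p (m0 + (2 * J).+1)%N - p' (2 * J).+1 <= c^-1 * (N ^+ 8)^-1.
    by apply: le_trans pm1; rewrite lerBlDr lerDl; have /andP[] := q3 (2 * J).+1.
  have NN : 0 <= 2 * (N * N) by rewrite !mulr_ge0// ltW.
  have := lerD (ler_wpM2r NN g1) (ler_wpM2r NN g2) => g3; apply: (le_trans g3).
  rewrite (_ : _ + _ = 4 * (N * N * (c^-1 * (N ^+ 8)^-1))); last by ring.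
  rewrite (_ : 4 / c / N = 4 * (c^-1 / N)); last by ring.
  by rewrite ler_pM2l.
rewrite (_ : _ - T = A1 + A2 + (A3 - T') + A4 + (T' - T)); last by ring.
apply: (le_trans (ler_normD _ _)); apply: (le_trans (lerD (ler_normD _ _) (lexx _))).
apply: (le_trans (lerD (lerD (ler_normD _ _) (lexx _)) (lexx _))).
apply: (le_trans (lerD (lerD (lerD (ler_normD _ _) (lexx _)) (lexx _)) (lexx _))).
apply: (le_trans (lerD (lerD (lerD (lerD b1 b2) b3) b4) b5)).
rewrite (_ : 112 / c / N = 112 * (c^-1 / N)); last by ring.
rewrite (_ : 60 / c / N = 60 * (c^-1 / N)); last by ring.
rewrite (_ : 30 / c / N = 30 * (c^-1 / N)); last by ring.
rewrite (_ : 18 / c / N = 18 * (c^-1 / N)); last by ring.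
rewrite (_ : 4 / c / N = 4 * (c^-1 / N)); last by ring.
set Q := 12 * (a * M) ^+ 2 + 4 * (a * M) + 5; move: (c^-1 / N) => z1.
rewrite (_ : (a * Q + 3 * b) / Num.sqrt N = a * Q / Num.sqrt N + 3 * (b / Num.sqrt N)); last by ring.
rewrite (_ : (a * Q + 5 * b) / Num.sqrt N = a * Q / Num.sqrt N + 5 * (b / Num.sqrt N)); last by ring.
rewrite (_ : 2 * b / Num.sqrt N = 2 * (b / Num.sqrt N)); last by ring.
by move: (a * Q / Num.sqrt N) (b / Num.sqrt N) => z2 z3; lra.
Qed.

End fixed_scale.

(** * Large parameter asymptotics *)

Section asymptotics.
Context {R : realType}.

Lemma near_pinfty_powR_ge (C r : R) : 0 < r -> \forall N \near +oo%R, C <= N `^ r.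
Proof.
move=> r0; have C1 : 0 <= Num.max C 0 by rewrite le_max lexx orbT.
apply: filterS (nbhs_pinfty_ge (num_real ((Num.max C 0) `^ r^-1))) => N hN.
apply: (@le_trans _ _ (Num.max C 0)); first by rewrite le_max lexx.
have -> : Num.max C 0 = (Num.max C 0 `^ r^-1) `^ r.
  by rewrite -powRrM mulVf ?gt_eqF// powRr1.
apply: ge0_ler_powR; rewrite ?nnegrE ?powR_ge0 ?(ltW r0)//.
exact: le_trans (powR_ge0 _ _) hN.
Qed.

Lemma near_pinfty_ln_ge (C : R) : \forall N \near +oo%R, C <= ln N.
Proof.
apply: filterS (nbhs_pinfty_ge (num_real (expR C))) => N hN.
by rewrite -[leLHS]expRK ler_ln ?posrE ?expR_gt0// (lt_le_trans (expR_gt0 C)).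
Qed.

Lemma ln_le_powR (x r : R) : 0 < x -> 0 < r -> ln x <= r^-1 * x `^ r.
Proof.
move=> x0 r0; rewrite -(ler_pM2l r0) mulrA divff ?gt_eqF// mul1r -ln_powR.
have p0 : 0 < x `^ r by rewrite powR_gt0.
have := @le_ln1Dx R (x `^ r - 1); rewrite [1 + _]addrC subrK => h.
apply: (le_trans (h _)); last by rewrite gerDl oppr_le0.
by rewrite ltrBrDl subrr.
Qed.

Lemma powR_mulD (x r t : R) : 0 < x -> x `^ (r + t) = x `^ r * x `^ t.
Proof. by move=> x0; apply: powRD; apply/implyP => _; rewrite gt_eqF. Qed.

Lemma log_sqr_powR_small (alpha : R) : alpha < 1 ->
  \forall N \near +oo%R, 8 * (ln N ^+ 2 * N `^ alpha) <= N.
Proof.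
(* Two factors N^q absorb the two logarithms, the third one the constants. *)
move=> a1; pose q := (1 - alpha) / 3.
have q0 : 0 < q by rewrite divr_gt0// subr_gt0.
have h2 := @near_pinfty_powR_ge (8 * (q^-1) ^+ 2) q q0.
have N1 := nbhs_pinfty_ge (num_real (1 : R)).
apply: filterS2 N1 h2 => N N1 h2.
have N0 : 0 < N := lt_le_trans ltr01 N1.
have l0 : 0 <= ln N by rewrite ln_ge0.
have h1 : ln N ^+ 2 <= (q^-1) ^+ 2 * (N `^ q * N `^ q).
  rewrite -[N `^ q * _]expr2 -exprMn lerXn2r ?nnegrE ?mulr_ge0 ?invr_ge0 ?powR_ge0 ?(ltW q0)//.
  exact: ln_le_powR.
have e : N = N `^ q * (N `^ q * N `^ q) * N `^ alpha.
  rewrite -!powR_mulD// (_ : _ + _ = 1) ?powRr1 ?(ltW N0)//.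
  by rewrite /q; field.
rewrite [leRHS]e mulrA ler_wpM2r ?powR_ge0//.
apply: (@le_trans _ _ (8 * ((q^-1) ^+ 2 * (N `^ q * N `^ q)))); first by rewrite ler_pM2l.
by rewrite mulrA ler_wpM2r// mulr_ge0// powR_ge0.
Qed.

(* The choice [Gamma = (log N)^2] makes the exponential tails of the shape beat
   every power of [N + X]. *)
Lemma exp_tail_le_pow8 (alpha tau c : R) : 0 < alpha -> alpha < 1 -> 0 < tau -> 0 < c ->
  \forall N \near +oo%R, forall X : R, ln N ^+ 2 * N `^ alpha - 1 <= X -> 0 <= X ->
    expR (- (c * (X / (tau * N `^ alpha)))) <= ((N + X) ^+ 8)^-1.
Proof.
(* Since ln(N + X) <= ln N + X / N, it suffices that 8 ln N and 8 X / N are each at most half of c X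
   / (tau N^alpha); hence 16. *)
move=> a0 a1 t0 c0; pose k := 16 * tau / c.
have k0 : 0 < k by rewrite divr_gt0// mulr_gt0.
have ck : c * k = 16 * tau by rewrite /k; field; rewrite gt_eqF.
have h1 := near_pinfty_ln_ge (k + 1).
have b0 : 0 < 1 - alpha by rewrite subr_gt0.
have h2 := @near_pinfty_powR_ge k (1 - alpha) b0.
have h3 := nbhs_pinfty_ge (num_real (1 : R)).
apply: filterS3 h1 h2 h3 => N h1 h2 N1 X JX X0.
have N0 : 0 < N := lt_le_trans ltr01 N1.
have Nn0 : N != 0 by rewrite gt_eqF.
have tn0 : tau != 0 by rewrite gt_eqF.
have Y1 : 1 <= N `^ alpha by rewrite -[leLHS](powRr0 N) ler_powR// ltW.
have eN : N `^ (1 - alpha) * N `^ alpha = N by rewrite -powR_mulD// subrK powRr1// ltW.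
have NX0 : 0 < N + X by rewrite ltr_wpDr.
have -> : ((N + X) ^+ 8)^-1 = expR (- (8 * ln (N + X))).
  by rewrite expRN mulr_natl -lnXn// lnK// posrE exprn_gt0.
rewrite ler_expR lerN2.
have l1 : ln (N + X) <= ln N + X / N.
  have -> : N + X = N * (1 + X / N) by field.
  have q : 0 <= X / N by rewrite divr_ge0// ltW.
  have p : 0 < 1 + X / N by rewrite ltr_wpDr.
  by rewrite lnM ?posrE// lerD2l le_ln1Dx// (lt_le_trans (ltrN10 _)).
move: (N `^ alpha) (N `^ (1 - alpha)) h2 Y1 JX eN => Y Z h2 Y1 JX eN.
have Y0 : 0 < Y := lt_le_trans ltr01 Y1.
have Yn0 : Y != 0 by rewrite gt_eqF.
have l2 : 16 * tau * (X / N) <= c * (X / Y).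
  rewrite -ck -mulrA ler_pM2l// [k * _]mulrCA ler_wpM2l// ler_pdivrMr//.
  by rewrite [Y^-1 * _]mulrC -eN mulfK.
have l3 : 16 * tau * ln N <= c * (X / Y).
  rewrite -ck -mulrA ler_pM2l// ler_pdivlMr//.
  apply: le_trans JX; rewrite lerBrDr.
  have := ln_ge0 N1; move: (ln N) h1 => l h1 l0.
  have := k0 => k0'.
  have p1 : 0 <= (l - k - 1) * (l * Y) by rewrite !mulr_ge0 ?(ltW Y0)// ; lra.
  have p2 : 1 <= l * Y by rewrite mulr_ege1//; lra.
  by nra.
have -> : c * (X / (tau * Y)) = c * (X / Y) / tau by field; rewrite tn0 Yn0.
rewrite ler_pdivlMr//; move: (ln (N + X)) (ln N) (X / N) (c * (X / Y)) l1 l2 l3 => u v w z l1 l2 l3.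
have := ler_wpM2l (ltW t0) l1; nra.
Qed.

End asymptotics.

Lemma sqrt_mul_powRN {R : realType} (N alpha : R) : 0 < N ->
  Num.sqrt N * N `^ (- alpha) = N `^ (1 / 2 - alpha).
Proof. by move=> N0; rewrite -(powR12_sqrt (ltW N0)) -powR_mulD// div1r. Qed.

Lemma int_window_bij (J : nat) :
  set_bij `I_(2 * J).+1 [set k : int | `|k| <= J%:Z] (fun i => i%:Z - J%:Z).
Proof.
split.
- by move=> i /= iJ; rewrite ler_norml; lia.
- by move=> i j _ _ /addIr [].
- by move=> k /= kJ; exists (absz (k + J%:Z)) => /=; lia.
Qed.

(** * Both kernels in the notation of the fixed scale *)

Section kernels_at_large_scale.
Context {R : realType}.
Variables (h : nat -> {poly R}) (Psi : R -> R) (tau alpha N c : R) (n0 J : nat).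
Let s := tau * N `^ alpha.
Let b := N `^ (1 / 2 - alpha).
Let a := pi * b / Num.sqrt 2.
Hypothesis hermite_h : orthonormal_hermite h.
Hypothesis Psi01 : forall x, 0 <= Psi x <= 1.
Hypothesis Psi_nincr : forall x y, x <= y -> Psi y <= Psi x.
Hypotheses (s0 : 0 < s) (c0 : 0 < c) (N1 : 1 <= N) (bN : b <= N).
Hypothesis n0N : n0%:R <= N < n0%:R + 1.
Hypothesis JN : 4 * (J%:R + 1) <= N.
Hypothesis tail_right : forall X : R, J%:R <= X -> Psi (X / s) <= c^-1 * ((N + X) ^+ 8)^-1.
Hypothesis tail_left : forall X : R, J%:R <= X -> 1 - Psi (- X / s) <= c^-1 * ((N + X) ^+ 8)^-1.

Let term (x y : R) (k : nat) : R :=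
  Psi ((k%:R - N) / s) * (psi h k (a * x) * psi h k (a * y)).
Let weight (i : nat) : R := Psi ((i%:R - J%:R) / s).
Let sine_sum (x y : R) : R := \sum_(i < (2 * J).+1) (weight i - weight i.+1) *
  sine_kernel (1 / 2 * b * Num.sqrt (N + (i%:R - J%:R))) x y.

Lemma scale_gt0 : 0 < N. Proof. exact: lt_le_trans N1. Qed.

Lemma b_gt0 : 0 < b. Proof. by rewrite powR_gt0// scale_gt0. Qed.

Lemma is_cvg_series_term x y : cvgn (series (term x y)).
Proof.
have [a0 _] := a_bounds b_gt0.
set m1 := ((n0 - J) + (2 * J).+1)%N.
have nd : {homo [normed series (term x y)] : n m / (n <= m)%N >-> n <= m}.
  by apply: nondecreasing_series => *; exact: normr_ge0.
apply: normed_cvg; apply: nondecreasing_is_cvgn => //.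
exists (\sum_(k < m1) `|term x y k| + 60 / c / N / a) => _ [n _ <-].
apply: le_trans (nd _ _ (leq_addl m1 n)) _; rewrite /normed_series_of seriesEord/=.
rewrite (sum_ord_add (fun k => `|term x y k|)) lerD2l ler_pdivlMr// mulr_suml.
have := @term_tail_sum R h Psi N s c b x y n0 J hermite_h Psi01 c0 N1 b_gt0 bN n0N JN tail_right n.
apply: le_trans; apply: ler_sum => i _.
by rewrite [leRHS]normrM (gtr0_norm a0) mulrC.
Qed.

(** The two scales combine into c_N N^(-alpha) = a; convergence of the series allows c_N to be taken
    out of the limit. *)
Lemma rescaled_gue_kernelE x y :
  rescaled_gue_kernel h Psi tau alpha N x y = a * limn (series (term x y)).
Proof.
have N0 := scale_gt0.
have cN0 : 0 < cN N by rewrite divr_gt0 ?mulr_gt0 ?pi_gt0 ?sqrtr_gt0.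
have aE : cN N * N `^ (- alpha) = a.
  by rewrite /a /b -sqrt_mul_powRN// /cN; ring.
rewrite /rescaled_gue_kernel /gue_kernel.
have -> : (fun k : nat => Psi ((k%:R - N) / (tau * N `^ alpha)) *
    phi h N k (x * N `^ (- alpha)) * phi h N k (y * N `^ (- alpha))) = cN N *: term x y.
  apply/funext => k; rewrite fctE /term -/s.
  have p z : phi h N k (z * N `^ (- alpha)) = Num.sqrt (cN N) * psi h k (a * z).
    by rewrite /phi /psi [z * _]mulrC mulrA aE !mulrA.
  rewrite !p -[cN N in RHS](sqr_sqrtr (ltW cN0)).
  move: (psi _ _ _) (psi _ _ _) (Num.sqrt _) => u v w; rewrite /GRing.scale/=; ring.
rewrite lim_seriesZ; last exact: is_cvg_series_term.
by rewrite -aE /GRing.scale/=; ring.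
Qed.

Lemma rescaled_gue_kernel_close M x y : 0 <= M -> `|x| <= M -> `|y| <= M ->
  2 * (a * M) ^+ 2 <= N ->
  `|rescaled_gue_kernel h Psi tau alpha N x y - sine_sum x y| <=
    112 / c / N + (a * (12 * (a * M) ^+ 2 + 4 * (a * M) + 5) + 5 * b) / Num.sqrt N.
Proof.
move=> M0 xM yM aM; have ct := @is_cvg_series_term x y.
set m1 := ((n0 - J) + (2 * J).+1)%N.
rewrite rescaled_gue_kernelE.
have cv : `|a * series (term x y) n - sine_sum x y| @[n --> \oo] -->
    `|a * limn (series (term x y)) - sine_sum x y|.
  apply: cvg_norm; apply: cvgB; last exact: cvg_cst.
  by apply: cvgM; [exact: cvg_cst|exact: ct].
rewrite -(cvg_lim _ cv)//; apply: limr_le; first by apply/cvg_ex; eexists; exact: cv.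
exists m1 => // n /= mn; rewrite -(subnKC mn) seriesEord.
exact: (kernel_close_fixed_scale hermite_h Psi01 Psi_nincr s0 c0 N1 b_gt0 bN n0N JN
  tail_right tail_left M0 xM yM aM).
Qed.

Lemma measurable_rescaled_gue_kernel :
  measurable_fun setT (fun p : R * R => rescaled_gue_kernel h Psi tau alpha N p.1 p.2).
Proof.
under eq_fun do rewrite rescaled_gue_kernelE.
apply: measurable_funM => //.
apply: (@measurable_fun_cvg _ _ _ _ (fun n p => series (term p.1 p.2) n)); last first.
  by move=> p _; exact: is_cvg_series_term.
have mpsi k : measurable_fun setT (fun z : R => psi h k (a * z)).
  apply: continuous_measurable_fun => z.
  apply: (@continuous_comp _ _ _ ( *%R a) (psi h k)); first exact: mulrl_continuous.
  by apply/differentiable_continuous/derivable1_diffP; case: (is_derive_psi h k (a * z)).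
move=> n; apply: measurable_sum => k.
apply: measurable_funM => //; apply: measurable_funM.
- exact: (measurableT_comp (mpsi _) measurable_fst).
- exact: (measurableT_comp (mpsi _) measurable_snd).
Qed.

Lemma measurable_sine_sum : measurable_fun setT (fun p : R * R => sine_sum p.1 p.2).
Proof.
apply: measurable_sum => i; apply: measurable_funM => //.
exact: measurable_sine_kernel.
Qed.

(** The weights are nonnegative with sum at most 1, and twice each frequency is at most 2 N^2. So
    generous a bound costs little, since it enters the traces only through a logarithm. *)
Lemma sine_sum_le x y : `|sine_sum x y| <= 2 * near_kernel (2 * N ^+ 2) x y.
Proof.
have Np := scale_gt0; have A0 : 0 < 2 * N ^+ 2 by rewrite mulr_gt0// exprn_gt0.
have G0 := near_kernel_gt0 x y A0; have J0 : 0 <= J%:R :> R by [].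
have b0 := b_gt0; have := JN; have := bN; have := N1 => N1' bN' JN'.
apply: (le_trans (ler_norm_sum _ _ _)).
apply: (@le_trans _ _ (\sum_(i < (2 * J).+1) (weight i - weight i.+1) * (2 * near_kernel (2 * N ^+ 2) x y))).
  apply: ler_sum => i _.
  have w0 : 0 <= weight i - weight i.+1.
    rewrite subr_ge0; apply: Psi_nincr; rewrite ler_wpM2r ?invr_ge0 ?(ltW s0)//.
    by rewrite lerD2r ler_nat.
  have iJR : i%:R <= 2 * J%:R :> R by rewrite -natrM ler_nat -ltnS.
  rewrite normrM (ger0_norm w0) ler_wpM2l//; apply: sine_kernel_le_near => //.
    by rewrite !mulr_ge0 ?sqrtr_ge0// ltW.
  have h2 : Num.sqrt (N + (i%:R - J%:R)) <= 2 * N.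
    apply: (@le_trans _ _ (Num.sqrt (2 * N))); first by rewrite ler_wsqrtr//; lra.
    rewrite -[leRHS]ger0_norm -?sqrtr_sqr; last by rewrite mulr_ge0// ltW.
    by rewrite ler_wsqrtr// ler_eXnr//; lra.
  have -> : 2 * (1 / 2 * b * Num.sqrt (N + (i%:R - J%:R))) = b * Num.sqrt (N + (i%:R - J%:R)) by field.
  by rewrite expr2 mulrCA ler_pM ?sqrtr_ge0// ltW.
rewrite -mulr_suml telescope_ord ler_piMl ?mulr_ge0 ?(ltW G0)//.
by have := Psi01 ((0%:R - J%:R) / s); have := Psi01 (((2 * J).+1%:R - J%:R) / s);
  rewrite /weight; move: (Psi _) (Psi _) => u v /andP[? ?] /andP[? ?]; lra.
Qed.

(** The mean value identity turns the coefficients into increments of Psi, an integer k satisfies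
    |k| <= Gamma N^alpha exactly when |k| <= J, and N^(1 - alpha) sqrt(1 + k/N) = b sqrt(N + k). *)
Lemma L_kernelE (Gamma : R) (eta xi : int -> R) x y :
  J%:R <= Gamma * N `^ alpha < J%:R + 1 ->
  mean_value_points Psi tau alpha N xi ->
  (forall k : int, eta k = 1 / 2 * N `^ (1 - alpha) * Num.sqrt (1 + k%:~R / N)) ->
  L_kernel Psi tau alpha Gamma eta xi N x y = sine_sum x y.
Proof.
move=> JG xiP etaE; have Np := scale_gt0.
pose shift (i : nat) : int := i%:Z - J%:Z.
have kE : [set k : int | `|k|%:~R <= Gamma * N `^ alpha] = [set k : int | `|k| <= J%:Z].
  have /andP[g1 g2] := JG; apply/seteqP; split => k /= kJ; last first.
    by apply: le_trans g1; rewrite -[J%:R]/(J%:Z%:~R) ler_int.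
  have : `|k|%:~R < (J%:Z + 1)%:~R :> R by apply: (le_lt_trans kJ); rewrite intrD.
  by rewrite ltr_int ltzD1.
rewrite /L_kernel kE (reindex_fsbig shift _ _ _ (int_window_bij J)) -fsbig_ord mulr_sumr.
apply: eq_bigr => i _; rewrite mulrA; have [_ ->] := xiP (shift i).
have -> : (shift i)%:~R = i%:R - J%:R :> R by rewrite /shift intrB.
have -> : (shift i + 1)%:~R = i.+1%:R - J%:R :> R by rewrite /shift intrD intrB -natr1 addrAC.
rewrite /weight etaE /shift intrB; congr (_ * sine_kernel _ _ _).
rewrite -mulrA -[RHS]mulrA; congr (_ * _).
have -> : N + (i%:R - J%:R) = N * (1 + (i%:R - J%:R) / N) by field; rewrite gt_eqF.
rewrite sqrtrM ?(ltW Np)// mulrA; congr (_ * _).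
by rewrite -(powR12_sqrt (ltW Np)) -powR_mulD//; congr (_ `^ _); field.
Qed.

End kernels_at_large_scale.

Section decay.
Context {R : realType}.

Lemma powR_log_decay (d D Q e : R) (n : nat) : 0 < d -> 0 <= D -> 0 <= Q -> 0 < e ->
  \forall N \near +oo%R, N `^ (- d) * (Q * ln (1 + D * N ^+ 2)) ^+ n < e.
Proof.
move=> d0 D0 Q0 e0.
have n0 : 0 < 2 * n.+1%:R :> R by rewrite mulr_gt0.
(* Bounding the logarithm by a multiple of N^r, its n-th power costs less than N^(d/2), half of the
   available decay; the other half beats the constants. *)
pose r := d / (2 * n.+1%:R); have r0 : 0 < r by rewrite divr_gt0.
pose E := Q * (ln (1 + D) + 2 * r^-1).
have lD : 0 <= ln (1 + D) by rewrite ln_ge0// lerDl.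
have E0 : 0 <= E by rewrite mulr_ge0// addr_ge0// mulr_ge0// invr_ge0 ltW.
have d2 : 0 < d / 2 by rewrite divr_gt0.
have h1 := @near_pinfty_powR_ge R ((E ^+ n + 1) / e) (d / 2) d2.
have h2 := nbhs_pinfty_ge (num_real (1 : R)).
apply: filterS2 h1 h2 => N h1 N1.
have N0 : 0 < N := lt_le_trans ltr01 N1.
have Nr1 : 1 <= N `^ r by rewrite -[leLHS](powRr0 N) ler_powR// ltW.
have lN : ln (1 + D * N ^+ 2) <= (ln (1 + D) + 2 * r^-1) * N `^ r.
  apply: (@le_trans _ _ (ln ((1 + D) * N ^+ 2))).
    rewrite ler_ln ?posrE; last 2 first.
    - by rewrite ltr_wpDr// mulr_ge0// exprn_ge0// ltW.
    - by rewrite mulr_gt0 ?exprn_gt0// ltr_wpDr.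
    by rewrite mulrDl mul1r lerD2r exprn_ege1.
  rewrite lnM ?posrE ?exprn_gt0 ?ltr_wpDr// lnXn// mulrDl lerD//.
    by rewrite ler_peMr.
  by rewrite -[leLHS]mulr_natl -mulrA ler_pM2l// ln_le_powR.
have l0 : 0 <= ln (1 + D * N ^+ 2) by rewrite ln_ge0// lerDl mulr_ge0// exprn_ge0// ltW.
have P0 : 0 < N `^ (- d) by rewrite powR_gt0.
apply: (@le_lt_trans _ _ (E ^+ n * N `^ (- (d / 2)))).
  apply: (@le_trans _ _ (N `^ (- d) * (E * N `^ r) ^+ n)).
    rewrite ler_pM2l//; apply: lerXn2r; rewrite ?nnegrE; [exact: mulr_ge0| |].
      by rewrite mulr_ge0// powR_ge0.
    by rewrite /E -mulrA ler_wpM2l.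
  rewrite exprMn mulrCA ler_wpM2l ?exprn_ge0//.
  rewrite -powR_mulrn ?powR_ge0// -powRrM -powR_mulD// ler_powR//.
  have n1E : n.+1%:R = n%:R + 1 :> R by rewrite natr1.
  rewrite /r n1E; have : 0 <= n%:R :> R by [].
  move: (n%:R) => z z0; rewrite -subr_ge0.
  have -> : - (d / 2) - (- d + d / (2 * (z + 1)) * z) = d / (2 * (z + 1)).
    by field; rewrite gt_eqF// ltr_wpDl.
  by rewrite divr_ge0 ?(ltW d0)// mulr_ge0// addr_ge0.
rewrite powRN ltr_pdivrMr ?powR_gt0//.
move: h1; rewrite ler_pdivrMr// mulrC; apply: lt_le_trans.
by rewrite ltrDl.
Qed.

End decay.

(** * Uniform comparison for large N *)

Section comparison.
Context {R : realType}.
Variables (h : nat -> {poly R}) (Psi : R -> R) (tau alpha : R) (xi : R -> int -> R).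
Hypothesis hermite_h : orthonormal_hermite h.
Hypothesis Psi_shape : is_shape_star Psi.
Hypotheses (tau_gt0 : 0 < tau) (alpha_gt : 1 / 3 < alpha) (alpha_lt1 : alpha < 1).
Hypothesis xi_mvt : forall N : R, 0 < N -> mean_value_points Psi tau alpha N (xi N).

Let K N := rescaled_gue_kernel h Psi tau alpha N.
Let L N := L_kernel Psi tau alpha (ln N ^+ 2)
  (fun k => 1 / 2 * N `^ (1 - alpha) * Num.sqrt (1 + k%:~R / N)) (xi N) N.

(** The terms 1/N and b^j / sqrt N, j = 1, 2, 3, have the exponents -1, -alpha, 1/2 - 2 alpha and 1
    - 3 alpha. Half of the last one dominates all four for 1/3 < alpha < 1. The numbers 324, 36 and
    20 come from a <= 3 b. *)
Lemma error_term_le (c M N b a : R) : 0 < c -> 0 <= M -> 1 <= N ->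
  b = N `^ (1 / 2 - alpha) -> a = pi * b / Num.sqrt 2 ->
  112 / c / N + (a * (12 * (a * M) ^+ 2 + 4 * (a * M) + 5) + 5 * b) / Num.sqrt N <=
  (112 / c + 324 * M ^+ 2 + 36 * M + 20) * N `^ (- ((3 * alpha - 1) / 2)).
Proof.
move=> c0 M0 N1 bE aE; have N0 : 0 < N := lt_le_trans ltr01 N1.
have b0 : 0 < b by rewrite bE powR_gt0.
have [a0 ab] := a_bounds b0; rewrite -aE in a0 ab.
have ag := alpha_gt; have al := alpha_lt1.
have a3 : 1 <= 3 * alpha by move: ag; rewrite ltr_pdivrMr// mulrC => /ltW.
set D := N `^ _.
have le_D (r : R) : r <= - ((3 * alpha - 1) / 2) -> N `^ r <= D by move=> hr; rewrite ler_powR.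
have sE : (Num.sqrt N)^-1 = N `^ (- (1 / 2)) by rewrite powRN div1r powR12_sqrt// ltW.
have q1 : N^-1 <= D.
  rewrite -(powRr1 (ltW N0)) -powRN; apply: le_D; lra.
have q2 : b / Num.sqrt N <= D by rewrite sE bE -powR_mulD//; apply: le_D; lra.
have q3 : b ^+ 2 / Num.sqrt N <= D.
  by rewrite sE expr2 bE -!powR_mulD//; apply: le_D; lra.
have q4 : b ^+ 3 / Num.sqrt N <= D.
  by rewrite sE exprS expr2 bE -!powR_mulD//; apply: le_D; lra.
have aM0 : 0 <= a * M by rewrite mulr_ge0// ltW.
have aMb : a * M <= 3 * b * M by rewrite ler_wpM2r.
apply: (@le_trans _ _ (112 / c / N + (3 * b * (12 * (3 * b * M) ^+ 2 + 4 * (3 * b * M) + 5) + 5 * b) / Num.sqrt N)).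
  rewrite lerD2l ler_wpM2r ?invr_ge0 ?sqrtr_ge0// lerD2r.
  apply: ler_pM => //; first exact: ltW.
    apply: addr_ge0 => //; apply: addr_ge0; first by rewrite mulr_ge0// exprn_ge0.
    by rewrite mulr_ge0.
  rewrite lerD2r lerD// ?ler_pM2l// lerXn2r ?nnegrE//.
  exact: le_trans aMb.
have -> : 112 / c / N + (3 * b * (12 * (3 * b * M) ^+ 2 + 4 * (3 * b * M) + 5) + 5 * b) / Num.sqrt N =
   112 / c * N^-1 + 324 * M ^+ 2 * (b ^+ 3 / Num.sqrt N) + 36 * M * (b ^+ 2 / Num.sqrt N) +
   20 * (b / Num.sqrt N) by ring.
have p1 : 0 <= 112 / c by rewrite divr_ge0// ltW.
have p2 : 0 <= 324 * M ^+ 2 by rewrite mulr_ge0 ?ler0n ?exprn_ge0.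
have p3 : 0 <= 36 * M by rewrite mulr_ge0 ?ler0n.
have -> : (112 / c + 324 * M ^+ 2 + 36 * M + 20) * D =
  112 / c * D + 324 * M ^+ 2 * D + 36 * M * D + 20 * D by ring.
apply: lerD; last by rewrite ler_pM2l.
apply: lerD; last exact: ler_wpM2l.
by apply: lerD; exact: ler_wpM2l.
Qed.

Lemma kernels_close (M : R) : 0 <= M -> exists2 C : R, 0 <= C &
  \forall N \near +oo%R, [/\ 1 <= N,
    measurable_fun setT (fun p : R * R => K N p.1 p.2),
    measurable_fun setT (fun p : R * R => L N p.1 p.2),
    forall x y, `|x| <= M -> `|y| <= M ->
      `|K N x y - L N x y| <= C * N `^ (- ((3 * alpha - 1) / 2)) &
    forall x y, `|L N x y| <= 2 * near_kernel (2 * N ^+ 2) x y].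
Proof.
move=> M0; have [c c0 tails] := shape_star_tails Psi_shape.
exists (112 / c + 324 * M ^+ 2 + 36 * M + 20).
  have p1 : 0 <= 112 / c by rewrite divr_ge0// ltW.
  have p2 : 0 <= 324 * M ^+ 2 by rewrite mulr_ge0 ?ler0n ?exprn_ge0.
  have p3 : 0 <= 36 * M by rewrite mulr_ge0 ?ler0n.
  exact: (addr_ge0 (addr_ge0 (addr_ge0 p1 p2) p3) (ler0n R 20)).
have al0 : 0 < alpha by apply: lt_trans alpha_gt; rewrite divr_gt0.
have al2 : 0 < 2 * alpha by rewrite mulr_gt0.
have h1 := nbhs_pinfty_ge (num_real (8 : R)).
have h2 := log_sqr_powR_small alpha_lt1.
have h3 := exp_tail_le_pow8 al0 alpha_lt1 tau_gt0 c0.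
(* This yields 2 (a M)^2 <= 18 M^2 b^2 <= N, since a <= 3 b and N = N^(2 alpha) b^2. *)
have h4 := @near_pinfty_powR_ge R (18 * M ^+ 2) _ al2.
apply: filterS2 (filterI h1 h2) (filterI h3 h4) => N [/= N8 GN] [/= tailN MN].
have N1 : 1 <= N by apply: le_trans N8; rewrite ler1n.
have N0 : 0 < N := lt_le_trans ltr01 N1.
have G0 : 0 <= ln N ^+ 2 * N `^ alpha by rewrite mulr_ge0 ?sqr_ge0 ?powR_ge0.
pose J := Num.truncn (ln N ^+ 2 * N `^ alpha).
have JG : J%:R <= ln N ^+ 2 * N `^ alpha < J%:R + 1 by rewrite natr1 truncn_itv.
have n0N : (Num.truncn N)%:R <= N < (Num.truncn N)%:R + 1 by rewrite natr1 truncn_itv// ltW.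
have s0 : 0 < tau * N `^ alpha by rewrite mulr_gt0// powR_gt0.
have JN : 4 * (J%:R + 1) <= N by case/andP: JG => ? ?; lra.
have bN : N `^ (1 / 2 - alpha) <= N.
  rewrite -[leRHS](powRr1 (ltW N0)) ler_powR//; have := al0; lra.
have tail (X : R) : J%:R <= X -> [/\ 0 <= X / (tau * N `^ alpha) &
    c^-1 * expR (- (c * (X / (tau * N `^ alpha)))) <= c^-1 * ((N + X) ^+ 8)^-1].
  move=> JX; have X0 : 0 <= X by apply: le_trans JX.
  split; first by rewrite divr_ge0// ltW.
  rewrite ler_pM2l ?invr_gt0// tailN//; case/andP: JG => ? ?; lra.
have tr (X : R) : J%:R <= X -> Psi (X / (tau * N `^ alpha)) <= c^-1 * ((N + X) ^+ 8)^-1.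
  by move=> /tail [X0]; apply: le_trans; case: (tails _ X0).
have tl (X : R) : J%:R <= X -> 1 - Psi (- X / (tau * N `^ alpha)) <= c^-1 * ((N + X) ^+ 8)^-1.
  by move=> /tail [X0]; apply: le_trans; rewrite mulNr; case: (tails _ X0).
have P01 := shape_itv Psi_shape.1.
have Pni u v : u <= v -> Psi v <= Psi u := shape_nincr Psi_shape.1.
have LE x y := L_kernelE (Psi := Psi) (tau := tau) N1 x y JG (xi_mvt N0) (fun k => erefl).
have aM : 2 * (pi * N `^ (1 / 2 - alpha) / Num.sqrt 2 * M) ^+ 2 <= N.
  have b0 : 0 < N `^ (1 / 2 - alpha) by rewrite powR_gt0.
  have [a0 ab] := a_bounds b0.
  have e1 : 2 * alpha + (1 / 2 - alpha + (1 / 2 - alpha)) = 1 by field.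
  have eN : N `^ (2 * alpha) * N `^ (1 / 2 - alpha) ^+ 2 = N.
    by rewrite expr2 -!powR_mulD// e1 powRr1// ltW.
  move: (pi * _ / _) a0 ab => A a0 ab; rewrite -[leRHS]eN.
  apply: (@le_trans _ _ (18 * M ^+ 2 * N `^ (1 / 2 - alpha) ^+ 2)).
    rewrite (_ : 18 * M ^+ 2 * _ = 2 * (3 * N `^ (1 / 2 - alpha) * M) ^+ 2); last by ring.
    rewrite ler_pM2l// lerXn2r ?nnegrE ?mulr_ge0 ?(ltW b0) ?(ltW a0)//.
    by rewrite ler_wpM2r.
  by rewrite ler_wpM2r ?sqr_ge0.
split => //.
- exact: (measurable_rescaled_gue_kernel hermite_h P01 c0 N1 bN n0N JN tr).
- by rewrite /L; under eq_fun do rewrite LE; exact: measurable_sine_sum.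
- move=> x y xM yM; rewrite /L LE.
  apply: (le_trans (rescaled_gue_kernel_close hermite_h P01 Pni s0 c0 N1 bN n0N JN tr tl M0 xM yM aM)).
  exact: error_term_le c0 M0 N1 erefl erefl.
- by move=> x y; rewrite /L LE; exact: (sine_sum_le P01 Pni s0 N1 bN JN).
Qed.

End comparison.

(** * Test functions and conclusion *)

Section test_functions.
Context {R : realType}.

Lemma smooth_compact_support_bounded (f : R -> R) : smooth_compact_support f ->
  exists2 M : R, 0 < M & (forall x, M < `|x| -> f x = 0) /\
    (forall x, `|f x| <= M) /\ measurable_fun setT f.
Proof.
move=> [df cf].
have fc : continuous f.
  by move=> x; apply/differentiable_continuous/derivable1_diffP; exact: (df 0%N x).
have [M1 [_ M1P]] := compact_bounded cf.
have [M2 [_ M2P]] := compact_bounded (continuous_compact (continuous_subspaceT fc) cf).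
pose M := Num.max (Num.max M1 M2 + 1) 1.
have M1M : M1 < M by rewrite /M lt_max ltr_pwDr// le_max lexx.
have M2M : M2 < M by rewrite /M lt_max ltr_pwDr// le_max lexx orbT.
have M0 : 0 < M by rewrite lt_max ltr01 orbT.
exists M => //; have supp x : f x != 0 -> closure [set x | f x != 0] x.
  by move=> fx; exact: subset_closure.
split; [|split].
- move=> x Mx; apply/eqP; apply: contraTT Mx => /supp fx.
  by rewrite -leNgt; exact: M1P M1M x fx.
- move=> x; have [->|/supp fx] := eqVneq (f x) 0; first by rewrite normr0 ltW.
  by apply: (M2P _ M2M); exists x.
- exact: continuous_measurable_fun.
Qed.

Lemma smooth_compact_support_uniform n (f : 'I_n -> R -> R) :
  (forall i, smooth_compact_support (f i)) ->
  exists2 M : R, 0 < M & forall i, (forall x, M < `|x| -> f i x = 0) /\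
    (forall x, `|f i x| <= M) /\ measurable_fun setT (f i).
Proof.
move=> fs; have /choice[m mP] : forall i, exists m : R, 0 < m /\ (forall x, m < `|x| -> f i x = 0) /\
    (forall x, `|f i x| <= m) /\ measurable_fun setT (f i).
  by move=> i; have [m m0 mP] := smooth_compact_support_bounded (fs i); exists m.
have mle i : m i <= 1 + \sum_j m j.
  rewrite (bigD1 i)//= addrCA lerDl addr_ge0// sumr_ge0// => j _.
  by have [/ltW] := mP j.
exists (1 + \sum_j m j).
  by rewrite ltr_pwDl// sumr_ge0// => j _; have [/ltW] := mP j.
move=> i; have [_ [h1 [h2 h3]]] := mP i; split; last split => //.
- by move=> x hx; apply: h1; apply: le_lt_trans hx.
- by move=> x; apply: (le_trans (h2 x)).
Qed.

End test_functions.

Theorem proposition1p11 (R : realType) (h : nat -> {poly R})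
    (hermite_h : orthonormal_hermite h)
    (Psi : R -> R) (Psi_shape : is_shape_star Psi) (B2_Psi : B2 Psi = 1%:E)
    (tau : R) (tau_gt0 : 0 < tau)
    (alpha : R) (alpha_gt : 1 / 3 < alpha) (alpha_lt1 : alpha < 1)
    (xi : R -> int -> R)
    (xi_mvt : forall N : R, 0 < N -> mean_value_points Psi tau alpha N (xi N)) :
  let Gamma (N : R) : R := ln N ^+ 2 in
  let eta (N : R) (k : int) : R :=
    1 / 2 * N `^ (1 - alpha) * Num.sqrt (1 + k%:~R / N) in
  asymptotically_equivalent
    (fun N x y => rescaled_gue_kernel h Psi tau alpha N x y)
    (fun N x y => L_kernel Psi tau alpha (Gamma N) (eta N) (xi N) N x y).
Proof.
move=> Gamma eta [|n] f fs.
  (* A trace with no factor is 1 for both kernels. *)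
  rewrite (_ : (fun N : R => _) = fun=> 0); first exact: cvg_cst.
  by apply/funext => N; rewrite /kernel_trace /= !big_ord0 subrr.
have [M M0 fM] := smooth_compact_support_uniform fs.
have [C0 C00 near_close] := kernels_close hermite_h Psi_shape tau_gt0 alpha_gt alpha_lt1 xi_mvt (ltW M0).
set d := (3 * alpha - 1) / 2 in near_close.
have d0 : 0 < d.
  by rewrite divr_gt0// subr_gt0; move: alpha_gt; rewrite ltr_pdivrMr// mulrC.
(* The near-diagonal bound on K is inherited from L: 2 bounds L, [C0] bounds the difference, and on
   the square a constant is at most 1 + 2 M times the same constant times [near_kernel]. *)
pose C := 2 + C0 * (1 + 2 * M).
have C_ge0 : 0 <= C by rewrite addr_ge0// mulr_ge0// addr_ge0// mulr_ge0// ltW.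
pose c := 2 * M * (M * (C0 * n.+1%:R)).
have c0 : 0 <= c by rewrite !mulr_ge0// ltW.
apply/cvgrPdist_lt => e e0.
have ec : 0 < e / (c + 1) by rewrite divr_gt0// ltr_wpDl.
have D0 : 0 <= 4 * M by rewrite mulr_ge0// ltW.
have Q0 : 0 <= 4 * C * M by rewrite !mulr_ge0// ltW.
have decay := @powR_log_decay R d (4 * M) (4 * C * M) _ n d0 D0 Q0 ec.
apply: filterS2 near_close decay => N [N1 mK mL KL L2] decN.
rewrite sub0r normrN.
have N0 : 0 < N := lt_le_trans ltr01 N1.
have A0 : 0 < 2 * N ^+ 2 by rewrite mulr_gt0// exprn_gt0.
have A1 : 1 <= 2 * N ^+ 2 by rewrite mulr_ege1 ?exprn_ege1// ler1n.
have G0 x y := near_kernel_gt0 x y A0.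
have Nd : N `^ (- d) <= 1 by rewrite -[leRHS](powRr0 N) ler_powR// oppr_le0 ltW.
have Gge x y : `|x| <= M -> `|y| <= M -> 1 <= (1 + 2 * M) * near_kernel (2 * N ^+ 2) x y.
  move=> xM yM; rewrite ler_pdivlMr ?mul1r; last by rewrite ltr_wpDr// invr_gt0.
  rewrite lerD ?invf_le1//; apply: (le_trans (ler_normB _ _)); lra.
have LC x y : `|x| <= M -> `|y| <= M ->
    `|L_kernel Psi tau alpha (Gamma N) (eta N) (xi N) N x y| <= C * near_kernel (2 * N ^+ 2) x y.
  move=> xM yM; apply: (le_trans (L2 x y)); rewrite ler_wpM2r ?(ltW (G0 x y))//.
  by rewrite lerDl mulr_ge0// addr_ge0// mulr_ge0// ltW.
have KC x y : `|x| <= M -> `|y| <= M ->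
    `|rescaled_gue_kernel h Psi tau alpha N x y| <= C * near_kernel (2 * N ^+ 2) x y.
  move=> xM yM; rewrite mulrDl -mulrA.
  have := KL x y xM yM => KLxy.
  rewrite -[rescaled_gue_kernel _ _ _ _ _ _ _](subrK
    (L_kernel Psi tau alpha (Gamma N) (eta N) (xi N) N x y)) addrC.
  apply: (le_trans (ler_normD _ _)); apply: lerD; first exact: L2.
  apply: (le_trans KLxy); rewrite ler_wpM2l//; apply: (le_trans Nd); exact: Gge.
have e'0 : 0 <= C0 * N `^ (- d) by rewrite mulr_ge0// powR_ge0.
have := kernel_trace_close A0 M0 (ltW M0) C_ge0 e'0 (fun i => (fM i).2.2)
  (fun i => (fM i).1) (fun i => (fM i).2.1) mK mL KC LC KL.
move=> /le_lt_trans; apply.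
rewrite (_ : 2 * C * M * (2 * ln (1 + 2 * M * (2 * N ^+ 2))) = 4 * C * M * ln (1 + 4 * M * N ^+ 2)); last first.
  rewrite (_ : 2 * M * (2 * N ^+ 2) = 4 * M * N ^+ 2); last by ring.
  by move: (ln _) => l; ring.
move: (_ ^+ n) decN => q decN.
rewrite (_ : _ * _ = c * (N `^ (- d) * q)); last by rewrite /c; ring.
have c1 : 0 < c + 1 by rewrite ltr_wpDl.
apply: (@le_lt_trans _ _ (c * (e / (c + 1)))); first by rewrite ler_wpM2l// ltW.
by rewrite mulrCA gtr_pMr// ltr_pdivrMr// mul1r ltrDl.
Qed.
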